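(* Let $d\ge1$, let $F:\mathcal{S}\to\mathbb{R}$ be a rotation-invariant function on the space $\mathcal{S}$ of real symmetric $d\times d$ matrices, and let $f$ be its restriction to the subspace $\mathcal{D}$ of diagonal matrices. Then: (i) if $f$ is $C^\infty$ on $\mathcal{D}$, then $F$ is $C^\infty$ on $\mathcal{S}$; (ii) for every integer $n\ge0$ and every $0<\alpha<1$, if $f$ is $C^{n,\alpha}$ on $\mathcal{D}$, then $F$ is $C^{n,\alpha}$ on $\mathcal{S}$; (iii) if $f$ is (real) analytic on $\mathcal{D}$, then $F$ is (real) analytic on $\mathcal{S}$.
   Context: $\mathcal{S}$ is the vector space of real $d\times d$ symmetric matrices, $\mathcal{D}\subset\mathcal{S}$ is the subspace of diagonal matrices, and $G$ is the group of $d\times d$ rotation matrices (real orthogonal matrices of determinant $1$). A function $F:\mathcal{S}\to\mathbb{R}$ is rotation-invariant if $F(gxg^{-1})=F(x)$ for every $x\in\mathcal{S}$ and $g\in G$. A function is $C^{n,\alpha}$ if it is $C^n$ and its $n$-th derivative is locally H\''older continuous with exponent $\alpha$. *)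

(* Defs.v *)
From HB Require Import structures.
From mathcomp Require Import all_boot all_order all_algebra.
From mathcomp Require Import all_classical all_reals all_analysis.

Set Implicit Arguments.
Unset Strict Implicit.
Unset Printing Implicit Defensive.

Import Order.TTheory GRing.Theory Num.Theory.
Import numFieldNormedType.Exports.

Local Open Scope classical_set_scope.
Local Open Scope ring_scope.

(* A linear subspace U of a normed module V, as a type carrying the norm
   induced from V. *)
Record normed_submod (R : numFieldType) (V : normedModType R)
    (U : submodClosed V) := NormedSubmod {
  submod_val : V;
  submod_valP : submod_val \in U }.

Section normed_submod.
Context (R : numFieldType) (V : normedModType R) (U : submodClosed V).
Local Notation T := (normed_submod U).

HB.instance Definition _ := [isSub for @submod_val R V U].
HB.instance Definition _ := [Choice of T by <:].
HB.instance Definition _ := [SubChoice_isSubLmodule of T by <:].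

Let norm (x : T) : R := `|\val x|.

Let norm_triangle x y : norm (x + y) <= norm x + norm y.
Proof. by rewrite /norm raddfD ler_normD. Qed.

Let norm_scale (l : R) x : norm (l *: x) = `|l| * norm x.
Proof. by rewrite /norm linearZ /= normrZ. Qed.

Let norm_eq0 x : norm x = 0 -> x = 0.
Proof. by move=> /normr0_eq0 x0; apply/val_inj; rewrite x0 raddf0. Qed.

HB.instance Definition _ :=
  Lmodule_isNormed.Build R T norm_triangle norm_scale norm_eq0.

Lemma normed_submod_normE (x : T) : `|x| = `|\val x|.
Proof. by []. Qed.

End normed_submod.

Section smoothness.
Context {R : realType} {V : normedModType R}.
Implicit Types (f : V -> R) (a x y h : V) (vs : seq V).

(* [iter_diff f [:: v_1; ...; v_k] x] is D^k f(x)(v_1, ..., v_k), obtained by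
   differentiating the map x |-> D^(k-1) f(x)(v_2, ..., v_k) along v_1. *)
Definition iter_diff f vs : V -> R :=
  foldr (fun v (g : V -> R) x => 'd g x v) f vs.

(* V is meant to be finite-dimensional, so that differentiability and
   continuity of a map into k-linear forms can be tested on each k-tuple of
   vectors. *)
Definition is_Cn n f : Prop :=
  (forall vs, (size vs < n)%N -> forall x, differentiable (iter_diff f vs) x) /\
  (forall vs, (size vs <= n)%N -> continuous (iter_diff f vs)).

Definition is_Cinfty f : Prop := forall n, is_Cn n f.

(* The inequality says that the operator norm of D^n f(x) - D^n f(y) is at
   most C |x - y|^alpha. *)
Definition is_holder n (alpha : R) f : Prop :=
  is_Cn n f /\
  forall a, exists2 W, nbhs a W & exists C : R,
    forall x y, W x -> W y -> forall vs, size vs = n ->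
      `|iter_diff f vs x - iter_diff f vs y| <=
        C * `|x - y| `^ alpha * \prod_(v <- vs) `|v|.

Definition multilinear k (A : ('I_k -> V) -> R) : Prop :=
  forall (v : 'I_k -> V) (i : 'I_k), scalar (fun u : V => A (@dfwith _ (fun=> V) v i u)).

(* Near every point a, f is the sum of a convergent power series
   sum_k A_k(h, ..., h) in h = x - a, given by k-linear forms A_k. The bound
   by C r^-k on the norms of the A_k says that the radius of convergence is at
   least r; in coordinates it is an absolutely convergent multivariate power
   series. *)
Definition is_analytic f : Prop :=
  forall a, exists (A : forall k, ('I_k -> V) -> R) (C r : R),
    [/\ 0 < r,
        forall k, multilinear (A k),
        forall k (v : 'I_k -> V), `|A k v| <= C * r ^- k * \prod_i `|v i| &
        forall h, `|h| < r ->
          series (fun k => A k (fun=> h)) @ \oo --> f (a + h)].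

End smoothness.

Section matrices.
Context (R : realType) (d : nat).

Definition sym_pred : {pred 'M[R]_d} := fun x => x \is symmetricmx.

Lemma sym_predP (x : 'M[R]_d) : reflect (x^T = x) (x \in sym_pred).
Proof.
apply: (iffP (is_hermitianmxP _ _ _)); rewrite expr0 scale1r map_mx_id //.
Qed.

Lemma sym_submod_closed : submod_closed sym_pred.
Proof.
split=> [|a x y /sym_predP xs /sym_predP ys]; apply/sym_predP.
  exact: trmx0.
by rewrite linearP /= xs ys.
Qed.

HB.instance Definition _ :=
  GRing.isSubmodClosed.Build R 'M[R]_d sym_pred sym_submod_closed.

(* The norm inherited from 'M[R]_d is the maximum norm; in finite dimension the
   regularity classes above do not depend on the choice of norm. *)
Definition symmx := normed_submod sym_pred.
HB.instance Definition _ := NormedModule.on symmx.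
HB.instance Definition _ := SubType.on symmx.

Definition diag_pred : {pred symmx} := fun x => is_diag_mx (\val x).

Lemma diag_submod_closed : submod_closed diag_pred.
Proof.
split=> [|a x y /is_diag_mxP xd /is_diag_mxP yd]; apply/is_diag_mxP => i j ij.
  by rewrite raddf0 mxE.
by rewrite linearP !mxE xd // yd // mulr0 addr0.
Qed.

HB.instance Definition _ :=
  GRing.isSubmodClosed.Build R symmx diag_pred diag_submod_closed.

Definition diagmx := normed_submod diag_pred.
HB.instance Definition _ := NormedModule.on diagmx.
HB.instance Definition _ := SubType.on diagmx.

Definition rotation : {pred 'M[R]_d} :=
  fun g => (g *m g^T == 1%:M) && (\det g == 1).

Lemma rotation_inv g : g \in rotation -> invmx g = g^T.
Proof.
move=> /andP[/eqP gg _]; have [gu _] := mulmx1_unit gg.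
by rewrite -[LHS]mulmx1 -gg mulKmx.
Qed.

Lemma rot_conj_subproof g (x : symmx) :
  g \in rotation -> g *m \val x *m invmx g \in sym_pred.
Proof.
move=> /rotation_inv ->; apply/sym_predP.
by rewrite !trmx_mul trmxK (sym_predP _ (valP x)) mulmxA.
Qed.

Definition rot_conj g (gG : g \in rotation) (x : symmx) : symmx :=
  NormedSubmod (rot_conj_subproof x gG).

Definition rotation_invariant (F : symmx -> R) : Prop :=
  forall g (gG : g \in rotation) x, F (rot_conj gG x) = F x.

Definition restrict_diag (F : symmx -> R) : diagmx -> R := F \o \val.

End matrices.

(* Main.v *)
(* Each of the three regularity classes is a class of functions that are well
   approximated by polynomials: C^(n,alpha) corresponds to an error of order
   N^-(n+alpha) for polynomials of degree N, and analyticity to a geometric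
   error (Jackson's direct theorems and Bernstein's inverse theorems). So it is
   enough to carry polynomial approximations over from diagonal to symmetric
   matrices.
   Write phi l = F (diag l), a symmetric function of the eigenvalues l. Jackson's
   theorem along the coordinate lines, combined with de la Vallee Poussin
   operators in each variable, approximates phi on a cube by sums of products
   u_1(l_1) ... u_d(l_d), of degree O(N). Averaged over the permutations of l,
   such a product becomes a polynomial in the matrix x: it is the polarization
   of the determinant, evaluated at u_1(x), ..., u_d(x). Since phi is symmetric,
   averaging does not increase the error, and every symmetric matrix is
   rotation-conjugate to a diagonal one, so F is approximated by polynomials of
   degree O(N) with the same rate as phi, uniformly on bounded sets. *)
Require Import Defs.
From HB Require Import structures.
From mathcomp Require Import all_boot all_order all_fingroup all_algebra.
From mathcomp Require Import all_classical all_reals all_analysis.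
From mathcomp Require Import ring lra zify.

Set Implicit Arguments.
Unset Strict Implicit.
Unset Printing Implicit Defensive.

Import Order.TTheory GRing.Theory Num.Theory.
Import numFieldNormedType.Exports.

Local Open Scope classical_set_scope.
Local Open Scope ring_scope.

(** * Chebyshev polynomials and trigonometric kernels *)

Section Chebyshev.
Context {R : realType}.
Implicit Types (p : {poly R}) (x y s t : R).

(** The obstacle is that the eigenvalues of [x] are in general not differentiable where they
    collide. A polynomial in [x] does not see collisions, so only polynomials cross from diagonal to
    symmetric matrices. Every approximation operator is a finite sum over the nodes
    [cos (2 pi k / M)] rather than an integral, because discrete orthogonality of Chebyshev
    polynomials is exact below the aliasing degree and makes all identities algebraic. The inverse
    theorems differentiate only at the midpoint of a segment of fixed length, where a derivative
    costs a factor linear in the degree; the quadratic factor of Markov's inequality at an endpoint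
    would lose derivatives. In the analytic class, growth off the interval is controlled by bounding
    coefficients through the Chebyshev basis, so that no complex variable enters. The smooth class
    is reduced to the Holder one: [C^(n+1)] on the diagonal yields [C^(n,1/2)] for [F], for each
    [n]. Working with rotations instead of all orthogonal matrices costs only a diagonal sign
    matrix, which commutes with diagonal matrices. *)

Fixpoint chebT (n : nat) : {poly R} :=
  match n with
  | 0 => 1
  | m.+1 => match m with
            | 0 => 'X
            | k.+1 => 2%:P * 'X * chebT m - chebT k
            end
  end.

Lemma chebTSS n : chebT n.+2 = 2%:P * 'X * chebT n.+1 - chebT n.
Proof. by []. Qed.

Lemma nat_ind2 (P : nat -> Prop) :
  P 0%N -> P 1%N -> (forall n, P n -> P n.+1 -> P n.+2) -> forall n, P n.
Proof.
move=> P0 P1 PS n; suff: P n /\ P n.+1 by case.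
by elim: n => [//|n [Pn PnS]]; split=> //; exact: PS.
Qed.

Lemma chebT_cos n t : (chebT n).[cos t] = cos (n%:R * t).
Proof.
elim/nat_ind2: n => [||n IH0 IH1].
- by rewrite hornerC mul0r cos0.
- by rewrite hornerX mul1r.
rewrite chebTSS hornerD hornerN !hornerM hornerC hornerX IH0 IH1.
rewrite (_ : n.+2%:R * t = n.+1%:R * t + t); last by rewrite -[n.+2%N]addn1 natrD; ring.
rewrite (_ : n%:R * t = n.+1%:R * t - t); last by rewrite -[n.+1%N]addn1 natrD; ring.
by rewrite cosB cosD; ring.
Qed.

Lemma size_chebT n : (size (chebT n) <= n.+1)%N.
Proof.
elim/nat_ind2: n => [||n IH0 IH1]; first by rewrite size_polyC oner_eq0.
- by rewrite size_polyX.
rewrite chebTSS (leq_trans (size_polyD _ _))// size_polyN geq_max.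
apply/andP; split; last by apply: leq_trans IH0 _; rewrite ltnW.
rewrite -mulrA mul_polyC (leq_trans (size_scale_leq _ _))// mulrC.
by rewrite (leq_trans (size_polyMleq _ _))// size_polyX addn2.
Qed.

Lemma lead_chebT n : (chebT n)`_n != 0.
Proof.
case: n => [|n]; first by rewrite coefC eqxx oner_neq0.
suff -> : (chebT n.+1)`_n.+1 = 2 ^+ n by rewrite expf_neq0// pnatr_eq0.
elim: n => [|n IH]; first by rewrite coefX eqxx expr0.
rewrite chebTSS coefB -mulrA coefCM coefXM/= IH.
by rewrite (nth_default _ (leq_trans (size_chebT _) _)) ?subr0 ?exprS.
Qed.

Lemma chebT_basis n p : (size p <= n)%N ->
  exists a : nat -> R, p = \sum_(j < n) a j *: chebT j.
Proof.
elim: n p => [p|n IH p sp].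
  by rewrite leqn0 size_poly_eq0 => /eqP ->; exists (fun=> 0); rewrite big_ord0.
pose c := p`_n / (chebT n)`_n.
have [|a pa] := IH (p - c *: chebT n).
  apply/leq_sizeP => j; rewrite leq_eqVlt => /orP[/eqP <-|nj].
    by rewrite coefB coefZ /c divfK ?subrr// lead_chebT.
  rewrite coefB coefZ (nth_default _ (leq_trans sp _))//.
  by rewrite (nth_default _ (leq_trans (size_chebT _) _))// mulr0 subrr.
exists (fun j => if j == n then c else a j).
rewrite big_ord_recr/= eqxx.
under eq_bigr => i _ do rewrite (ltn_eqF (ltn_ord i)).
by rewrite -pa subrK.
Qed.

Lemma chebT_deriv0 n : (chebT n)^`().[0] = n%:R * sin (n%:R * (pi / 2)).
Proof.
have T0 m : (chebT m).[0] = cos (m%:R * (pi / 2)).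
  by rewrite -[in LHS](cos_pihalf R) chebT_cos.
elim/nat_ind2: n => [||n IH0 IH1].
- by rewrite derivC hornerC mul0r.
- by rewrite derivX hornerC !mul1r sin_pihalf.
rewrite chebTSS derivB !derivM derivC derivX !mul0r add0r mulr1.
rewrite hornerD hornerN IH0 hornerD !hornerM !hornerC hornerX !mulr0 mul0r addr0 T0.
rewrite (_ : n.+1%:R * (pi / 2) = n%:R * (pi / 2) + pi / 2); last first.
  by rewrite -[n.+1]addn1 natrD; ring.
rewrite (_ : n.+2%:R * (pi / 2) = n%:R * (pi / 2) + pi); last first.
  by rewrite -[n.+2]addn2 natrD; field.
by rewrite cosDpihalf sinDpi -[n.+2]addn2 natrD; ring.
Qed.

Lemma cos_surj x : -1 <= x <= 1 -> exists t, x = cos t.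
Proof. by move=> x1; exists (acos x); rewrite acosK// in_itv. Qed.

Lemma chebT_le1 n x : -1 <= x <= 1 -> `|(chebT n).[x]| <= 1.
Proof. by move=> /cos_surj[t ->]; rewrite chebT_cos cos_max. Qed.

(** Equally spaced angles on the whole circle: averaging over [k < M] integrates cosines of
    frequency below [M] exactly. *)
Definition cnode (M k : nat) : R := cos (k%:R * (2 * pi / M%:R)).

Lemma cnode_itv M k : -1 <= cnode M k <= 1.
Proof. by rewrite cos_geN1 cos_le1. Qed.

Lemma chebT_cnode M j k : (chebT j).[cnode M k] = cos (k%:R * (j%:R * (2 * pi / M%:R))).
Proof. by rewrite chebT_cos mulrCA. Qed.

(** Multiplication by [2 * sin b], with [b] half the angle step, turns each cosine into a difference
    of sines. The sum telescopes, and its ends agree because [2 M b] is [j] full periods. *)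
Lemma sum_cos_cnode M j : (0 < j < M)%N ->
  \sum_(k < M) cos (k%:R * (j%:R * (2 * pi / M%:R))) = 0 :> R.
Proof.
move=> /andP[j0 jM].
have M0 : (0 : R) < M%:R by rewrite ltr0n (leq_trans _ jM).
set b : R := j%:R * pi / M%:R.
have -> : j%:R * (2 * pi / M%:R) = 2 * b :> R by rewrite /b; field; rewrite gt_eqF.
have sb : 0 < sin b.
  apply: sin_gt0_pi; rewrite /b divr_gt0//= ?mulr_gt0 ?ltr0n ?pi_gt0//=.
  by rewrite ltr_pdivrMr// mulrC ltr_pM2l ?pi_gt0// ltr_nat.
have sb0 : 2 * sin b != 0 by rewrite gt_eqF// mulr_gt0.
apply: (mulfI sb0).
rewrite mulr0 mulr_sumr.
under eq_bigr => k _.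
  rewrite (_ : _ * cos _ = sin ((2 * (k : nat).+1%:R - 1) * b) - sin ((2 * k%:R - 1) * b)); last first.
    rewrite (_ : (2 * (k : nat).+1%:R - 1) * b = k%:R * (2 * b) + b); last by rewrite -natr1; ring.
    rewrite (_ : (2 * k%:R - 1) * b = k%:R * (2 * b) - b); last by ring.
    by rewrite sinD sinB; ring.
  over.
rewrite -(big_mkord predT (fun k => sin ((2 * k.+1%:R - 1) * b) - sin ((2 * k%:R - 1) * b))).
rewrite telescope_sumr// mulr0 add0r mulN1r sinN opprK.
rewrite (_ : (2 * M%:R - 1) * b = - b + (pi *+ 2) *+ j).
  by rewrite (periodicn (@sinD2pi R)) sinN addNr.
by rewrite /b -2!mulr_natr; field; rewrite gt_eqF.
Qed.

(** The product-to-sum formula leaves cosine sums at the frequencies [i + j] and [i - j]; the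
    hypothesis keeps both below aliasing. For [i = j > 0] only the second survives, whence the
    [2^-1]. *)
Lemma cnode_orth M i j : (i + j < M)%N ->
  \sum_(k < M) (chebT i).[cnode M k] * (chebT j).[cnode M k] =
  M%:R * ((i == j)%:R * (if j == 0%N then 1 else 2^-1)).
Proof.
move=> ijM.
have M0 : (M%:R : R) != 0 by rewrite pnatr_eq0 -lt0n (leq_trans _ ijM).
pose s (l : nat) : R := \sum_(k < M) cos (k%:R * (l%:R * (2 * pi / M%:R))).
have s0 : s 0%N = M%:R.
  rewrite /s (eq_bigr (fun=> 1)) ?sumr_const ?card_ord// => k _.
  by rewrite mul0r mulr0 cos0.
have sj l : (l < M)%N -> s l = (l == 0%N)%:R * M%:R.
  case: l => [_|l lM]; first by rewrite s0 eqxx mul1r.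
  by rewrite mul0r; exact: sum_cos_cnode.
wlog ij : i j ijM / (j <= i)%N => [H|].
  have [ij|/ltnW ij] := leqP j i; first exact: H.
  under eq_bigr => k _ do rewrite mulrC.
  by rewrite H// 1?addnC// eq_sym; case: eqP => [->//|]; rewrite !mul0r.
transitivity (2^-1 * (s (i + j)%N + s (i - j)%N)).
  rewrite mulrDr !mulr_sumr -big_split/=; apply: eq_bigr => k _.
  rewrite !chebT_cnode natrD natrB//.
  set w := 2 * pi / M%:R.
  rewrite (_ : k%:R * ((i%:R + j%:R) * w) = k%:R * (i%:R * w) + k%:R * (j%:R * w)); last by ring.
  rewrite (_ : k%:R * ((i%:R - j%:R) * w) = k%:R * (i%:R * w) - k%:R * (j%:R * w)); last by ring.
  by rewrite cosB cosD; field.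
rewrite !sj// ?(leq_ltn_trans _ ijM) ?leq_subLR ?addnA ?leq_addl//; last by lia.
case: (eqVneq i j) => [<-|/negbTE ne].
  rewrite subnn eqxx addnn double_eq0; case: eqP => _; first by field.
  by rewrite !mul1r !mul0r; field.
have ij0 : ((i + j)%N == 0%N) = false.
  by rewrite addn_eq0; apply/negbTE; apply: contraFN ne => /andP[/eqP -> /eqP ->].
have dij0 : ((i - j)%N == 0%N) = false.
  by rewrite subn_eq0; apply/negbTE; rewrite -ltnNge ltn_neqAle ij andbT eq_sym ne.
by rewrite ij0 dij0 !mul0r addr0 !mulr0.
Qed.

End Chebyshev.
Arguments chebT {R} n : simpl never.

(** * Nonnegative kernels and their multipliers at the nodes *)

Section kernels.
Context {R : realType}.
Implicit Types (p : {poly R}) (x y s t : R) (q : nat -> R).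

Definition ndist (a b : nat) : nat := (a - b + (b - a))%N.

Lemma cos_ndist a b t : cos ((ndist a b)%:R * t) = cos ((a%:R - b%:R) * t).
Proof.
rewrite /ndist; have [ab|/ltnW ba] := leqP a b.
  by rewrite (eqP ab) add0n natrB// -[LHS]cosN -mulNr opprB.
by rewrite (eqP ba) addn0 natrB.
Qed.

(* With [x = cos t] and [y = cos s] this is the average over the two signs of
   [|\sum_a q a e^(i a (t -+ s))| ^ 2], hence nonnegative. *)
Definition ckernel q n y : {poly R} :=
  \sum_(a < n) \sum_(b < n)
    (q a * q b * (chebT (ndist a b)).[y]) *: chebT (ndist a b).

Lemma size_ckernel q n y : (size (ckernel q n y) <= n)%N.
Proof.
apply: (leq_trans (size_sum _ _ _)); apply/bigmax_leqP => a _.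
apply: (leq_trans (size_sum _ _ _)); apply/bigmax_leqP => b _.
apply: (leq_trans (size_scale_leq _ _)); apply: (leq_trans (size_chebT _)).
by rewrite /ndist; have := ltn_ord a; have := ltn_ord b; lia.
Qed.

Lemma sum_cos_sqr q n t :
  \sum_(a < n) \sum_(b < n) q a * q b * cos ((a%:R - b%:R) * t) =
  (\sum_(a < n) q a * cos (a%:R * t)) ^+ 2 + (\sum_(a < n) q a * sin (a%:R * t)) ^+ 2.
Proof.
rewrite !expr2 !mulr_suml -big_split/=; apply: eq_bigr => a _.
rewrite !mulr_sumr -big_split/=; apply: eq_bigr => b _.
by rewrite mulrBl cosB; ring.
Qed.

Lemma ckernel_cosE q n s t :
  (ckernel q n (cos s)).[cos t] =
  2^-1 * (\sum_(a < n) \sum_(b < n) q a * q b * cos ((a%:R - b%:R) * (t - s)) +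
          \sum_(a < n) \sum_(b < n) q a * q b * cos ((a%:R - b%:R) * (t + s))).
Proof.
rewrite -big_split/= mulr_sumr horner_sum; apply: eq_bigr => a _.
rewrite -big_split/= mulr_sumr horner_sum; apply: eq_bigr => b _.
rewrite hornerZ !chebT_cos !cos_ndist (mulrBr _ t) (mulrDr _ t) cosB cosD.
by field.
Qed.

Lemma ckernel_ge0 q n x y : -1 <= x <= 1 -> -1 <= y <= 1 -> 0 <= (ckernel q n y).[x].
Proof.
move=> /cos_surj[t ->] /cos_surj[s ->].
by rewrite ckernel_cosE !sum_cos_sqr mulr_ge0// !addr_ge0// sqr_ge0.
Qed.

Lemma sum_pick q n c : (forall a, (n <= a)%N -> q a = 0) ->
  \sum_(a < n) q a * ((a : nat) == c)%:R = q c.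
Proof.
move=> q0; have [cn|nc] := ltnP c n.
  rewrite (bigD1 (Ordinal cn))//= eqxx mulr1 big1 ?addr0// => i ic.
  rewrite (_ : _ == _ = false) ?mulr0//; apply/eqP => ic'.
  by move/eqP : ic; apply; apply: val_inj.
rewrite q0// big1// => i _; rewrite (_ : _ == _ = false) ?mulr0//.
by apply/eqP => ic; have := ltn_ord i; rewrite ic ltnNge nc.
Qed.

Definition cmult q n j : R := \sum_(b < n) q b * q (b + j)%N.

(** Discrete orthogonality keeps only the pairs with [|a - b| = j]. Their total weight is the
    autocorrelation of [q] at shift [j]; for [j > 0] it occurs twice, which cancels the [2^-1] of
    [cnode_orth]. *)
Lemma ckernel_mult M q n j : (forall a, (n <= a)%N -> q a = 0) -> (n + j <= M)%N ->
  \sum_(k < M) (chebT j).[cnode M k] *: ckernel q n (cnode M k) =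
  (M%:R * cmult q n j) *: chebT j.
Proof.
move=> q0 njM.
under eq_bigr => k _ do rewrite scaler_sumr.
rewrite exchange_big/=.
transitivity (\sum_(a < n) \sum_(b < n) (M%:R * (q a * q b *
    ((ndist a b == j)%:R * (if j == 0%N then 1 else 2^-1)))) *: chebT j).
  apply: eq_bigr => a _.
  under eq_bigr => k _ do rewrite scaler_sumr.
  rewrite exchange_big/=; apply: eq_bigr => b _.
  under eq_bigr => k _ do rewrite scalerA mulrCA.
  rewrite -scaler_suml -mulr_sumr cnode_orth; last first.
    by rewrite /ndist; have := ltn_ord a; have := ltn_ord b; lia.
  case: (eqVneq (ndist a b) j) => [<-|_]; first by rewrite !mul1r mulrCA.
  by rewrite !(mul0r, mulr0, scale0r).
under eq_bigr => a _ do rewrite -scaler_suml -mulr_sumr.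
rewrite -scaler_suml -mulr_sumr; congr (_ * _ *: _).
have S c : (fun b => \sum_(a < n) q a * q b * ((a : nat) == c)%:R) =1 fun b : nat => q b * q c.
  move=> b; rewrite -(sum_pick c q0) mulr_sumr; apply: eq_bigr => a _; ring.
case: j njM => [|j] njM.
  rewrite exchange_big/=; apply: eq_bigr => b _; rewrite addn0 -(S b b).
  apply: eq_bigr => a _; rewrite mulr1; congr (_ * _%:R); congr nat_of_bool.
  by apply/eqP/eqP; rewrite /ndist; lia.
rewrite /=.
transitivity (2^-1 * (\sum_(b < n) \sum_(a < n) q a * q b * ((a : nat) == (b + j.+1)%N)%:R +
    \sum_(a < n) \sum_(b < n) q b * q a * ((b : nat) == (a + j.+1)%N)%:R)).
  rewrite [X in _ * (X + _)]exchange_big/= -big_split mulr_sumr/=; apply: eq_bigr => a _.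
  rewrite -big_split mulr_sumr/=; apply: eq_bigr => b _.
  have -> : (ndist a b == j.+1) = ((a : nat) == (b + j.+1)%N) (+) ((b : nat) == (a + j.+1)%N).
    by apply/eqP; rewrite /ndist; do 2 case: eqP => /=; lia.
  have [ab|] := eqVneq (a : nat) (b + j.+1)%N.
    by rewrite ab (_ : ((b : nat) == _) = false) ?addbF; [rewrite ?(mulr0n,mulr1n); field|apply/eqP; lia].
  by rewrite addFb => _; rewrite mulr0n mulr0 add0r (mulrC (q b)); ring.
under eq_bigr => b _ do rewrite S.
by rewrite /cmult; field.
Qed.

End kernels.

(** * The operators of de la Vallee Poussin and Jackson, and Bernstein's inequality *)

Section approximation_operators.
Context {R : realType}.
Implicit Types (p : {poly R}) (x y s t : R) (q : nat -> R) (g : R -> R).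

Definition fejer (n a : nat) : R := (a < n)%:R.

Lemma fejer_ge n a : (n <= a)%N -> fejer n a = 0.
Proof. by move=> na; rewrite /fejer ltnNge na. Qed.

Lemma cmult_fejer n j : (j <= n)%N -> cmult (fejer n) n j = (n - j)%:R.
Proof.
move=> jn; rewrite /cmult /fejer.
rewrite -(big_mkord predT (fun b : nat => (b < n)%:R * (b + j < n)%:R)).
rewrite (big_cat_nat (n := (n - j)%N))//= ?leq_subr//.
rewrite [X in _ + X]big_nat_cond [X in _ + X]big1 ?addr0; last first.
  by move=> b; rewrite andbT => /andP[bn _]; rewrite [(b + j < n)%N](_ : _ = false) ?mulr0//; lia.
rewrite big_nat (eq_bigr (fun=> 1)); last first.
  move=> b /andP[_ bn]; have -> : (b < n)%N by lia.
  have -> : (b + j < n)%N by lia.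
  by rewrite mulr1.
by rewrite -big_nat sumr_const_nat subn0.
Qed.

Lemma sum_ckernel_fejer M n x : (n <= M)%N ->
  \sum_(k < M) (ckernel (fejer n) n (cnode M k)).[x] = M%:R * n%:R.
Proof.
move=> nM; have := @ckernel_mult R M (fejer n) n 0.
rewrite addn0 cmult_fejer// subn0 => /(_ (@fejer_ge n) nM) H.
have := congr1 (horner^~ x) H; rewrite /= horner_sum hornerZ hornerC mulr1 => <-.
by apply: eq_bigr => k _; rewrite hornerZ hornerC mul1r.
Qed.

(* The de la Vallee Poussin kernel [2 F_(2N) - F_N] applied at the nodes. *)
Lemma vallee_poussin (N : nat) : (0 < N)%N ->
  exists (m : nat) (y : 'I_m -> R) (w : 'I_m -> {poly R}),
  [/\ forall k, -1 <= y k <= 1, forall k, (size (w k) <= N.*2)%N,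
      forall x, -1 <= x <= 1 -> \sum_k `|(w k).[x]| <= 3 &
      forall p, (size p <= N.+1)%N -> \sum_k p.[y k] *: w k = p].
Proof.
(* Kernel frequencies below [2 N] meet polynomials of degree at most [N], so [3 N] nodes avoid
   aliasing. *)
move=> N0; pose M := (3 * N)%N.
have M0 : (0 < M)%N by rewrite muln_gt0.
have MN0 : (M%:R * N%:R : R) != 0 by rewrite -natrM pnatr_eq0 muln_eq0 negb_or -!lt0n M0.
pose K n k := ckernel (fejer n) n (cnode M k).
exists M, (cnode M), (fun k => (M%:R * N%:R)^-1 *: (K N.*2 k - K N k)); split.
- by move=> k; exact: cnode_itv.
- move=> k; apply: (leq_trans (size_scale_leq _ _)).
  apply: (leq_trans (size_polyD _ _)); rewrite size_polyN geq_max size_ckernel/=.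
  by rewrite (leq_trans (size_ckernel _ _ _))//; lia.
(* Both kernels are nonnegative, so the sum is at most that of their masses: [2 N + N] against the
   normalisation [N]. *)
- move=> x x1.
  apply: (@le_trans _ _ (\sum_(k < M) (M%:R * N%:R)^-1 * ((K N.*2 k).[x] + (K N k).[x]))).
    apply: ler_sum => k _; rewrite hornerZ normrM normfV (ger0_norm (mulr_ge0 _ _))//.
    rewrite ler_wpM2l ?invr_ge0 ?mulr_ge0// hornerD hornerN.
    apply: (le_trans (ler_normB _ _)).
    by rewrite !ger0_norm// ckernel_ge0// cnode_itv.
  rewrite -mulr_sumr big_split/= !sum_ckernel_fejer ?/M; [|lia|lia].
  rewrite -/M -muln2 natrM (_ : _ + _ = M%:R * N%:R * 3) ?mulKf//.
  by ring.
- move=> p /chebT_basis[a ->].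
  under eq_bigr => k _ do rewrite horner_sum scaler_suml.
  rewrite exchange_big/=; apply: eq_bigr => -[j /= jN] _.
  under eq_bigr => k _ do rewrite hornerZ scalerA -mulrA [_ * _^-1]mulrC -!scalerA scalerBr.
  rewrite -!scaler_sumr sumrB; congr (_ *: _).
  rewrite !ckernel_mult ?cmult_fejer; try exact: fejer_ge; try by rewrite /M; lia.
  (* The multipliers [2 N - j] and [N - j] differ by [N] for every [j <= N], which is why
     polynomials of degree at most [N] are reproduced. *)
  rewrite -scalerBl scalerA (_ : _ * _ = 1) ?scale1r// -mulrBr -natrB; last by lia.
  rewrite (_ : (N.*2 - j - (N - j) = N)%N); last by lia.
  by rewrite mulVf.
Qed.

(* Up to a shift, [tent m] is the convolution square of [fejer m], so that its
   [ckernel] is Jackson's kernel, the square of Fejer's. *)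
Definition tent (m a : nat) : R := (minn a (m.*2 - a))%:R.

Lemma tent_ge m a : (m.*2 <= a)%N -> tent m a = 0.
Proof. by move=> ma; rewrite /tent (_ : minn _ _ = 0%N)//; lia. Qed.

(** Only the rising half [b <= m] of the tent is kept, where the summand is [b ^ 2]. *)
Lemma cmult_tent0 m : (0 < m)%N -> m%:R ^+ 3 / 3 <= cmult (tent m) m.*2 0.
Proof.
move=> m0; apply: (@le_trans _ _ (\sum_(0 <= b < m.+1) b%:R ^+ 2)).
  elim: m {m0} => [|m IH]; first by rewrite big_nat1 expr0n mul0r expr0n.
  rewrite big_nat_recr//= -natr1; have m0 : (0 : R) <= m%:R by [].
  nra.
rewrite /cmult -(big_mkord predT (fun b : nat => tent m b * tent m (b + 0)%N)).
rewrite [leRHS](big_cat_nat (n := m.+1))//=; last by lia.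
rewrite ler_wpDr//; first by apply: sumr_ge0 => b _; rewrite mulr_ge0.
rewrite big_nat [leRHS]big_nat; apply: ler_sum => b /= bm.
rewrite addn0 -expr2 /tent (_ : minn _ _ = b)//; lia.
Qed.

(** Twice the deficit is the sum [E] of squared increments of the weights plus the boundary terms
    [Q0]. The tent has slope one, so the deficit is of order [m] against a mass of order [m ^ 3];
    this ratio is the [N ^- 2] of Jackson's second moment. *)
Lemma cmult_tent m i : (0 < m)%N -> (i <= 2)%N ->
  0 <= cmult (tent m) m.*2 0 - cmult (tent m) m.*2 i <= 6 * m%:R.
Proof.
move=> m0 i2; pose n := m.*2; pose q := tent m.
pose Q : R := \sum_(0 <= b < n) q b ^+ 2.
pose Q' : R := \sum_(0 <= b < n) q (b + i)%N ^+ 2.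
pose Q0 : R := \sum_(0 <= b < i) q b ^+ 2.
have QQ : Q' + Q0 = Q.
  rewrite /Q' -[n in LHS](addnK i) -(@big_addn _ _ _ 0 (n + i) i predT (fun b => q b ^+ 2)) add0n.
  rewrite addrC -(big_cat_nat (n := i))//=; last by lia.
  rewrite (big_cat_nat (n := n))//=; last by lia.
  rewrite [X in _ + X]big_nat_cond [X in _ + X]big1 ?addr0// => b.
  by rewrite andbT => /andP[nb _]; rewrite /q tent_ge// expr0n.
have Q00 : 0 <= Q0 <= i%:R.
  rewrite /Q0 sumr_ge0 => [|b _]; last exact: sqr_ge0.
  rewrite -[i in leRHS]subn0 -sumr_const_nat !big_nat ler_sum// => b /= bi.
  by rewrite exprn_ile1// /q /tent (ler_nat _ _ 1%N); lia.
pose E : R := \sum_(0 <= b < n) (q b - q (b + i)%N) ^+ 2.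
have E0 : 0 <= E <= n%:R * i%:R ^+ 2.
  rewrite /E sumr_ge0 => [|b _]; last exact: sqr_ge0.
  rewrite mulrC mulr_natr -[n in leRHS]subn0 -sumr_const_nat ler_sum// => b _.
  rewrite -[leLHS]real_normK ?num_real// lerXn2r ?nnegrE// ler_norml /q /tent.
  rewrite lerNl opprB !lerBlDr -!natrD !ler_nat.
  by apply/andP; split; lia.
have c0 : cmult q n 0 = Q.
  rewrite /cmult /Q big_mkord; apply: eq_bigr => b _.
  by rewrite addn0 expr2.
have EE : E = Q + Q' - 2 * cmult q n i.
  rewrite /E /Q /Q' /cmult -(big_mkord predT (fun b : nat => q b * q (b + i)%N)) mulr_sumr.
  rewrite -big_split -sumrB/=; apply: eq_bigr => b _.
  by ring.
rewrite c0; have im : (n%:R * i%:R ^+ 2 + i%:R : R) <= 12 * m%:R.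
  by rewrite -natrX -natrM -natrD -natrM ler_nat /n -muln2; move: i2; case: i {Q' Q0 QQ Q00 E E0 EE} => [|[|[|//]]] _; lia.
move: QQ Q00 E0 EE im; move: (cmult q n i) (n%:R) (i%:R) (m%:R) => a b c e.
by move=> ? /andP[? ?] /andP[? ?] ? ?; apply/andP; split; lra.
Qed.

(** Written in Chebyshev polynomials of [y], the square [(x - y) ^ 2] turns the second moment into a
    combination of the multipliers [l 0], [l 1], [l 2]; frequencies up to 2 are all that [n + 2]
    nodes have to resolve. *)
Lemma jackson_operator (N : nat) : (0 < N)%N ->
  exists (m : nat) (y : 'I_m -> R) (w : 'I_m -> {poly R}),
  [/\ forall k, -1 <= y k <= 1, forall k, (size (w k) <= N.+1)%N,
      forall k x, -1 <= x <= 1 -> 0 <= (w k).[x],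
      forall x, \sum_k (w k).[x] = 1 &
      forall x, -1 <= x <= 1 -> \sum_k N%:R ^+ 2 * (x - y k) ^+ 2 * (w k).[x] <= 180].
Proof.
(* Rounding up makes [n] equal to [N] or [N + 1]: the kernel has degree at most [N], and [N <= 2 m]
   serves for the moment. *)
move=> N0; pose m := uphalf N; pose n := m.*2; pose M := n.+2.
have m0 : (0 < m)%N by rewrite /m uphalf_gt0.
have mN : (N <= n <= N.+1)%N by rewrite /n /m uphalf_half doubleD; have := odd_double_half N; lia.
pose q := tent m; pose l j := cmult q n j.
pose K k := ckernel q n (cnode M k).
have mR : (0 : R) < m%:R by rewrite ltr0n.
have l0 : 0 < l 0%N.
  by apply: lt_le_trans (cmult_tent0 m0); rewrite divr_gt0// exprn_gt0.
have M0 : (0 : R) < M%:R by rewrite ltr0n.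
have S j x : (j <= 2)%N ->
    \sum_(k < M) (chebT j).[cnode M k] * (K k).[x] = M%:R * l j * (chebT j).[x].
  move=> j2; rewrite -hornerZ -ckernel_mult ?horner_sum; last 2 first.
  - by move=> a; exact: tent_ge.
  - by rewrite /M -addn2 leq_add2l.
  by apply: eq_bigr => k _; rewrite hornerZ.
have S0 x : \sum_(k < M) (K k).[x] = M%:R * l 0%N.
  have := S 0%N x isT; rewrite hornerC mulr1 => <-; apply: eq_bigr => k _.
  by rewrite hornerC mul1r.
have T1E y : (chebT 1).[y] = y by rewrite hornerX.
have T2E y : (chebT 2).[y] = 2 * y ^+ 2 - 1.
  by rewrite chebTSS hornerD hornerN !hornerM !hornerC hornerX -mulrA expr2.
exists M, (cnode M), (fun k => (M%:R * l 0%N)^-1 *: K k); split.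
- by move=> k; exact: cnode_itv.
- move=> k; apply: (leq_trans (size_scale_leq _ _)).
  by apply: (leq_trans (size_ckernel _ _ _)); case/andP: mN.
- move=> k x x1; rewrite hornerZ mulr_ge0 ?invr_ge0 ?mulr_ge0 ?(ltW l0)//.
  by rewrite ckernel_ge0// cnode_itv.
- move=> x; under eq_bigr => k _ do rewrite hornerZ.
  by rewrite -mulr_sumr S0 mulVf// gt_eqF// mulr_gt0.
- move=> x x1.
  have -> : \sum_(k < M) N%:R ^+ 2 * (x - cnode M k) ^+ 2 * ((M%:R * l 0%N)^-1 *: K k).[x] =
      N%:R ^+ 2 / l 0%N * (x ^+ 2 * (l 0%N - 2 * l 1%N + l 2%N) + (l 0%N - l 2%N) / 2).
    transitivity (N%:R ^+ 2 / (M%:R * l 0%N) * (x ^+ 2 * (\sum_(k < M) (K k).[x]) -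
      2 * x * (\sum_(k < M) (chebT 1).[cnode M k] * (K k).[x]) +
      2^-1 * (\sum_(k < M) (chebT 2).[cnode M k] * (K k).[x] + \sum_(k < M) (K k).[x]))).
      under eq_bigr => k _ do rewrite hornerZ mulrACA.
      rewrite (big_mkcond predT) [X in _ = _ * X](_ : _ = \sum_(k < M) (x - cnode M k) ^+ 2 * (K k).[x]).
        by rewrite [RHS]mulr_sumr.
      rewrite mulrDr [in LHS]mulr_sumr [X in _ - X]mulr_sumr ![2^-1 * _]mulr_sumr -sumrB -!big_split/=.
      by apply: eq_bigr => k _; rewrite T1E T2E; field.
    rewrite S0 !S// T1E T2E.
    by move: l0; move: (l 0%N) => l0 l00; field; rewrite !gt_eqF.
  have /andP[A0 A1] := @cmult_tent m 1 m0 isT.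
  have /andP[B0 B1] := @cmult_tent m 2 m0 isT.
  rewrite -!/(l _) in A0 A1 B0 B1.
  have x2 : 0 <= x ^+ 2 <= 1.
    rewrite sqr_ge0 -[leRHS](expr1n _ 2) -[leLHS]real_normK ?num_real// lerXn2r ?nnegrE//.
    by rewrite ler_norml.
  rewrite mulrAC ler_pdivrMr//.
  (* The bracket is at most [12 m + 3 m], from [2 (l 0 - l 1) <= 12 m] and [(l 0 - l 2) / 2 <= 3 m].
     Then [4 m ^ 2] times [15 m] is [180] times the lower bound [m ^ 3 / 3] of [l 0]. *)
  apply: (@le_trans _ _ ((2 * m%:R) ^+ 2 * (15 * m%:R))).
    apply: (@le_trans _ _ (N%:R ^+ 2 * (15 * m%:R))).
      rewrite ler_wpM2l ?sqr_ge0//.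
      by move/andP: x2 => [x20 x21]; nra.
    rewrite ler_wpM2r ?mulr_ge0// lerXn2r ?nnegrE ?mulr_ge0//.
    by rewrite -natrM ler_nat mul2n; case/andP: mN.
  apply: (@le_trans _ _ (180 * (m%:R ^+ 3 / 3))); last by rewrite ler_wpM2l// cmult_tent0.
  by rewrite le_eqVlt; apply/orP; left; apply/eqP; field.
Qed.

(* The weights are a Fejer kernel modulated by [sin (N u)], as in M. Riesz's
   proof of Bernstein's inequality. *)
Lemma bernstein_functional (N : nat) : (0 < N)%N ->
  exists (m : nat) (y w : 'I_m -> R),
  [/\ forall k, -1 <= y k <= 1, \sum_k `|w k| <= 2 * N%:R &
      forall p, (size p <= N.+1)%N -> \sum_k p.[y k] * w k = p^`().[0]].
Proof.
move=> N0; pose M := (3 * N)%N.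
have M0 : (0 : R) < M%:R by rewrite ltr0n muln_gt0.
pose sn (i : nat) : R := sin (i%:R * (pi / 2)).
(* A frequency [j <= N] has the form [N + a - b] for exactly [j] pairs [(a, b)]; this produces the
   factor [j] in the derivative of [chebT j] at 0. *)
pose K (k : nat) : R := \sum_(a < N) \sum_(b < N) sn (N + a - b)%N * (chebT (N + a - b)%N).[cnode M k].
pose W k := (ckernel (fejer N) N (cnode M k)).[0].
have KW (k : 'I_M) : `|2 * K k| <= 2 * W k.
  rewrite normrM (ger0_norm (ltW _))// ler_pM2l// /W -(cos_pihalf R).
  set t := pi / 2; pose s : R := k%:R * (2 * pi / M%:R).
  have cn : cnode M k = cos s by [].
  pose S (u : R) : R := \sum_(a < N) \sum_(b < N) cos ((a%:R - b%:R) * u).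
  have S0 u : 0 <= S u.
    rewrite /S; have := sum_cos_sqr (fun=> 1 : R) N u.
    under eq_bigr => a _ do under eq_bigr => b _ do rewrite !mul1r.
    by move=> ->; rewrite addr_ge0// sqr_ge0.
  have WS : (ckernel (fejer N) N (cnode M k)).[cos t] = 2^-1 * (S (t - s) + S (t + s)).
    rewrite cn ckernel_cosE /S; congr (_ * (_ + _)); apply: eq_bigr => a _; apply: eq_bigr => b _.
      by rewrite /fejer !ltn_ord !mul1r.
    by rewrite /fejer !ltn_ord !mul1r.
  (* Expansion around the frequency [N] leaves [sin (N u)] times a Fejer sum; the other term is odd
     under exchange of [a] and [b] and cancels. *)
  have KS u : \sum_(a < N) \sum_(b < N) sin ((N + a - b)%N%:R * u) = sin (N%:R * u) * S u.
    transitivity (\sum_(a < N) \sum_(b < N) (sin (N%:R * u) * cos ((a%:R - b%:R) * u) +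
      cos (N%:R * u) * sin ((a%:R - b%:R) * u))).
      apply: eq_bigr => a _; apply: eq_bigr => b _; rewrite -sinD.
      congr sin; rewrite natrB ?natrD; first by ring.
      by have := ltn_ord b; lia.
    under eq_bigr => a _ do rewrite big_split/= -!mulr_sumr.
    rewrite big_split/= -!mulr_sumr -/(S u) [X in cos _ * X](_ : _ = 0) ?mulr0 ?addr0//.
    set X := LHS; suff : X = - X by lra.
    rewrite /X [X in _ = - X]exchange_big -sumrN/=; apply: eq_bigr => a _.
    rewrite -sumrN; apply: eq_bigr => b _; rewrite -sinN; congr sin; ring.
  have -> : K k = 2^-1 * (sin (N%:R * (t - s)) * S (t - s) + sin (N%:R * (t + s)) * S (t + s)).
    rewrite -!KS -big_split mulr_sumr/=; apply: eq_bigr => a _.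
    rewrite -big_split mulr_sumr/=; apply: eq_bigr => b _.
    rewrite cn chebT_cos /sn -/t (mulrBr _ t) (mulrDr _ t) sinB sinD.
    by field.
  rewrite WS normrM (ger0_norm _)// ler_wpM2l//.
  apply: (le_trans (ler_normD _ _)); rewrite !normrM.
  by apply: lerD; rewrite (ger0_norm (S0 _)) ler_piMl// sin_max.
exists M, (cnode M), (fun k => M%:R^-1 * (2 * K k)); split.
- by move=> k; exact: cnode_itv.
- apply: (@le_trans _ _ (M%:R^-1 * (2 * \sum_(k < M) W k))).
    rewrite mulr_sumr mulr_sumr; apply: ler_sum => k _.
    by rewrite normrM (ger0_norm (_ : 0 <= M%:R^-1))// ler_wpM2l// KW.
  by rewrite sum_ckernel_fejer ?/M; [rewrite mulrCA mulKf// gt_eqF|lia].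
move=> p /chebT_basis[c ->].
under eq_bigr => k _ do rewrite horner_sum mulr_suml.
rewrite exchange_big/= (raddf_sum (@deriv R)) horner_sum; apply: eq_bigr => -[j /= jN] _.
rewrite derivZ hornerZ chebT_deriv0 -/(sn j).
under eq_bigr => k _ do rewrite hornerZ -mulrA.
rewrite -mulr_sumr; congr (_ * _).
transitivity (2 / M%:R * \sum_(a < N) \sum_(b < N) sn (N + a - b)%N *
    \sum_(k < M) (chebT j).[cnode M k] * (chebT (N + a - b)%N).[cnode M k]).
  rewrite mulr_sumr; under [RHS]eq_bigr => a _ do rewrite mulr_sumr.
  transitivity (\sum_(k < M) \sum_(a < N) \sum_(b < N) 2 / M%:R * (sn (N + a - b)%N *
      ((chebT j).[cnode M k] * (chebT (N + a - b)%N).[cnode M k]))).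
    apply: eq_bigr => k _; rewrite /K !mulr_sumr; apply: eq_bigr => a _.
    by rewrite !mulr_sumr; apply: eq_bigr => b _; ring.
  rewrite exchange_big/=; apply: eq_bigr => a _.
  rewrite exchange_big/=; apply: eq_bigr => b _.
  by rewrite !mulr_sumr.
transitivity (\sum_(a < N) (a < j)%:R * sn j).
  rewrite mulr_sumr; apply: eq_bigr => a _.
  transitivity (\sum_(b < N) sn j * ((b : nat) == (N + a - j)%N)%:R).
    rewrite mulr_sumr; apply: eq_bigr => b _.
    rewrite cnode_orth; last by have := ltn_ord a; have := ltn_ord b; rewrite /M; lia.
    rewrite (_ : (N + a - b == 0)%N = false); last by have := ltn_ord b; lia.
    have -> : ((b : nat) == (N + a - j)%N) = (j == (N + a - b)%N) by have := ltn_ord b; lia.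
    case: eqVneq => [<-|_]; last by rewrite !(mul0r, mulr0).
    by rewrite mul1r mulr1; move: M0; move: (M%:R : R) => m1 m10; field; rewrite gt_eqF.
  rewrite -mulr_sumr mulrC; congr (_ * _).
  have [aj|ja] := ltnP a j.
    have bN : (N + a - j < N)%N by have := ltn_ord a; lia.
    rewrite (bigD1 (Ordinal bN))//= eqxx big1 ?addr0// => b bne.
    by rewrite (_ : _ == _ = false)//; apply/eqP => be; case/eqP: bne; apply: val_inj.
  by rewrite big1// => b _; rewrite (_ : _ == _ = false)//; have := ltn_ord b; lia.
rewrite -mulr_suml; congr (_ * _).
have jN' : (j <= N)%N by [].
rewrite -(big_mkord predT (fun a : nat => (a < j)%:R)) (big_cat_nat (n := j))//=.
rewrite big_nat (eq_bigr (fun=> 1)) => [|a /andP[_ ->]//].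
rewrite -big_nat sumr_const_nat subn0 big_nat big1 ?addr0// => a /andP[ja _].
by rewrite ltnNge ja.
Qed.

(** At the midpoint of the interval the factor is linear in the degree, whereas near the endpoints
    it can be quadratic. *)
Lemma bernstein_center (N : nat) (B : R) p : (0 < N)%N -> (size p <= N.+1)%N ->
  (forall x, -1 <= x <= 1 -> `|p.[x]| <= B) -> `|p^`().[0]| <= 2 * N%:R * B.
Proof.
move=> N0 sp pB; have [m [y [w [y1 w1 /(_ _ sp) <-]]]] := bernstein_functional N0.
apply: (le_trans (ler_norm_sum _ _ _)).
have B0 : 0 <= B by apply: le_trans (pB 0 _) => //; lra.
apply: (@le_trans _ _ (\sum_k `|w k| * B)).
  by apply: ler_sum => k _; rewrite normrM mulrC ler_wpM2l// pB.
by rewrite -mulr_suml ler_wpM2r.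
Qed.

(** The bound propagates through the three-term recurrence because
    [2 s (1 + 2 s) + 1 <= (1 + 2 s) ^ 2]. *)
Lemma chebT_coef_bound n k s : 0 <= s -> `|(chebT n)`_k| * s ^+ k <= (1 + 2 * s) ^+ n.
Proof.
move=> s0; elim/nat_ind2: n k => [k|k|n IH0 IH1 k].
- rewrite coefC; case: eqP => [->|_]; first by rewrite normr1 mulr1.
  by rewrite normr0 mul0r expr0.
- rewrite coefX; case: eqP => [->|_]; first by rewrite normr1 mul1r !expr1; lra.
  by rewrite normr0 mul0r expr1; lra.
have IHn k0 : `|(2%:P * 'X * chebT n.+1)`_k0| * s ^+ k0 <= 2 * s * (1 + 2 * s) ^+ n.+1.
  rewrite -mulrA coefCM coefXM; case: k0 => [|k0]; [rewrite eqxx|rewrite (_ : _ == _ = false)// succnK].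
    by rewrite mulr0 normr0 mul0r !mulr_ge0// exprn_ge0//; lra.
  rewrite normrM (ger0_norm (ltW _))// exprS -!mulrA ler_pM2l// mulrCA ler_wpM2l//.
rewrite chebTSS coefB.
apply: (@le_trans _ _ (2 * s * (1 + 2 * s) ^+ n.+1 + (1 + 2 * s) ^+ n)).
  apply: le_trans (lerD (IHn k) (IH0 k)); rewrite -mulrDl ler_wpM2r ?exprn_ge0//.
  exact: ler_normB.
rewrite !exprS; have := exprn_ge0 n (_ : 0 <= 1 + 2 * s); move: ((1 + 2 * s) ^+ n) => e.
by move=> /(_ ltac:(lra)) e0; nra.
Qed.

(** A real-variable substitute for the Bernstein-Walsh growth bound. Discrete orthogonality recovers
    each Chebyshev coefficient from the values at the nodes, hence a bound [2 * B], and
    [chebT_coef_bound] carries it to the monomial basis. *)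
Lemma coef_bound (N : nat) (B : R) p k s : 0 <= s -> (size p <= N.+1)%N ->
  (forall x, -1 <= x <= 1 -> `|p.[x]| <= B) ->
  `|p`_k| * s ^+ k <= 2 * N.+1%:R * (1 + 2 * s) ^+ N * B.
Proof.
move=> s0 sp pB; have [c pc] := chebT_basis sp.
have B0 : 0 <= B by apply: le_trans (pB 0 _) => //; lra.
pose M := (N + N).+1; have M0 : (0 : R) < M%:R by rewrite ltr0n.
have cB j : (j < N.+1)%N -> `|c j| <= 2 * B.
  move=> jN; pose e : R := if j == 0%N then 1 else 2^-1.
  have e2 : 2^-1 <= e by rewrite /e; case: ifP => _; lra.
  have H : \sum_(k < M) p.[cnode M k] * (chebT j).[cnode M k] = M%:R * e * c j.
    rewrite pc; under eq_bigr => i _ do rewrite horner_sum mulr_suml.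
    rewrite exchange_big/= (bigD1 (Ordinal jN))//= [X in _ + X]big1 => [|i ij].
      rewrite addr0; under eq_bigr => i _ do rewrite hornerZ -mulrA.
      rewrite -mulr_sumr cnode_orth; last by rewrite /M; lia.
      by rewrite eqxx mul1r -/e mulrC.
    under eq_bigr => k0 _ do rewrite hornerZ -mulrA.
    rewrite -mulr_sumr cnode_orth; last by have := ltn_ord i; rewrite /M; lia.
    rewrite (_ : ((i : nat) == j) = false) ?mul0r ?mulr0//.
    by apply/eqP => ij'; case/eqP: ij; apply: val_inj.
  have : `|M%:R * e * c j| <= M%:R * B.
    rewrite -H; apply: (le_trans (ler_norm_sum _ _ _)).
    apply: (@le_trans _ _ (\sum_(k < M) B)); last by rewrite sumr_const card_ord mulr_natl.
    apply: ler_sum => k0 _; rewrite normrM.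
    have := pB _ (@cnode_itv R M k0); have := chebT_le1 j (@cnode_itv R M k0).
    by move=> h1 h2; rewrite -[leRHS]mulr1 ler_pM.
  rewrite -mulrA normrM (gtr0_norm M0) ler_pM2l// normrM ger0_norm; last by lra.
  by move: (normr_ge0 (c j)) => ? ?; nra.
rewrite {1}pc coef_sum.
apply: (@le_trans _ _ (\sum_(j < N.+1) 2 * B * (1 + 2 * s) ^+ N)).
  apply: (@le_trans _ _ (\sum_(j < N.+1) `|c j| * (`|(chebT j)`_k| * s ^+ k))).
    rewrite -(ger0_norm (exprn_ge0 k s0)) -normrM mulr_suml.
    apply: (le_trans (ler_norm_sum _ _ _)); apply: ler_sum => j _.
    by rewrite coefZ !normrM mulrA.
  apply: ler_sum => j _; apply: ler_pM; rewrite ?mulr_ge0 ?exprn_ge0//; first exact: cB.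
  apply: (le_trans (chebT_coef_bound _ _ s0)); rewrite ler_weXn2l//; first by lra.
  by rewrite -ltnS.
rewrite sumr_const card_ord -mulr_natl; rewrite le_eqVlt; apply/orP; left; apply/eqP; ring.
Qed.

End approximation_operators.

(** * Polynomial approximation in one variable *)

Section one_variable.
Context {R : realType}.
Implicit Types (p : {poly R}) (x y s t e C : R) (g h : R -> R).

Definition papprox (n : nat) e g :=
  exists2 p : {poly R}, (size p <= n.+1)%N &
    forall x, -1 <= x <= 1 -> `|g x - p.[x]| <= e.

(** The hypothesis measures [g] at scale [1 / N] and is met alike by bounded, Lipschitz and Holder
    functions with suitable [D]. The constant 181 adds the mass 1 of the operator to its second
    moment 180. *)
Lemma jackson0 (N : nat) D g : (0 < N)%N ->
  (forall x y, -1 <= x <= 1 -> -1 <= y <= 1 ->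
    `|g x - g y| <= D * (1 + N%:R ^+ 2 * (x - y) ^+ 2)) ->
  papprox N (181 * D) g.
Proof.
move=> N0 gD; have [m [y [w [y1 sw w0 w1 w2]]]] := @jackson_operator R _ N0.
have D0 : 0 <= D.
  have := gD 0 0; rewrite !subrr normr0 expr0n mulr0 addr0 mulr1; apply; lra.
exists (\sum_k g (y k) *: w k) => [|x x1].
  apply: (leq_trans (size_sum _ _ _)); apply/bigmax_leqP => k _.
  exact: leq_trans (size_scale_leq _ _) (sw k).
have -> : g x - (\sum_k g (y k) *: w k).[x] = \sum_k (g x - g (y k)) * (w k).[x].
  rewrite horner_sum -[g x in LHS]mulr1 -(w1 x) mulr_sumr -sumrB.
  by apply: eq_bigr => k _; rewrite hornerZ mulrBl.
apply: (le_trans (ler_norm_sum _ _ _)).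
apply: (@le_trans _ _ (\sum_k D * ((w k).[x] + N%:R ^+ 2 * (x - y k) ^+ 2 * (w k).[x]))).
  apply: ler_sum => k _; rewrite normrM (ger0_norm (w0 _ _ _))//.
  by rewrite -[X in _ * (X + _)]mul1r -mulrDl mulrA ler_wpM2r ?w0// gD.
rewrite -mulr_sumr big_split/= w1 mulrC ler_wpM2r//.
by have := w2 x x1; lra.
Qed.

Lemma lipschitz_itv (a b e : R) h (dh : R -> R) : 
  (forall x, a <= x <= b -> is_derive x 1 h (dh x)) ->
  (forall x, a <= x <= b -> `|dh x| <= e) ->
  forall x y, a <= x <= b -> a <= y <= b -> `|h x - h y| <= e * `|x - y|.
Proof.
move=> hd he x y; wlog xy : x y / y <= x => [H xab yab|].
  have [yx|/ltW xy] := leP y x; first exact: H.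
  by rewrite distrC (distrC x) H.
move=> /andP[ax xb] /andP[ay yb].
have hdi z : z \in `[y, x]%R -> is_derive z 1 h (dh z).
  by rewrite in_itv => /andP[yz zx]; apply: hd; rewrite (le_trans ay)// (le_trans zx).
have hdo z : z \in `]y, x[%R -> is_derive z 1 h (dh z).
  by rewrite in_itv => /andP[/ltW yz /ltW zx]; apply: hdi; rewrite in_itv/= yz.
have hc : {within `[y, x], continuous h}.
  by apply: derivable_within_continuous => z /hdi zd; exact: ex_derive.
have [c cyx ->] := MVT_segment xy hdo hc.
rewrite normrM ler_wpM2r//; apply: he; move: cyx; rewrite in_itv => /andP[yc cx].
by rewrite (le_trans ay)// (le_trans cx).
Qed.

Lemma poly_antideriv p : exists2 q : {poly R}, (size q <= (size p).+1)%N & q^`() = p.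
Proof.
exists (\poly_(i < (size p).+1) (p`_i.-1 / i%:R)); first exact: size_poly.
apply/polyP => i; rewrite coef_deriv coef_poly ltnS.
case: ltnP => [ip|pi]; last by rewrite nth_default// mul0rn.
by rewrite -[LHS]mulr_natr divfK// pnatr_eq0.
Qed.

Lemma jackson1 (m : nat) e g dg :
  (forall x, -1 <= x <= 1 -> is_derive x 1 g (dg x)) ->
  papprox m e dg -> papprox m.+1 (181 / m.+1%:R * e) g.
Proof.
move=> gd [q sq qe]; have [Q sQ dQ] := poly_antideriv q.
have e0 : 0 <= e by apply: le_trans (qe 0 _) => //; lra.
have N0 : (0 : R) < m.+1%:R by rewrite ltr0n.
have [x y x1 y1|p sp pe] := @jackson0 m.+1 (e / m.+1%:R) (g \- horner Q) isT.
  have hd (z : R) : -1 <= z <= 1 -> is_derive z 1 (g \- horner Q) (dg z - q.[z]).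
    by move=> z1; have := gd _ z1 => ?; rewrite -dQ; apply: is_deriveB.
  apply: (le_trans (lipschitz_itv hd qe x1 y1)).
  rewrite -mulrA ler_wpM2l// -ler_pdivrMl ?invr_gt0// invrK.
  rewrite -[(x - y) ^+ 2]real_normK ?num_real//.
  have := normr_ge0 (x - y); have := N0; move: `|_| (m.+1%:R) => a b b0 a0.
  by nra.
exists (p + Q) => [|x x1].
  apply: (leq_trans (size_polyD _ _)); rewrite geq_max sp/=.
  by apply: (leq_trans sQ); rewrite ltnS (leq_trans sq).
by rewrite hornerD (addrC p.[x]) opprD addrA (le_trans (pe x x1))// mulrA mulrAC.
Qed.

Lemma jackson (m n : nat) e (G : nat -> R -> R) :
  (forall k x, (k < n)%N -> -1 <= x <= 1 -> is_derive x 1 (G k) (G k.+1 x)) ->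
  papprox m e (G n) -> papprox (m + n) ((181 / m.+1%:R) ^+ n * e) (G 0%N).
Proof.
elim: n G => [|n IH] G Gd Gn; first by rewrite addn0 expr0 mul1r.
have := IH (fun k => G k.+1) (fun k x kn => Gd k.+1 x kn) Gn.
move=> /(jackson1 (fun x => Gd 0%N x isT)) [p sp pe].
exists p; first by rewrite addnS.
move=> x x1; apply: (le_trans (pe x x1)).
have e0 : 0 <= e by case: Gn => q _ qe; apply: le_trans (qe 0 _) => //; lra.
rewrite exprS -[leRHS]mulrA ler_wpM2r ?mulr_ge0 ?exprn_ge0 ?divr_ge0//.
(* The degree has already grown to [m + n], so the factor of this step is no larger than
   [181 / (m + 1)]. *)
by rewrite ler_wpM2l// lef_pV2 ?posrE ?ltr0n// ler_nat ltnS leq_addr.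
Qed.

Lemma cvg_geo_bound (u : nat -> R) B r : 0 <= r < 1 ->
  (forall n, `|u n.+1 - u n| <= B * r ^+ n) ->
  exists2 l, u @ \oo --> l & forall n, `|l - u n| <= B * r ^+ n / (1 - r).
Proof.
move=> /andP[r0 r1] uB.
have B0 : 0 <= B by have := uB 0%N; rewrite expr0 mulr1; exact: le_trans.
have r1' : `|r| < 1 by rewrite ger0_norm.
have D m n : `|u (n + m)%N - u n| <= B * r ^+ n / (1 - r).
  have -> : u (n + m)%N - u n = \sum_(0 <= i < m) (u (n + i).+1 - u (n + i)%N).
    under eq_bigr => i _ do rewrite -addnS.
    by rewrite (telescope_sumr (fun i => u (n + i)%N))// addn0.
  apply: (le_trans (ler_norm_sum _ _ _)).
  apply: (@le_trans _ _ (\sum_(0 <= i < m) B * r ^+ n * r ^+ i)).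
    by apply: ler_sum => i _; rewrite -mulrA -exprD.
  have -> : \sum_(0 <= i < m) B * r ^+ n * r ^+ i = series (geometric (B * r ^+ n) r) m by [].
  rewrite geometric_seriesE ?lt_eqF//= ler_wpM2r ?invr_ge0 ?subr_ge0 ?(ltW r1)//.
  by rewrite ler_piMr ?mulr_ge0 ?exprn_ge0// gerBl exprn_ge0.
have cu : cvgn u.
  apply/cauchy_cvgP/cauchy_exP => e e0.
  have c0 : (fun n => B / (1 - r) * r ^+ n) @ \oo --> (0 : R) by apply: (@cvg_geometric R).
  have /cvgr0_norm_lt/(_ _ e0)[N _ HN] := c0.
  exists (u N); exists N => // n /= Nn.
  rewrite /ball/= distrC -(subnKC Nn); apply: (le_lt_trans (D _ _)).
  have := HN N (leqnn N); rewrite /= ger0_norm ?mulr_ge0 ?invr_ge0 ?subr_ge0 ?exprn_ge0 ?(ltW r1)//.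
  by rewrite mulrAC.
exists (limn u) => // n.
have cun : `|u m - u n| @[m --> \oo] --> `|limn u - u n|.
  by apply: cvg_norm; apply: cvgB => //; exact: cvg_cst.
apply: (cvgr_to_le cun); near=> m.
have nm : (n <= m)%N by near: m; exact: nbhs_infty_ge.
by rewrite -(subnKC nm); exact: D.
Unshelve. all: by end_near. Qed.

(** Each of the [n + 1] powers [r ^ i] with [i <= n] is at least [r ^ n], so the left side is below
    a partial sum of the geometric series. *)
Lemma ler_natM_geo (n : nat) (r : R) : 0 <= r < 1 -> n.+1%:R * r ^+ n <= (1 - r)^-1.
Proof.
move=> /andP[r0 r1]; rewrite -div1r ler_pdivlMr ?subr_gt0//.
apply: (@le_trans _ _ ((\sum_(i < n.+1) r ^+ i) * (1 - r))).
  rewrite ler_wpM2r ?subr_ge0 ?(ltW r1)//.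
  rewrite -[n.+1 in leLHS]card_ord mulr_natl -sumr_const ler_sum// => i _.
  by rewrite ler_wiXn2l ?(ltW r1)// -ltnS.
by rewrite mulrC -opprB mulNr -subrX1 opprB gerBl exprn_ge0.
Qed.

Lemma cvg0_ge (u : nat -> R) e : u @ \oo --> 0 -> 0 < e -> exists N, forall n, (N <= n)%N -> `|u n| < e.
Proof. by move=> /cvgr0_norm_lt/(_ _)/[apply] -[N _ HN]; exists N. Qed.

(* The coefficients of [P (N.+1) - P N] are controlled by [coef_bound]; the
   value of [s] makes [(1 + 2 s) ^ c <= 9 / 8], so that the growth off the
   interval does not destroy the rate [2 ^- N]. *)
Lemma series_of_papprox (c : nat) C g (P : nat -> {poly R}) : (0 < c)%N ->
  (forall x, -1 <= x <= 1 -> `|g x| <= C) ->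
  (forall n, (size (P n) <= (c * n).+1)%N) ->
  (forall n x, -1 <= x <= 1 -> `|g x - (P n).[x]| <= C * 2 ^- n) ->
  let s : R := (18 * c%:R)^-1 in
  exists a : nat -> R,
  [/\ forall k, (P n)`_k @[n --> \oo] --> a k,
      forall k, `|a k| <= (300 * c%:R * C) * s ^- k &
      forall t, `|t| < s -> series (fun k => a k * t ^+ k) @ \oo --> g t].
Proof.
move=> c0 gC sP PC s.
have c0' : (0 : R) < c%:R by rewrite ltr0n.
have c1 : (1 : R) <= c%:R by rewrite ler1n.
have C0 : 0 <= C by apply: le_trans (gC 0 _) => //; lra.
have s0 : 0 < s by rewrite invr_gt0 mulr_gt0.
have s1 : s <= 1 by rewrite invf_le1 ?mulr_gt0//; lra.
(* With [x = 2 s], Bernoulli's inequality gives [(1 - x) ^ c >= 1 - c x = 8 / 9], and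
   [(1 + x) ^ c (1 - x) ^ c <= 1]. *)
have sc : (1 + 2 * s) ^+ c <= 9 / 8.
  pose x := 2 * s; have x0 : 0 < x by rewrite mulr_gt0.
  have cx : c%:R * x = 9^-1 by rewrite /x /s; field; lra.
  have x1 : x <= 1.
    have : x <= c%:R * x by rewrite ler_peMl// ltW.
    by rewrite cx; lra.
  have B n : 1 - n%:R * x <= (1 - x) ^+ n.
    elim: n => [|n IH]; first by rewrite mul0r subr0 expr0.
    rewrite exprS -natr1; apply: le_trans (ler_wpM2l _ IH); last by lra.
    have n0 : (0 : R) <= n%:R by []; nra.
  have {}B := B c; rewrite cx in B.
  have H : (1 + x) ^+ c * (1 - x) ^+ c <= 1.
    rewrite -exprMn exprn_ile1//.
      by rewrite mulr_ge0//; move: cx; nra.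
    by nra.
  have E0 : 0 <= (1 + x) ^+ c by rewrite exprn_ge0//; lra.
  move: B H E0; rewrite -/x; move: ((1 + x) ^+ c) ((1 - x) ^+ c) => a b; nra.
pose d n := P n.+1 - P n.
have dC n x : -1 <= x <= 1 -> `|(d n).[x]| <= 2 * C * 2 ^- n.
  move=> x1; have := PC n x x1; have := PC n.+1 x x1.
  rewrite /d hornerD hornerN exprS invfM.
  have e0 : (0 : R) < 2 ^- n by rewrite invr_gt0 exprn_gt0.
  move: (2 ^- n) e0 ((P n.+1).[x]) ((P n).[x]) (g x) => e e0 a b z.
  rewrite !ler_norml => /andP[? ?] /andP[? ?].
  by apply/andP; split; nra.
pose K := 72 * c%:R * C.
have K0 : 0 <= K by rewrite !mulr_ge0.
have dk n k : `|(P n.+1)`_k - (P n)`_k| <= K * s ^- k * (3 / 4) ^+ n.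
  have sd : (size (d n) <= (c * n.+1).+1)%N.
    apply: (leq_trans (size_polyD _ _)); rewrite size_polyN geq_max sP/=.
    by rewrite (leq_trans (sP _))// ltnS leq_mul2l leqnSn orbT.
  have := coef_bound k (ltW s0) sd (dC n).
  rewrite coefB -ler_pdivlMr ?exprn_gt0// => /le_trans; apply.
  have sk0 : 0 <= s ^- k by rewrite invr_ge0 exprn_ge0// ltW.
  rewrite [leRHS]mulrAC; apply: (ler_wpM2r sk0).
  have E1 : (1 + 2 * s) ^+ (c * n.+1) <= (9 / 8) ^+ n.+1.
    by rewrite exprM lerXn2r ?nnegrE ?exprn_ge0//; lra.
  have E2 : ((c * n.+1).+1%:R : R) <= 2 * c%:R * n.+1%:R.
    by rewrite -!natrM ler_nat; nia.
  have E3 := @ler_natM_geo n (3 / 4) ltac:(lra).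
  (* Growth [9 / 8] against decay [1 / 2] leaves [9 / 16 = (3 / 4) ^ 2] per step: one factor [3 / 4]
     absorbs the [n + 1], the other makes the coefficients converge. *)
  have e34 : (9 / 8 : R) ^+ n.+1 * 2 ^- n = 9 / 8 * ((3 / 4) ^+ n * (3 / 4) ^+ n).
    rewrite exprS -mulrA -exprVn -!exprMn; congr (_ * _ ^+ _); by field.
  apply: (@le_trans _ _ (2 * (2 * c%:R * n.+1%:R) * (9 / 8) ^+ n.+1 * (2 * C * 2 ^- n))).
    rewrite ler_wpM2r ?mulr_ge0 ?invr_ge0 ?exprn_ge0//.
    by rewrite ler_pM ?mulr_ge0 ?exprn_ge0// ?ler_pM2l//; lra.
  have -> : 2 * (2 * c%:R * n.+1%:R) * (9 / 8) ^+ n.+1 * (2 * C * 2 ^- n) =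
      9 * c%:R * C * (n.+1%:R * (3 / 4) ^+ n) * (3 / 4) ^+ n.
    transitivity (8 * c%:R * n.+1%:R * C * ((9 / 8) ^+ n.+1 * 2 ^- n)); first by ring.
    by rewrite e34; field.
  apply: ler_wpM2r; first by rewrite exprn_ge0//; lra.
  apply: (@le_trans _ _ (9 * c%:R * C * (1 - 3 / 4)^-1)).
    by rewrite ler_wpM2l// !mulr_ge0.
  by rewrite /K (_ : (1 - 3 / 4)^-1 = 4); [nra|field].
have /choice[a Ha] : forall k, exists l : R, (P n)`_k @[n --> \oo] --> l /\
    forall n, `|l - (P n)`_k| <= K * s ^- k * (3 / 4) ^+ n * 4.
  move=> k; have [l Pl lB] := @cvg_geo_bound (fun n => (P n)`_k) _ (3 / 4) ltac:(lra) (fun n => dk n k).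
  exists l; split=> // n; apply: le_trans (lB n) _.
  by rewrite (_ : 1 - 3 / 4 = 4^-1) ?invrK//; field.
exists a; split; first by move=> k; case: (Ha k).
- move=> k; have := (Ha k).2 0%N; rewrite expr0 mulr1 => B.
  have P0 : `|(P 0%N)`_k| <= 2 * C * s ^- k.
    have := sP 0%N; rewrite muln0 => /size1_polyC P0.
    have z01 : -1 <= (0 : R) <= 1 by rewrite lerN10 ler01.
    have := PC 0%N 0 z01; rewrite expr0 invr1 mulr1 P0 hornerC coefC.
    have := gC 0 z01.
    case: eqP => [->|_ _ _]; last by rewrite normr0 !mulr_ge0// invr_ge0 exprn_ge0// ltW.
    rewrite expr0 invr1 mulr1; move: ((P 0%N)`_0) (g 0) => u b.
    by rewrite !ler_norml => /andP[? ?] /andP[? ?]; apply/andP; split; lra.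
  rewrite -[a k](subrK (P 0%N)`_k) (le_trans (ler_normD _ _))// (le_trans (lerD B P0))//.
  have : 0 <= s ^- k by rewrite invr_ge0 exprn_ge0// ltW.
  by rewrite /K; move: (s ^- k) => z z0; rewrite mulrAC -mulrDl ler_wpM2r//; nra.
move=> t ts.
pose r := `|t| / s; have r01 : 0 <= r < 1.
  by rewrite divr_ge0 ?(ltW s0)//= ltr_pdivrMr// mul1r.
have r1 : 0 < 1 - r by case/andP: r01; lra.
have t1 : -1 <= t <= 1 by rewrite -ler_norml (le_trans (ltW ts)).
apply/cvgrPdist_le => e e0.
pose B := C + K * 4 / (1 - r) + 1.
have B0 : 0 < B by rewrite ltr_pwDr// addr_ge0// divr_ge0 ?mulr_ge0// ltW.
have [N /(_ N (leqnn N)) NB] : exists N, forall n, (N <= n)%N -> `|(3 / 4 : R) ^+ n| < e / B.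
  apply: cvg0_ge; last by rewrite divr_gt0.
  by apply: cvg_expr; rewrite ger0_norm; lra.
rewrite ger0_norm in NB; last by rewrite exprn_ge0//; lra.
near=> m.
(* Past [c N] terms the partial sum covers all of [P N], so the remainder is the error of [P N]
   minus a sum of coefficient errors. *)
have cNm : (c * N < m)%N by near: m; exact: nbhs_infty_gt.
have -> : g t - series (fun k => a k * t ^+ k) m =
    (g t - (P N).[t]) - \sum_(0 <= k < m) (a k - (P N)`_k) * t ^+ k.
  rewrite (@horner_coef_wide _ m); last exact: leq_trans (sP N) _.
  rewrite /series/= -(big_mkord predT (fun k => (P N)`_k * t ^+ k)).
  under [X in _ = _ - X]eq_bigr => k _ do rewrite mulrBl.
  by rewrite sumrB; ring.
apply: (le_trans (ler_normB _ _)).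
have E1 : `|g t - (P N).[t]| <= C * (3 / 4) ^+ N.
  apply: (le_trans (PC N t t1)); rewrite ler_wpM2l// -exprVn lerXn2r ?nnegrE//; lra.
have E2 : `|\sum_(0 <= k < m) (a k - (P N)`_k) * t ^+ k| <= K * 4 / (1 - r) * (3 / 4) ^+ N.
  apply: (le_trans (ler_norm_sum _ _ _)).
  apply: (@le_trans _ _ (\sum_(0 <= k < m) (K * 4 * (3 / 4) ^+ N) * r ^+ k)).
    apply: ler_sum => k _; rewrite normrM normrX /r [(_ / s) ^+ k]expr_div_n.
    have := (Ha k).2 N => /(ler_wpM2r (exprn_ge0 k (normr_ge0 t)))/le_trans; apply.
    by rewrite le_eqVlt; apply/orP; left; apply/eqP; ring.
  have -> : \sum_(0 <= k < m) (K * 4 * (3 / 4) ^+ N) * r ^+ k =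
    series (geometric (K * 4 * (3 / 4) ^+ N) r) m by [].
  rewrite geometric_seriesE/=; last by rewrite lt_eqF//; case/andP: r01.
  rewrite [leRHS]mulrAC ler_wpM2r ?invr_ge0 ?(ltW r1)//.
  have z0 : 0 <= K * 4 * (3 / 4) ^+ N by rewrite !mulr_ge0// exprn_ge0//; lra.
  by rewrite ler_piMr// gerBl exprn_ge0//; case/andP: r01.
apply: (le_trans (lerD E1 E2)); rewrite -mulrDl.
move: NB; rewrite ltr_pdivlMr// => NB; apply: le_trans (ltW NB).
rewrite mulrC ler_wpM2l ?exprn_ge0//; last by rewrite /B; lra.
Unshelve. all: by end_near. Qed.

End one_variable.

(** * Power series in one variable *)

Section analytic_one_variable.
Context {R : realType}.
Implicit Types (g : R -> R) (a : nat -> R) (s C t : R).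

(** Radius of convergence at least [s], with a constant for each smaller radius. In this form,
    unlike a single bound by [C * s ^- k], the property passes to the differentiated series with the
    same [s]. *)
Definition geo_dominated s a := forall r, 0 < r < s -> exists C, forall k, `|a k| * r ^+ k <= C.

Lemma geo_dominated_cvg s a t : geo_dominated s a -> `|t| < s -> cvgn (pseries a t).
Proof.
move=> ad ts; pose r := (`|t| + s) / 2.
have t0 := normr_ge0 t; have tr : `|t| < r by rewrite /r; lra.
have r0 : 0 < r by rewrite /r; lra.
have [|C aC] := ad r; first by rewrite /r; lra.
have q1 : `|(`|t| / r)| < 1 by rewrite (ger0_norm (divr_ge0 t0 (ltW r0))) ltr_pdivrMr// mul1r.
apply: normed_cvg; apply: (@series_le_cvg _ _ (geometric C (`|t| / r))).
- by move=> n; exact: normr_ge0.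
- move=> n; rewrite /geometric/= mulr_ge0 ?exprn_ge0 ?(divr_ge0 t0 (ltW r0))//.
  by apply: le_trans (aC 0%N); rewrite expr0 mulr1.
- move=> n; rewrite /geometric/= normrM normrX expr_div_n.
  by rewrite [leRHS]mulrCA [leLHS]mulrC ler_wpM2l ?exprn_ge0// ler_pdivlMr ?exprn_gt0.
- exact: is_cvg_geometric_series.
Qed.

Lemma geo_dominated_diffs s a : geo_dominated s a -> geo_dominated s (pseries_diffs a).
Proof.
move=> ad r /andP[r0 rs]; pose r' := (r + s) / 2.
have r'0 : 0 < r' by rewrite /r'; lra.
have [|C aC] := ad r'; first by rewrite /r'; lra.
have q01 : 0 <= r / r' < 1.
  by rewrite divr_ge0 ?(ltW r0) ?(ltW r'0)//= ltr_pdivrMr// mul1r /r'; lra.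
exists (C / r' * (1 - r / r')^-1) => k.
rewrite /pseries_diffs normrM ger0_norm//.
have := @ler_natM_geo R k (r / r') q01; rewrite expr_div_n => H.
have -> : k.+1%:R * `|a k.+1| * r ^+ k =
    (`|a k.+1| * r' ^+ k.+1 / r') * (k.+1%:R * (r ^+ k / r' ^+ k)).
  by rewrite exprS; field; rewrite expf_neq0// gt_eqF.
apply: ler_pM => //; rewrite ?mulr_ge0 ?invr_ge0 ?exprn_ge0 ?(ltW r0) ?(ltW r'0)//.
by rewrite ler_wpM2r ?invr_ge0 ?(ltW r'0).
Qed.

Lemma pseries_derive_chain g s a (t0 : R) : geo_dominated s a ->
  (forall h, `|h| < s -> pseries a h @ \oo --> g (t0 + h)) ->
  forall n, (forall h, `|h| < s -> derive1n n g (t0 + h) = limn (pseries (iter n (@pseries_diffs R) a) h)) /\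
    (forall h, `|h| < s -> is_derive (t0 + h) 1 (derive1n n g) (derive1n n.+1 g (t0 + h))).
Proof.
move=> ad ag n; pose A n := iter n (@pseries_diffs R) a.
have Ad m : geo_dominated s (A m) by elim: m => [//|m IH]; exact: geo_dominated_diffs.
have step m : (forall h, `|h| < s -> derive1n m g (t0 + h) = limn (pseries (A m) h)) ->
    forall h, `|h| < s -> is_derive (t0 + h) 1 (derive1n m g) (limn (pseries (A m.+1) h)).
  move=> Em h hs.
  (* Termwise differentiation asks for convergence at a point strictly farther out than [h]. *)
  pose K := (`|h| + s) / 2; have h0 := normr_ge0 h.
  have K0 : 0 < K by rewrite /K; lra.
  have Ks : `|K| < s by rewrite gtr0_norm// /K; lra.
  have D : is_derive h 1 (fun x => limn (pseries (A m) x)) (limn (pseries (A m.+1) h)).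
    apply: (@pseries_snd_diffs _ _ K).
    - exact: geo_dominated_cvg Ks.
    - exact: (geo_dominated_cvg (Ad m.+1)).
    - exact: (geo_dominated_cvg (Ad m.+2)).
    - by rewrite (gtr0_norm K0) /K; lra.
  have D2 : is_derive (t0 + h) 1 ((fun x => limn (pseries (A m) x)) \o (fun z => z - t0))
      (limn (pseries (A m.+1) h) * 1).
    apply: is_derive1_comp; first by rewrite addrAC subrr add0r.
    by apply: is_derive_eq; rewrite subr0.
  rewrite mulr1 in D2; apply: near_eq_is_derive D2.
  near=> z.
  have zs : `|z - t0| < s.
    near: z; apply/nbhs_ballP; exists (s - `|h|) => /=; first by rewrite subr_gt0.
    move=> z; rewrite /ball/= => zb.
    have -> : z - t0 = - (t0 + h - z) + h by ring.
    by rewrite (le_lt_trans (ler_normD _ _))// normrN -ltrBrDr.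
  by rewrite /= -Em// addrC subrK.
have E m : forall h, `|h| < s -> derive1n m g (t0 + h) = limn (pseries (A m) h).
  elim: m => [|m IH] h hs; first by rewrite derive1n0; apply/esym/cvg_lim => //; exact: ag.
  by rewrite derive1nS derive1E; have := step m IH h hs => ?; rewrite derive_val.
split; first exact: E.
by move=> h hs; rewrite E//; apply: step => //; exact: E.
Unshelve. all: by end_near. Qed.

Lemma fact_le_expn n : (n`! <= n ^ n)%N.
Proof.
elim: n => [//|n IH]; rewrite factS expnS leq_mul2l /=.
by apply: leq_trans IH _; case: n => [//|n]; rewrite leq_exp2r.
Qed.

(* [jackson] with [n] derivatives, bounded by [C n! s ^- n], at degree [L' n]
   costs the factor [(181 / (L' n)) ^ n], and [n! <= n ^ n]. *)
Lemma analytic_papprox C s : 0 < s -> exists2 L, (0 < L)%N & forall g,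
  (forall t, -1 <= t <= 1 -> exists2 a, (forall k, `|a k| <= C * s ^- k) &
     forall h, `|h| < s -> pseries a h @ \oo --> g (t + h)) ->
  forall n, papprox (L * n) (C * 2 ^- n) g.
Proof.
(* The number 362 is [2 * 181]: it makes the Jackson factor [181 / (L' n + 1)] times [n / s] at most
   [2^-1]. *)
move=> s0; pose L' := (Num.truncn (362 / s)).+1.
have sL : 362 <= s * L'%:R.
  by rewrite mulrC -ler_pdivrMr// ltW// truncnS_gt.
exists L'.+1 => // g ga n.
have C0 : 0 <= C.
  have [|a aC _] := ga 0; first by rewrite lerN10 ler01.
  by have := aC 0%N; rewrite expr0 invr1 mulr1; exact: le_trans.
have gn (x : R) : -1 <= x <= 1 -> (forall k, is_derive x 1 (derive1n k g) (derive1n k.+1 g x)) /\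
    `|derive1n n g x| <= n`!%:R * (C * s ^- n).
  move=> x1; have [a aC ag] := ga x x1.
  have ad : geo_dominated s a.
    move=> r /andP[r0 rs]; exists C => k; rewrite -ler_pdivlMr ?exprn_gt0//.
    apply: (le_trans (aC k)); rewrite ler_wpM2l// lef_pV2 ?posrE ?exprn_gt0//.
    by rewrite lerXn2r ?nnegrE// ltW.
  have H := pseries_derive_chain ad ag.
  split; first by move=> k; have := (H k).2 0; rewrite normr0 addr0; apply.
  have := (H n).1 0; rewrite normr0 addr0 => ->//.
  pose A m := iter m (@pseries_diffs R) a.
  have -> : limn (pseries (A n) 0) = A n 0%N.
    apply/cvg_lim => //; apply: cvg_near_cst; near=> m.
    have m0 : (0 < m)%N by near: m; exact: nbhs_infty_gt.
    rewrite /pseries/series/= -(prednK m0) big_nat_recl//= expr0 mulr1.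
    by rewrite big1 ?addr0// => i _; rewrite expr0n mulr0.
  have AE m k : k`!%:R * A m k = (k + m)`!%:R * a (k + m)%N.
    elim: m k => [|m IH] k; first by rewrite addn0.
    by rewrite /A iterS /pseries_diffs -/(A m) mulrA -natrM mulnC -factS IH addSnnS.
  by have := AE n 0%N; rewrite add0n fact0 mul1r => ->; rewrite normrM ger0_norm// ler_wpM2l.
(* The [n]-th derivative is approximated by the zero polynomial; all the accuracy comes from the [n]
   Jackson steps. *)
have base : papprox (L' * n) (n`!%:R * (C * s ^- n)) (derive1n n g).
  by exists 0 => [|x x1]; rewrite ?size_poly0// horner0 subr0; case: (gn x x1).
have := @jackson R (L' * n) n _ (fun k => derive1n k g) (fun k x _ x1 => (gn x x1).1 k) base.
rewrite [(_ * n + n)%N]addnC -mulSn => -[p sp pe]; exists p => // x x1.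
apply: le_trans (pe x x1) _.
have -> : (181 / (L' * n).+1%:R) ^+ n * (n`!%:R * (C * s ^- n)) =
  C * ((181 / (L' * n).+1%:R) ^+ n * n`!%:R * s ^- n) by ring.
apply: ler_wpM2l => //; rewrite -2!exprVn.
apply: (@le_trans _ _ ((181 / (L' * n).+1%:R) ^+ n * n%:R ^+ n * s^-1 ^+ n)).
  rewrite ler_wpM2r ?exprn_ge0 ?invr_ge0 ?(ltW s0)// ler_wpM2l ?exprn_ge0 ?divr_ge0//.
  by rewrite -natrX ler_nat fact_le_expn.
rewrite -!exprMn lerXn2r ?nnegrE ?mulr_ge0 ?divr_ge0 ?invr_ge0 ?(ltW s0)//.
rewrite ler_pdivrMr// mulrAC ler_pdivrMr ?ltr0n//.
have n0 : (0 : R) <= n%:R by [].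
have -> : ((L' * n).+1%:R : R) = L'%:R * n%:R + 1 by rewrite -natrM natr1.
by have := ler_wpM2r n0 sL; have := s0; move: (L'%:R) (n%:R) => l m; lra.
Unshelve. all: by end_near. Qed.

End analytic_one_variable.

(** * Multilinear forms and polarization *)

Section polarization.
Context {R : realType} {V : normedModType R}.
Implicit Types (k : nat).

Lemma dfwithE (k : nat) (v : 'I_k -> V) i u j :
  @dfwith _ (fun=> V) v i u j = if j == i then u else v j.
Proof.
case: eqP => [->|/eqP ji]; first by rewrite dfwithin.
by rewrite dfwithout// eq_sym.
Qed.

Lemma multilinear_slot_sum k (B : ('I_k -> V) -> R) v i (J : finType) (c : J -> R) (w : J -> V) :
  multilinear B ->
  B (@dfwith _ (fun=> V) v i (\sum_j c j *: w j)) =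
  \sum_j c j * B (@dfwith _ (fun=> V) v i (w j)).
Proof.
move=> mB; pose f u := B (@dfwith _ (fun=> V) v i u).
have fS : scalar f by exact: mB.
have f0 : f 0 = 0 by have := fS (-1) 0 0; rewrite scaler0 addr0 mulN1r addNr.
have : forall r : seq J, f (\sum_(j <- r) c j *: w j) = \sum_(j <- r) c j * f (w j).
  by elim=> [|j r IH]; rewrite ?big_nil ?big_cons// fS IH.
exact.
Qed.

Lemma multilinear_expand k (B : ('I_k -> V) -> R) (J : finType) (c : 'I_k -> J -> R)
    (w : 'I_k -> J -> V) : multilinear B ->
  B (fun i => \sum_j c i j *: w i j) =
  \sum_(f : {ffun 'I_k -> J}) (\prod_i c i (f i)) * B (fun i => w i (f i)).
Proof.
move=> mB; case: k => [|k] in B c w mB *.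
  rewrite (big_pred1 (ffun0 (card_ord 0))).
    by rewrite big_ord0 mul1r; congr B; apply/funext => -[].
  by move=> f; apply/esym/eqP/ffunP => -[].
case: (pickP (@predT J)) => [j0 _|J0]; last first.
  rewrite [RHS]big1 => [|f _]; last by have := J0 (f ord0).
  have mB0 := mB (fun i => \sum_j c i j *: w i j) ord0 (-1) 0 0.
  rewrite scaler0 addr0 mulN1r addNr in mB0.
  rewrite -[RHS]mB0; congr B; apply/funext => i; rewrite dfwithE.
  by case: eqP => [->|//]; rewrite big1// => j; have := J0 j.
(* [W m f] has its first [m] slots expanded. On the other slots [f] is pinned to [j0] (this is
   [cl m]), so that every stage sums over the same function space. *)
pose W m (f : {ffun 'I_k.+1 -> J}) (i : 'I_k.+1) := if (i < m)%N then c i (f i) *: w i (f i) else \sum_j c i j *: w i j.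
pose cl m (f : {ffun 'I_k.+1 -> J}) := [forall i : 'I_k.+1, (m <= i)%N ==> (f i == j0)].
have main m : (m <= k.+1)%N ->
    B (fun i => \sum_j c i j *: w i j) = \sum_(f | cl m f) B (W m f).
  elim: m => [_|m IH mk].
    rewrite (big_pred1 [ffun=> j0]) => [|f]; first by congr B; apply/funext.
    apply/forallP/eqP => [fj|-> i]; last by rewrite ffunE eqxx implybT.
    by apply/ffunP => i; rewrite ffunE; apply/eqP; have := fj i.
  rewrite IH ?(ltnW mk)//; pose im := Ordinal mk.
  pose upd (f : {ffun 'I_k.+1 -> J}) j := [ffun i => if i == im then j else f i].
  rewrite [RHS](partition_big (fun f => upd f j0) (cl m)) /=; last first.
    move=> f /forallP fm; apply/forallP => i; apply/implyP => mi; rewrite ffunE.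
    case: (eqVneq i im) => [//|iim]; apply: (implyP (fm i)).
    rewrite ltn_neqAle mi andbT; apply: contra iim => /eqP mi'.
    by apply/eqP/val_inj.
  apply: eq_bigr => f fm; have fim : f im = j0 by apply/eqP/(implyP (forallP fm im)).
  transitivity (\sum_j B (W m.+1 (upd f j))).
    have -> : W m f = @dfwith _ (fun=> V) (W m f) im (\sum_j c im j *: w im j).
      apply/funext => i; rewrite dfwithE; case: eqP => [->|//].
      by rewrite /W /= ltnn.
    rewrite multilinear_slot_sum//; apply: eq_bigr => j _.
    have fS := mB (W m.+1 (upd f j)) im (c im j) (w im j) 0.
    have mB0 := mB (W m.+1 (upd f j)) im (-1) 0 0.
    rewrite scaler0 addr0 mulN1r addNr in mB0.
    rewrite mB0 !addr0 in fS.
    transitivity (c im j * B (@dfwith _ (fun=> V) (W m.+1 (upd f j)) im (w im j))).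
      congr (_ * B _); apply/funext => i; rewrite !dfwithE; case: eqP => [//|/eqP iim].
      rewrite /W ffunE (negbTE iim) ltnS [in RHS]leq_eqVlt.
      have -> : ((i : nat) == m) = false by apply: contra_neqF iim => /eqP im'; exact: val_inj.
      by [].
    rewrite -fS; congr B; apply/funext => i; rewrite dfwithE; case: eqP => [->|//].
    by rewrite /W ffunE eqxx /= ltnSn.
  symmetry; rewrite (reindex_onto (fun j => upd f j) (fun g : {ffun 'I_k.+1 -> J} => g im)) /=; last first.
    move=> g /andP[_ /eqP <-]; apply/ffunP => i; rewrite !ffunE.
    by case: eqP => [->|].
  apply: eq_bigl => j; rewrite !ffunE !eqxx andbT.
  apply/andP; split.
    apply/forallP => i; apply/implyP => mi; rewrite ffunE.
    case: (eqVneq i im) => [iim|_]; first by move: mi; rewrite iim /= ltnn.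
    by apply: (implyP (forallP fm i)); rewrite ltnW.
  apply/eqP/ffunP => i; rewrite !ffunE; case: eqP => [->|//].
  by rewrite fim.
rewrite (main k.+1)//; apply: eq_big => f.
  by apply/forallP => i; rewrite leqNgt ltn_ord.
move=> _; pose g i := w i (f i).
suff : forall m, B (fun i => if (i < m)%N then c i (f i) *: g i else g i) =
    (\prod_(i < k.+1 | (i < m)%N) c i (f i)) * B g.
  move=> /(_ k.+1); have <- : \prod_(i < k.+1) c i (f i) = \prod_(i < k.+1 | (i < k.+1)%N) c i (f i).
    by apply: eq_bigl => i; rewrite ltn_ord.
  move=> <-; by congr B; apply/funext => i; rewrite /W /= ltn_ord.
elim=> [|m IH]; first by rewrite big_pred0 ?mul1r.
have [km|mk] := leqP k.+1 m.
  have E (i : 'I_k.+1) : (i < m.+1)%N = (i < m)%N.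
    by rewrite (leq_trans (ltn_ord i) km) (leq_trans (ltn_ord i) (leqW km)).
  rewrite (eq_bigl (fun i : 'I_k.+1 => (i < m)%N) _ E) -IH; congr B.
  by apply/funext => i; rewrite E.
pose im := Ordinal mk.
rewrite (bigD1 im) ?ltnSn//= -mulrA.
rewrite (eq_bigl (fun i : 'I_k.+1 => (i < m)%N)) => [|i]; last first.
  by rewrite -val_eqE/= ltnS [in RHS]ltn_neqAle andbC.
rewrite -IH; pose G (i : 'I_k.+1) := if (i < m)%N then c i (f i) *: g i else g i; rewrite -[X in _ = _ * B X]/G.
have mB0 := mB G im (-1) 0 0; rewrite scaler0 addr0 mulN1r addNr in mB0.
have fS := mB G im (c im (f im)) (g im) 0; rewrite mB0 !addr0 in fS.
have -> : G = @dfwith _ (fun=> V) G im (g im).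
  by apply/funext => i; rewrite dfwithE; case: eqP => [->|//]; rewrite /G /= ltnn.
rewrite -fS; congr B; apply/funext => i; rewrite dfwithE /G; case: (eqVneq i im) => [->|iim] /=.
  by rewrite ltnSn.
rewrite ltnS leq_eqVlt (_ : ((i : nat) == m) = false)//.
by apply: contra_neqF iim => /eqP im'; exact: val_inj.
Qed.


(** The sum over [T] factors into a product over [j] of [1 - [j is not a value of f]], which
    vanishes unless [f] is onto, hence a bijection of ['I_k]. *)
Lemma signed_subset_sum k (f : {ffun 'I_k -> 'I_k}) :
  \sum_(T : {set 'I_k}) (-1) ^+ #|~: T| * (\prod_i (f i \in T)%:R) = (injectiveb f)%:R :> R.
Proof.
transitivity (\sum_(T : {set 'I_k}) \prod_j (if j \in T then 1 else - (j \notin codom f)%:R) : R).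
  apply: eq_bigr => T _; case: (boolP [forall i, f i \in T]) => [/forallP fT|].
    rewrite [X in _ * X]big1 ?mulr1 => [|i _]; last by rewrite fT.
    rewrite (bigID (mem T))/= [X in X * _]big1 ?mul1r => [|i ->//].
    rewrite (eq_bigr (fun=> -1)) => [|j jT].
      by rewrite prodr_const; congr (_ ^+ _); apply: eq_card => j; rewrite !inE.
    rewrite (negbTE jT) (_ : j \notin codom f = true)//.
    by apply: contra jT => /codomP[i ->].
  move=> /forallPn/=[i fiT]; rewrite (bigD1 i)//= (negbTE fiT) mul0r mulr0.
  by rewrite [RHS](bigD1 (f i))//= (negbTE fiT) codom_f oppr0 mul0r.
rewrite -bigA_distr; case: (boolP (injectiveb f)) => [/injectiveP fi|fni].
  by rewrite big1// => j _; rewrite injF_onto//= oppr0 addr0.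
have [j jf] : exists j, j \notin codom f.
  apply/existsP; apply: contraNT fni => /existsPn fs.
  have : #|codom f| = #|'I_k| by apply: eq_card => j; rewrite inE; apply/negPn.
  move=> cf; rewrite /injectiveb /dinjectiveb.
  by apply/card_uniqP; rewrite cf size_map -cardE.
by rewrite (bigD1 j)//= jf subrr mul0r.
Qed.

(* Inclusion-exclusion over the index sets, as in Ryser's formula for the permanent. *)
Lemma polarization k (B : ('I_k -> V) -> R) (v : 'I_k -> V) : multilinear B ->
  \sum_(T : {set 'I_k}) (-1) ^+ #|~: T| * B (fun=> \sum_(j in T) v j) =
  \sum_(s : 'S_k) B (fun i => v (s i)).
Proof.
move=> mB.
transitivity (\sum_(T : {set 'I_k}) \sum_(f : {ffun 'I_k -> 'I_k})
    ((-1) ^+ #|~: T| * \prod_i (f i \in T)%:R) * B (fun i => v (f i))).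
  apply: eq_bigr => T _; under [RHS]eq_bigr => f _ do rewrite -mulrA.
  rewrite -mulr_sumr -(multilinear_expand (fun _ j => (j \in T)%:R) (fun _ j => v j) mB).
  congr (_ * B _); apply/funext => i; rewrite big_mkcond; apply: eq_bigr => j _.
  by case: ifP => _; rewrite ?scale1r ?scale0r.
rewrite exchange_big/=; under eq_bigr => f _ do rewrite -mulr_suml signed_subset_sum.
rewrite (bigID (fun f : {ffun 'I_k -> 'I_k} => injectiveb f))/= [X in _ + X]big1 ?addr0; last first.
  by move=> f /negbTE ->; rewrite mul0r.
rewrite (reindex_onto (fun s : 'S_k => pval s) (fun f => insubd (1%g : 'S_k) f)); last first.
  by move=> f fi; exact: (insubdK (1%g : 'S_k) fi).
apply: eq_big => s; first by rewrite (valP s) (valKd (1%g : 'S_k) s : insubd _ (pval s) = s) eqxx.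
by move=> _; rewrite (valP s) mul1r; congr B; apply/funext => i; rewrite pvalE.
Qed.

Lemma multilinear_line k (B : ('I_k -> V) -> R) (x y : V) : multilinear B ->
  exists2 p : {poly R}, (size p <= k.+1)%N & forall t, B (fun=> x + t *: y) = p.[t].
Proof.
move=> mB; exists (\sum_(f : {ffun 'I_k -> bool})
    B (fun i => if f i then y else x) *: 'X^(\sum_i (f i))) => [|t].
  apply: (leq_trans (size_sum _ _ _)); apply/bigmax_leqP => f _.
  apply: (leq_trans (size_scale_leq _ _)); rewrite size_polyXn ltnS.
  rewrite -[k in leqRHS]card_ord -sum1_card leq_sum// => i _; exact: leq_b1.
transitivity (B (fun=> \sum_(b : bool) (if b then t else 1) *: (if b then y else x))).
  by congr B; apply/funext => i; rewrite big_bool/= scale1r addrC.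
rewrite (multilinear_expand (fun _ b => if b then t else 1) (fun _ b => if b then y else x))//.
rewrite horner_sum; apply: eq_bigr => f _; rewrite hornerZ hornerXn mulrC; congr (_ * _).
rewrite expr_sum; apply: eq_bigr => i _.
by case: (f i).
Qed.

End polarization.

(** * Bernstein's inverse theorems *)

Section polynomial_functions.
Context {R : realType} {V : normedModType R}.
Implicit Types (P Q f : V -> R) (x y v h : V).

Lemma diff_criterion f x (l : V -> R) (K : R) : scalar l ->
  (forall v, `|l v| <= K * `|v|) ->
  (forall e, 0 < e -> \forall h \near (0 : V), `|f (x + h) - f x - l h| <= e * `|h|) ->
  differentiable f x /\ ('d f x : V -> R) = l.
Proof.
move=> lS lK fl.
pose L : {linear V -> R} := HB.pack l (GRing.isLinear.Build R V R *%R l lS).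
have Lc : continuous L.
  apply/linear_bounded_continuous/bounded_funP => r.
  exists (`|K| * r) => v vr; apply: (le_trans (lK v)).
  apply: (le_trans (ler_wpM2r (normr_ge0 _) (ler_norm K))).
  by rewrite ler_wpM2l.
have fE : f \o shift x = cst (f x) + L +o_ (0 : V) id.
  apply/eqaddoP => e e0; have := fl e e0; apply: filterS => h /=.
  by rewrite !fctE/= opprD addrA (addrC h x).
have dE := diff_unique Lc fE.
split; last by rewrite dE.
by apply/diff_locallyP; rewrite dE.
Qed.

(** Polynomial functions of degree at most the index, without coordinates. Generation from
    continuous linear forms gives differentiability, boundedness on balls and homogeneous parts by
    induction. *)
Inductive pol : nat -> (V -> R) -> Prop :=
| pol_cst m (c : R) : pol m (fun=> c)
| pol_lin m (l : V -> R) : scalar l -> continuous l -> pol m.+1 l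
| pol_add m P Q : pol m P -> pol m Q -> pol m (fun x => P x + Q x)
| pol_mul m n P Q : pol m P -> pol n Q -> pol (m + n) (fun x => P x * Q x)
| pol_weak m n P : (m <= n)%N -> pol m P -> pol n P.

Lemma pol_sum m (I : Type) (r : seq I) (D : pred I) (P : I -> V -> R) :
  (forall i, D i -> pol m (P i)) -> pol m (fun x => \sum_(i <- r | D i) P i x).
Proof.
move=> Pm; elim: r => [|i r IH].
  by rewrite (_ : (fun _ => _) = fun=> 0); [exact: pol_cst|apply/funext => x; rewrite big_nil].
case: (boolP (D i)) => Di.
  rewrite (_ : (fun _ => _) = fun x => P i x + \sum_(j <- r | D j) P j x).
    by apply: pol_add => //; exact: Pm.
  by apply/funext => x; rewrite big_cons Di.
rewrite (_ : (fun _ => _) = fun x => \sum_(j <- r | D j) P j x)//.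
by apply/funext => x; rewrite big_cons (negbTE Di).
Qed.

Lemma pol_scale m (c : R) P : pol m P -> pol m (fun x => c * P x).
Proof. by move=> mP; rewrite -[m]add0n; apply: pol_mul => //; exact: pol_cst. Qed.

Lemma pol_sub m n P Q : pol m P -> pol n Q -> pol (maxn m n) (fun x => P x - Q x).
Proof.
move=> mP nQ; rewrite (_ : (fun _ => _) = fun x => P x + (-1) * Q x); last first.
  by apply/funext => x; rewrite mulN1r.
apply: pol_add; first exact: (pol_weak (leq_maxl _ _)).
by apply: pol_scale; exact: (pol_weak (leq_maxr _ _)).
Qed.

Lemma pol_prod (I : Type) (r : seq I) m (P : I -> V -> R) :
  (forall i, pol m (P i)) -> pol (size r * m) (fun x => \prod_(i <- r) P i x).
Proof.
move=> Pm; elim: r => [|i r IH].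
  by rewrite (_ : (fun _ => _) = fun=> 1); [exact: pol_cst|apply/funext => x; rewrite big_nil].
rewrite (_ : (fun _ => _) = fun x => P i x * \prod_(j <- r) P j x).
  by rewrite mulSn; apply: pol_mul.
by apply/funext => x; rewrite big_cons.
Qed.

Lemma pol_diff m P : pol m P -> (forall x, differentiable P x) /\
  (forall v, pol m (fun x => 'd P x v)).
Proof.
elim=> {m P} [m c|m l lS lc|m P Q mP [dP P'] mQ [dQ Q']|m n P Q mP [dP P'] mQ [dQ Q']|m n P mn mP [dP P']].
- split=> [x|v]; first exact: differentiable_cst.
  rewrite (_ : (fun _ => _) = fun=> 0); first exact: pol_cst.
  by apply/funext => x; rewrite (@diff_cst _ V R c x).
- pose L : {linear V -> R} := HB.pack l (GRing.isLinear.Build R V R *%R l lS).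
  have Lc : continuous L by [].
  split=> [x|v]; first exact: (@linear_differentiable _ _ _ L).
  rewrite (_ : (fun _ => _) = fun=> l v); first exact: pol_cst.
  by apply/funext => x; rewrite (@diff_lin _ _ _ L).
- split=> [x|v]; first exact: differentiableD.
  rewrite (_ : (fun _ => _) = fun x => 'd P x v + 'd Q x v); first exact: pol_add.
  by apply/funext => x; rewrite (@diffD _ _ _ P Q).
- split=> [x|v]; first exact: differentiableM.
  rewrite (_ : (fun _ => _) = fun x => P x * 'd Q x v + Q x * 'd P x v).
    apply: pol_add; first exact: pol_mul.
    by rewrite addnC; apply: pol_mul.
  by apply/funext => x; rewrite (@diffM _ _ P Q).
- by split=> // v; apply: (pol_weak mn).
Qed.

Lemma pol_iter_diff m P vs : pol m P -> pol m (iter_diff P vs).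
Proof. by move=> mP; elim: vs => [//|v vs IH]; exact: (pol_diff IH).2. Qed.

Lemma iter_diff_sub m n P Q vs x : pol m P -> pol n Q ->
  iter_diff (fun x => P x - Q x) vs x = iter_diff P vs x - iter_diff Q vs x.
Proof.
move=> mP nQ; elim: vs x => [//|v vs IH] x /=.
rewrite (_ : iter_diff _ vs = iter_diff P vs - iter_diff Q vs); last first.
  by apply/funext => y; exact: IH.
rewrite diffB; first by [].
- exact: (pol_diff (pol_iter_diff vs mP)).1.
- exact: (pol_diff (pol_iter_diff vs nQ)).1.
Qed.

(** Homogeneous forms. Zero belongs to every degree, so that an absent homogeneous part is still a
    form of its degree. *)
Inductive hpol : nat -> (V -> R) -> Prop :=
| hpol_zero k : hpol k (fun=> 0)
| hpol_cst (c : R) : hpol 0 (fun=> c)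
| hpol_lin (l : V -> R) : scalar l -> hpol 1 l
| hpol_add k P Q : hpol k P -> hpol k Q -> hpol k (fun x => P x + Q x)
| hpol_mul k j P Q : hpol k P -> hpol j Q -> hpol (k + j) (fun x => P x * Q x).

Lemma hpol_sum k (I : Type) (r : seq I) (P : I -> V -> R) :
  (forall i, hpol k (P i)) -> hpol k (fun x => \sum_(i <- r) P i x).
Proof.
move=> Pm; elim: r => [|i r IH].
  by rewrite (_ : (fun _ => _) = fun=> 0); [exact: hpol_zero|apply/funext => x; rewrite big_nil].
rewrite (_ : (fun _ => _) = fun x => P i x + \sum_(j <- r) P j x).
  by apply: hpol_add.
by apply/funext => x; rewrite big_cons.
Qed.

Lemma hpol_homog k Q t h : hpol k Q -> Q (t *: h) = t ^+ k * Q h.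
Proof.
elim=> {k Q} [k|c|l lS|k P Q _ HP _ HQ|k j P Q _ HP _ HQ].
- by rewrite mulr0.
- by rewrite expr0 mul1r.
- have l0 : l 0 = 0 by have := lS (-1) 0 0; rewrite scaler0 addr0 mulN1r addNr.
  by rewrite expr1 -[t *: h]addr0 lS l0 addr0.
- by rewrite HP HQ mulrDr.
- by rewrite HP HQ exprD mulrACA.
Qed.

(** For a product, the first [k] arguments go to one factor and the remaining [j] to the other. The
    resulting form is in general not symmetric; [polar_form] symmetrises it. *)
Lemma hpol_multilinear k Q : hpol k Q ->
  exists2 B : ('I_k -> V) -> R, multilinear B & forall h, Q h = B (fun=> h).
Proof.
elim=> {k Q} [k|c|l lS|k P Q _ [B mB PB] _ [C mC QC]|k j P Q _ [B mB PB] _ [C mC QC]].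
- by exists (fun=> 0) => // v i a x y; rewrite mulr0 addr0.
- by exists (fun=> c) => // v [].
- exists (fun v : 'I_1 -> V => l (v ord0)) => // v i a x y.
  by rewrite !(ord1 i) !dfwithE/= lS.
- exists (fun v : 'I_k -> V => B v + C v) => [v i a x y|h]; last by rewrite PB QC.
  by rewrite (mB v i a x y) (mC v i a x y); ring.
- exists (fun v : 'I_(k + j) -> V => B (fun i => v (lshift j i)) * C (fun i => v (rshift k i))) => [v i a x y|h].
    have El (u : V) (i0 : 'I_k) : (fun i1 : 'I_k => @dfwith _ (fun=> V) v (lshift j i0) u (lshift j i1)) =
        @dfwith _ (fun=> V) (fun i1 => v (lshift j i1)) i0 u.
      by apply/funext => i1; rewrite !dfwithE (inj_eq (@lshift_inj _ _)).
    have El' (u : V) (i0 : 'I_k) : (fun i1 : 'I_j => @dfwith _ (fun=> V) v (lshift j i0) u (rshift k i1)) =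
        (fun i1 => v (rshift k i1)).
      by apply/funext => i1; rewrite !dfwithE eq_rlshift.
    have Er (u : V) (i0 : 'I_j) : (fun i1 : 'I_j => @dfwith _ (fun=> V) v (rshift k i0) u (rshift k i1)) =
        @dfwith _ (fun=> V) (fun i1 => v (rshift k i1)) i0 u.
      by apply/funext => i1; rewrite !dfwithE (inj_eq (@rshift_inj _ _)).
    have Er' (u : V) (i0 : 'I_j) : (fun i1 : 'I_k => @dfwith _ (fun=> V) v (rshift k i0) u (lshift j i1)) =
        (fun i1 => v (lshift j i1)).
      by apply/funext => i1; rewrite !dfwithE eq_lrshift.
    case: (split_ordP i) => i0 ->.
      by rewrite !El !El' (mB _ i0 a x y) mulrDl mulrA.
    by rewrite !Er !Er' (mC _ i0 a x y) mulrDr mulrCA.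
  by rewrite PB QC.
Qed.

(** A polynomial in an auxiliary variable collects all homogeneous parts at [a] at once, and
    products of functions become products in [{poly R}]. *)
Lemma pol_homogeneous_parts m P a : pol m P -> exists H : V -> {poly R},
  [/\ forall h, (size (H h) <= m.+1)%N, forall k, hpol k (fun h => (H h)`_k) &
      forall h t, P (a + t *: h) = (H h).[t]].
Proof.
(* The value 1 of the variable suffices: homogeneity of the coefficients supplies the powers of
   [t]. *)
move=> mP; suff [H [sH hH PH]] : exists H : V -> {poly R},
  [/\ forall h, (size (H h) <= m.+1)%N, forall k, hpol k (fun h => (H h)`_k) &
      forall h, P (a + h) = (H h).[1]].
  exists H; split=> // h t; rewrite PH !(@horner_coef_wide _ m.+1)//.
  by apply: eq_bigr => k _; rewrite expr1n mulr1 (hpol_homog _ _ (hH k)) mulrC.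
elim: mP => {m P} [m c|m l lS lc|m P Q mP [H [sH hH PH]] mQ [G [sG hG QG]]|
    m n P Q mP [H [sH hH PH]] mQ [G [sG hG QG]]|m n P mn mP [H [sH hH PH]]].
- exists (fun=> c%:P); split=> [h|k|h]; rewrite ?hornerC//.
    by rewrite (leq_trans (size_polyC_leq1 c)).
  under eq_fun => h do rewrite coefC.
  by case: k => [|k]; [exact: hpol_cst|exact: hpol_zero].
- exists (fun h => (l h)%:P * 'X + (l a)%:P); split=> [h|k|h].
  + by rewrite size_MXaddC; case: ifP => // _; rewrite ltnS (leq_trans (size_polyC_leq1 _)).
  + under eq_fun => h do rewrite coefD coefMX !coefC.
    case: k => [|[|k]] /=.
    * by under eq_fun => h do rewrite add0r; exact: hpol_cst.
    * by under eq_fun => h do rewrite addr0; exact: hpol_lin.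
    * by under eq_fun => h do rewrite addr0; exact: hpol_zero.
  + rewrite hornerD hornerM !hornerC hornerX mulr1 addrC.
    by have := lS 1 h a; rewrite scale1r mul1r.
- exists (fun h => H h + G h); split=> [h|k|h].
  + by rewrite (leq_trans (size_polyD _ _))// geq_max sH sG.
  + by under eq_fun => h do rewrite coefD; exact: hpol_add.
  + by rewrite hornerD PH QG.
- exists (fun h => H h * G h); split=> [h|k|h].
  + rewrite (leq_trans (size_polyMleq _ _))//.
    by have := sH h; have := sG h; lia.
  + under eq_fun => h do rewrite coefM.
    apply: hpol_sum => i; rewrite -[X in hpol X](subnKC (_ : (i <= k)%N)); last by rewrite -ltnS.
    exact: hpol_mul.
  + by rewrite hornerM PH QG.
- by exists H; split=> // h; rewrite (leq_trans (sH h)).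
Qed.

Lemma diff_line m P x h t (q : {poly R}) : pol m P -> (forall s, P (x + s *: h) = q.[s]) ->
  'd P (x + t *: h) h = q^`().[t].
Proof.
move=> mP Pq; rewrite -deriveE; last exact: (pol_diff mP).1.
rewrite derivE /derive1 /derive; set f := (fun _ => _); set g := (fun _ => _).
suff -> : f = g by []; apply/funext => s; rewrite /f /g /=.
by rewrite -Pq -Pq (_ : s *: h + (x + t *: h) = x + (s + t) *: h)// scalerDl; rewrite addrCA.
Qed.

(** Each point of the ball of radius [r] is the midpoint of a segment of length 2, in the direction
    of [v], inside the ball of radius [r + 1]; there [bernstein_center] applies. Each derivative
    thus consumes a unit of radius. *)
Lemma pol_bernstein m P (r B : R) : pol m P -> (0 < m)%N ->
  (forall x, `|x| < r + 1 -> `|P x| <= B) ->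
  forall x v, `|x| < r -> `|'d P x v| <= 2 * m%:R * B * `|v|.
Proof.
move=> mP m0 PB x v xr; have [->|v0] := eqVneq v 0.
  by rewrite linear0 !normr0 mulr0.
have nv0 : 0 < `|v| by rewrite normr_gt0.
pose w := `|v|^-1 *: v; have w1 : `|w| = 1.
  by rewrite /w normrZ normfV normr_id mulVf// gt_eqF.
have -> : v = `|v| *: w by rewrite /w scalerA mulfV ?scale1r// gt_eqF.
rewrite linearZ/= normrM normr_id normrZ w1 mulr1 normr_id mulrC ler_wpM2r//.
have [H [sH _ PH]] := pol_homogeneous_parts x mP.
have := @diff_line m P x w 0 _ mP (PH w); rewrite scale0r addr0 => ->.
apply: bernstein_center => // t t1.
rewrite -PH; apply: PB; rewrite (le_lt_trans (ler_normD _ _))// normrZ w1 mulr1 ltr_leD//.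
by rewrite ler_norml.
Qed.

Lemma pol_iter_bernstein m P (r B : R) vs : pol m P -> (0 < m)%N ->
  (forall x, `|x| < r + (size vs)%:R -> `|P x| <= B) ->
  forall x, `|x| < r -> `|iter_diff P vs x| <= (2 * m%:R) ^+ size vs * B * \prod_(v <- vs) `|v|.
Proof.
move=> mP m0; elim: vs r => [|v vs IH] r PB x xr.
  by rewrite /= big_nil expr0 mul1r mulr1; apply: PB; rewrite addr0.
have H := IH (r + 1); rewrite /= in PB H *.
apply: le_trans (pol_bernstein (pol_iter_diff vs mP) m0 (H _) v xr) _.
  by move=> y yr; apply: PB; rewrite -natr1 (addrC _ 1) addrA.
by rewrite big_cons exprS le_eqVlt; apply/orP; left; apply/eqP; ring.
Qed.

Lemma pol_mvt m P (r e : R) x y : pol m P -> `|x| < r -> `|y| < r ->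
  (forall z, `|z| < r -> `|'d P z (y - x)| <= e * `|y - x|) -> `|P y - P x| <= e * `|y - x|.
Proof.
move=> mP xr yr PB; have [H [sH _ PH]] := pol_homogeneous_parts x mP.
pose q := H (y - x).
have -> : P y = q.[1] by rewrite -PH scale1r subrKC.
have -> : P x = q.[0] by rewrite -PH scale0r addr0.
have L : forall t, 0 <= t <= 1 -> `|q^`().[t]| <= e * `|y - x|.
  move=> t /andP[t0 t1]; rewrite -(@diff_line m P x (y - x) t q mP (PH _)).
  apply: PB; rewrite (_ : x + _ = (1 - t) *: x + t *: y); last first.
    by rewrite scalerBr scalerBl scale1r addrA addrAC.
  rewrite (le_lt_trans (ler_normD _ _))// !normrZ !ger0_norm ?subr_ge0//.
  have [->|tn0] := eqVneq t 0; first by rewrite subr0 mul1r mul0r addr0.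
  have t0' : 0 < t by rewrite lt_def tn0.
  rewrite [ltRHS](_ : _ = (1 - t) * r + t * r); last by ring.
  by rewrite ler_ltD ?ltr_pM2l// ler_wpM2l ?subr_ge0// ltW.
have := @lipschitz_itv R 0 1 (e * `|y - x|) (horner q) (horner q^`()) (fun t _ => is_derive_poly q t) L 1 0.
by rewrite subr0 normr1 mulr1; apply; rewrite lexx ler01.
Qed.

End polynomial_functions.

(** * Rates of polynomial approximation imply regularity *)

Section inverse_theorems.
Context {R : realType} {V : normedModType R}.
Implicit Types (P F : V -> R) (x y v h : V).

Lemma cvg_of_bound (u b : nat -> R) l : (forall k, `|l - u k| <= b k) -> b @ \oo --> 0 -> u @ \oo --> l.
Proof.
move=> ub b0; apply/cvgrPdist_le => e e0.
have [N NB] := cvg0_ge b0 e0; exists N => // k /NB bk /=.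
by apply: le_trans (ub k) _; apply: le_trans (ler_norm _) (ltW bk).
Qed.

Lemma pol_bounded m P r : pol m P -> exists B : R, forall x, `|x| < r -> `|P x| <= B.
Proof.
elim=> {m P} [m c|m l lS lc|m P Q mP [B PB] mQ [C QC]|m n P Q mP [B PB] mQ [C QC]|//].
- by exists `|c|.
- pose L : {linear V -> R} := HB.pack l (GRing.isLinear.Build R V R *%R l lS).
  have Lc : continuous L by [].
  have [k k0 kL] := linear_lipschitz Lc; exists (k * r) => x xr.
  by apply: le_trans (kL x) _; rewrite ler_pM2l// ltW.
- exists (B + C) => x xr; apply: le_trans (ler_normD _ _) _.
  by apply: lerD; [exact: PB|exact: QC].
- exists (B * C) => x xr; rewrite normrM.
  by apply: ler_pM => //; [exact: PB|exact: QC].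
Qed.

Lemma diff_limit (f : nat -> V -> R) (d : nat -> nat) F (L : V -> V -> R) (r : R) (e : nat -> R) :
  (forall k, pol (d k) (f k)) ->
  (forall x, `|x| < r -> f k x @[k --> \oo] --> F x) ->
  (forall k, 0 <= e k) -> e @ \oo --> 0 ->
  (forall k x v, `|x| < r -> `|L x v - 'd (f k) x v| <= e k * `|v|) ->
  forall x, `|x| < r -> differentiable F x /\ ('d F x : V -> R) = L x.
Proof.
move=> fpol fF e0 ec fL x xr.
have fLx v : 'd (f k) x v @[k --> \oo] --> L x v.
  apply: (@cvg_of_bound _ (fun k => e k * `|v|)) => [k|]; first exact: fL.
  by rewrite -[X in _ --> X](mul0r `|v|); apply: cvgM => //; exact: cvg_cst.
have df k : differentiable (f k) x := (pol_diff (fpol k)).1 x.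
have LS : scalar (L x).
  move=> a u v; rewrite -(cvg_lim _ (fLx (a *: u + v)))//; apply/cvg_lim => //.
  under eq_cvg => k do rewrite linearP.
  by apply: cvgD => //; apply: cvgM => //; exact: cvg_cst.
have [K K0 KL] := linear_lipschitz (diff_continuous (df 0%N)).
apply: (@diff_criterion _ _ _ _ _ (e 0%N + K)) => // [v|eps eps0].
  rewrite -[L x v](subrK ('d (f 0%N) x v)) (le_trans (ler_normD _ _))// mulrDl lerD//.
  exact: fL.
have e30 : 0 < eps / 3 by rewrite divr_gt0.
have [k /(_ k (leqnn k)) ek] := cvg0_ge ec e30.
rewrite ger0_norm// in ek.
have /eqaddoP/(_ _ e30) H := diff_locally (df k).
near=> h.
have hr : `|x + h| < r.
  rewrite (le_lt_trans (ler_normD _ _))// -ltrBrDl.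
  by near: h; apply: nbhs0_lt; rewrite subr_gt0.
have E1 : `|f k (x + h) - f k x - 'd (f k) x h| <= eps / 3 * `|h|.
  have : `|(f k \o shift x - (cst (f k x) + 'd (f k) x)) h| <= eps / 3 * `|h| by near: h.
  by rewrite !fctE/= (addrC h x) opprD addrA.
(* The mean value inequality bounds the increment of [f l - f k] by [(e l + e k) |h|]; letting [l]
   grow replaces [f l] by [F]. *)
have E2 : `|F (x + h) - f k (x + h) - (F x - f k x)| <= e k * `|h|.
  have c1 : (`|f l (x + h) - f k (x + h) - (f l x - f k x)| - e l * `|h|) @[l --> \oo] -->
      `|F (x + h) - f k (x + h) - (F x - f k x)| - 0 * `|h|.
    apply: cvgB; last by apply: cvgM => //; exact: cvg_cst.
    apply: cvg_norm; apply: cvgB; apply: cvgB; try exact: cvg_cst; exact: fF.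
  rewrite mul0r subr0 in c1; apply: (cvgr_to_le c1); near=> l.
  rewrite lerBlDr -mulrDl.
  have -> : h = (x + h) - x by rewrite addrAC subrr add0r.
  have -> : x + (x + h - x) = x + h by rewrite [x + (_ - _)]addrC subrK.
  apply: (@pol_mvt _ _ (maxn (d l) (d k)) (fun z => f l z - f k z) r) => //.
    exact: pol_sub.
  move=> z zr; rewrite (@diffB _ _ _ (f l) (f k)); last 2 first.
  - exact: (pol_diff (fpol l)).1.
  - exact: (pol_diff (fpol k)).1.
  set w := (x + h - x); rewrite mulrDl.
  have -> : ('d (f l) z \- 'd (f k) z) w = (L z w - 'd (f k) z w) - (L z w - 'd (f l) z w).
    by rewrite /= opprB [RHS]addrC addrA subrK.
  by rewrite (le_trans (ler_normB _ _))// lerD// fL.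
have -> : F (x + h) - F x - L x h = (F (x + h) - f k (x + h) - (F x - f k x)) +
    (f k (x + h) - f k x - 'd (f k) x h) - (L x h - 'd (f k) x h) by ring.
rewrite (le_trans (ler_normB _ _))// (le_trans (lerD (ler_normD _ _) (fL k x h xr)))//.
apply: le_trans (lerD (lerD E2 E1) (lexx _)) _.
have h0 := normr_ge0 h; move: ek h0; move: (e k) (`|h|) => a b; nra.
Unshelve. all: by end_near. Qed.

Section holder.
(** Here [b] stands for [2 ^ (- alpha)], so at degree [c 2 ^ k] the error is of order
    [2 ^ (- k (n + alpha))]. That [b < 1] makes the derivatives of order [n] converge; that
    [2 b > 1] makes those of order [n + 1] grow geometrically. The margin in the radius pays for
    [n + 1] derivatives. *)
Variables (F : V -> R) (n c : nat) (b C r : R) (P : nat -> V -> R).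
Hypotheses (C0 : 0 <= C) (c0 : (0 < c)%N) (b1 : 2^-1 < b < 1).
Hypothesis Ppol : forall k, pol (c * 2 ^ k) (P k).
Hypothesis FP : forall k x, `|x| < r + n.+1%:R -> `|F x - P k x| <= C * (b / 2 ^+ n) ^+ k.

Let b0 : 0 < b. Proof. by case/andP: b1; lra. Qed.

(** Each derivative costs a Bernstein factor proportional to the degree [c 2 ^ (k + 1)], so order
    [j] worsens the rate in [k] by [2 ^ j]. *)
Let diff_bound j : exists2 A : R, 0 <= A & forall k vs x, size vs = j -> (j <= n.+1)%N -> `|x| < r ->
  `|iter_diff (P k.+1) vs x - iter_diff (P k) vs x| <= A * (b * 2 ^+ j / 2 ^+ n) ^+ k * \prod_(v <- vs) `|v|.
Proof.
exists ((4 * c%:R) ^+ j * (2 * C)); first by rewrite !mulr_ge0 ?exprn_ge0 ?mulr_ge0.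
move=> k vs x vsj jn xr.
rewrite -(iter_diff_sub _ _ (Ppol k.+1) (Ppol k)).
have mpol := pol_sub (Ppol k.+1) (Ppol k).
have ck : maxn (c * 2 ^ k.+1) (c * 2 ^ k) = (c * 2 ^ k.+1)%N.
  by apply/maxn_idPl; rewrite leq_mul2l leq_exp2l// leqnSn orbT.
rewrite ck in mpol.
pose q := b / 2 ^+ n.
have q0 : 0 <= q by rewrite divr_ge0 ?exprn_ge0// ltW.
have q1 : q <= 1.
  rewrite ler_pdivrMr ?exprn_gt0// mul1r; case/andP: b1 => _ /ltW b1'.
  by apply: le_trans b1' _; rewrite exprn_ege1// ler1n.
have DB y : `|y| < r + (size vs)%:R -> `|P k.+1 y - P k y| <= 2 * C * q ^+ k.
  move=> yr; have yr' : `|y| < r + n.+1%:R.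
    by apply: lt_le_trans yr _; rewrite lerD2l ler_nat vsj.
  have -> : P k.+1 y - P k y = (F y - P k y) - (F y - P k.+1 y) by ring.
  rewrite (le_trans (ler_normB _ _))//.
  apply: le_trans (lerD (FP k yr') (FP k.+1 yr')) _.
  rewrite -/q exprS; have qk : 0 <= q ^+ k by rewrite exprn_ge0.
  by rewrite -mulrDr -mulrA mulrCA ler_wpM2l// -[X in X + _]mul1r -mulrDl ler_wpM2r//; lra.
have cp : (0 < c * 2 ^ k.+1)%N by rewrite muln_gt0 c0 expn_gt0.
apply: le_trans (pol_iter_bernstein mpol cp DB xr) _.
rewrite ler_wpM2r ?prodr_ge0// vsj.
have -> : (b * 2 ^+ j / 2 ^+ n) = q * 2 ^+ j by rewrite /q; ring.
rewrite natrM natrX exprS (_ : 2 * (c%:R * (2 * 2 ^+ k)) = 4 * c%:R * 2 ^+ k); last by ring.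
rewrite !exprMn -!exprM (mulnC j) le_eqVlt; apply/orP; left; apply/eqP; ring.
Qed.

Let G vs x := limn (fun k => iter_diff (P k) vs x).

Let low_bound : exists2 A : R, 0 <= A & forall k vs x, (size vs <= n)%N -> `|x| < r ->
  `|iter_diff (P k.+1) vs x - iter_diff (P k) vs x| <= A * \prod_(v <- vs) `|v| * b ^+ k.
Proof.
have /choice[A HA] : forall j, exists A : R, 0 <= A /\ forall k vs x, size vs = j -> (j <= n.+1)%N -> `|x| < r ->
  `|iter_diff (P k.+1) vs x - iter_diff (P k) vs x| <= A * (b * 2 ^+ j / 2 ^+ n) ^+ k * \prod_(v <- vs) `|v|.
  by move=> j; have [A] := diff_bound j; exists A.
exists (\sum_(j < n.+1) A j); first by rewrite sumr_ge0// => j _; case: (HA j).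
move=> k vs x vn xr; have [A0 AB] := HA (size vs).
apply: le_trans (AB k vs x erefl (leqW vn) xr) _.
rewrite mulrAC ler_pM ?mulr_ge0 ?prodr_ge0 ?exprn_ge0 ?divr_ge0 ?mulr_ge0 ?exprn_ge0 ?(ltW b0)//.
  rewrite ler_wpM2r ?prodr_ge0// (bigD1 (Ordinal (vn : (size vs < n.+1)%N)))//=.
  by rewrite lerDl sumr_ge0// => j _; case: (HA j).
rewrite lerXn2r ?nnegrE ?divr_ge0 ?mulr_ge0 ?exprn_ge0 ?(ltW b0)//.
by rewrite -mulrA ler_piMr ?(ltW b0)// ler_pdivrMr ?exprn_gt0// mul1r ler_eXn2l// ltr1n.
Qed.

(** The limits [G] of the differentiated approximants are the candidate derivatives. Once
    [iter_diff F vs] is known to be [G vs] on the ball, [diff_limit] identifies its differential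
    with [G (v :: vs)], and the induction on the list proceeds. *)
Lemma holder_limit : exists2 A : R, 0 <= A &
  (forall vs, (size vs < n)%N -> forall x, `|x| < r -> differentiable (iter_diff F vs) x) /\
  forall vs, (size vs <= n)%N -> forall k x, `|x| < r ->
    `|iter_diff F vs x - iter_diff (P k) vs x| <= A * \prod_(v <- vs) `|v| * b ^+ k.
Proof.
have [A A0 AB] := low_bound.
have b01 : 0 <= b < 1 by case/andP: b1; lra.
have b1p : 0 < 1 - b by case/andP: b1; lra.
have bc : (fun k => b ^+ k) @ \oo --> (0 : R) by apply: cvg_expr; rewrite gtr0_norm//; case/andP: b1.
have GB vs x k : (size vs <= n)%N -> `|x| < r ->
    `|G vs x - iter_diff (P k) vs x| <= A / (1 - b) * \prod_(v <- vs) `|v| * b ^+ k.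
  move=> vn xr.
  have [l lc lB] := cvg_geo_bound b01 (fun k => AB k vs x vn xr).
  have -> : G vs x = l by apply/cvg_lim.
  by apply: le_trans (lB k) _; rewrite le_eqVlt; apply/orP; left; apply/eqP; ring.
have bPc (vs : seq V) : (fun k => A / (1 - b) * \prod_(v <- vs) `|v| * b ^+ k) @ \oo --> (0 : R).
  rewrite -[X in _ --> X](mulr0 (A / (1 - b) * \prod_(v <- vs) `|v|)).
  by apply: cvgM => //; exact: cvg_cst.
have step (vs : seq V) : (size vs < n)%N -> (forall x, `|x| < r -> iter_diff F vs x = G vs x) ->
    forall x, `|x| < r -> differentiable (iter_diff F vs) x /\
      ('d (iter_diff F vs) x : V -> R) = (fun v => G (v :: vs) x).
  move=> vn FGvs x xr.
  apply: (@diff_limit (fun k => iter_diff (P k) vs) (fun k => c * 2 ^ k)%N _ (fun x v => G (v :: vs) x) r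
    (fun k => A / (1 - b) * \prod_(v <- vs) `|v| * b ^+ k)) => //.
  - by move=> k; exact: pol_iter_diff.
  - move=> y yr; rewrite FGvs//; apply: (cvg_of_bound _ (bPc vs)) => k.
    by apply: GB => //; exact: ltnW.
  - by move=> k; rewrite !mulr_ge0 ?prodr_ge0 ?invr_ge0 ?exprn_ge0// ltW.
  - move=> k y v yr; have := GB (v :: vs) y k vn yr; rewrite big_cons /=.
    by move/le_trans; apply; rewrite le_eqVlt; apply/orP; left; apply/eqP; ring.
have FG vs : (size vs <= n)%N -> forall x, `|x| < r -> iter_diff F vs x = G vs x.
  elim: vs => [_ x xr|v vs IH vn x xr]; last first.
    by have [_ /(congr1 (fun g => g v))] := step vs vn (IH (ltnW vn)) x xr.
  apply/esym/cvg_lim => //=; apply: (@cvg_of_bound _ (fun k => C * b ^+ k)).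
    move=> k; apply: le_trans (FP k _) _.
      by apply: lt_le_trans xr _; rewrite lerDl.
    rewrite ler_wpM2l// lerXn2r ?nnegrE ?divr_ge0 ?exprn_ge0 ?(ltW b0)//.
    by rewrite ler_pdivrMr ?exprn_gt0// ler_peMr ?(ltW b0)// exprn_ege1// ler1n.
  by rewrite -[X in _ --> X](mulr0 C); apply: cvgM => //; exact: cvg_cst.
exists (A / (1 - b)); first by rewrite divr_ge0// ltW.
split=> [vs vn x xr|vs vn k x xr]; first by case: (step vs vn (FG vs (ltnW vn)) x xr).
by rewrite FG// GB.
Qed.

(** Telescoping from [P 0], the increments are of order [(2 b) ^ k]; as [2 b > 1], their geometric
    sum is of the order of its last term. *)
Lemma holder_next : exists2 A : R, 0 <= A & forall k vs x, size vs = n.+1 -> `|x| < r ->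
  `|iter_diff (P k) vs x| <= A * (2 * b) ^+ k * \prod_(v <- vs) `|v|.
Proof.
have [A A0 AB] := diff_bound n.+1.
have [B PB] := pol_bounded (r + n.+1%:R) (Ppol 0).
pose B0 := (2 * c%:R) ^+ n.+1 * `|B|.
have b2 : 0 < 2 * b - 1 by case/andP: b1; lra.
exists (B0 + A / (2 * b - 1)).
  by rewrite addr_ge0 ?divr_ge0 ?(ltW b2)// mulr_ge0// exprn_ge0.
move=> k vs x vsn xr; rewrite mulrDl mulrDl.
have Pi0 : 0 <= \prod_(v <- vs) `|v| by rewrite prodr_ge0.
have E0 : `|iter_diff (P 0) vs x| <= B0 * \prod_(v <- vs) `|v|.
  have P0 := Ppol 0; rewrite expn0 muln1 in P0.
  have H y : `|y| < r + (size vs)%:R -> `|P 0%N y| <= `|B|.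
    by rewrite vsn => yr; apply: le_trans (PB y yr) (ler_norm _).
  by have := pol_iter_bernstein P0 c0 H xr; rewrite vsn.
have b2k : (1 <= (2 * b) ^+ k) by rewrite exprn_ege1//; case/andP: b1; lra.
suff : `|iter_diff (P k) vs x - iter_diff (P 0) vs x| <=
    A * (((2 * b) ^+ k - 1) / (2 * b - 1)) * \prod_(v <- vs) `|v|.
  move=> H; rewrite -[iter_diff (P k) vs x](subrK (iter_diff (P 0) vs x)) addrC.
  apply: le_trans (ler_normD _ _) _; apply: lerD.
    apply: le_trans E0 _; rewrite ler_wpM2r// ler_peMr// mulr_ge0// exprn_ge0//.
  apply: le_trans H _; rewrite ler_wpM2r// -mulrA (mulrC _^-1) ler_wpM2l//.
  by rewrite ler_wpM2r ?invr_ge0 ?(ltW b2)//; lra.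
elim: k {b2k} => [|k IH]; first by rewrite !subrr normr0 mul0r mulr0 mul0r.
have -> : iter_diff (P k.+1) vs x - iter_diff (P 0) vs x =
  (iter_diff (P k.+1) vs x - iter_diff (P k) vs x) + (iter_diff (P k) vs x - iter_diff (P 0) vs x) by ring.
apply: le_trans (ler_normD _ _) _; apply: le_trans (lerD (AB k vs x vsn (leqnn _) xr) IH) _.
rewrite -mulrDl ler_wpM2r// -mulrDr ler_wpM2l//.
have -> : b * 2 ^+ n.+1 / 2 ^+ n = 2 * b by rewrite exprS; field; rewrite expf_neq0.
rewrite le_eqVlt; apply/orP; left; apply/eqP; rewrite exprS; field.
by rewrite gt_eqF.
Qed.

End holder.

Lemma dyadic_scale (d : R) : 0 < d < 1 -> exists k, 2^-1 ^+ k.+1 <= d < 2^-1 ^+ k.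
Proof.
move=> /andP[d0 d1].
have [N /(_ N (leqnn N)) HN] : exists N, forall n, (N <= n)%N -> `|(2^-1 : R) ^+ n| < d.
  by apply: cvg0_ge => //; apply: cvg_expr; rewrite ger0_norm; lra.
rewrite ger0_norm ?exprn_ge0 ?invr_ge0// in HN.
have ex : exists k, 2^-1 ^+ k.+1 <= d.
  by exists N; rewrite exprS (le_trans _ (ltW HN))// ler_piMl ?exprn_ge0//; lra.
case: (ex_minnP ex) => k kd kmin; exists k; rewrite kd/=.
case: k {kd} kmin => [|k] kmin; first by rewrite expr0.
by rewrite ltNge; apply/negP => /kmin; rewrite ltnn.
Qed.

(* On scale [|x - y| ~ 2 ^- k], compare [D^n F] with [D^n (P k)], whose
   variation is controlled by [D^(n+1) (P k)]. *)
Lemma holder_of_pol (F : V -> R) (n c : nat) (alpha : R) : 0 < alpha -> alpha < 1 -> (0 < c)%N ->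
  (forall r, exists C (P : nat -> V -> R), (forall k, pol (c * 2 ^ k) (P k)) /\
    forall k x, `|x| < r -> `|F x - P k x| <= C * (2^-1 `^ alpha / 2 ^+ n) ^+ k) ->
  is_holder n alpha F.
Proof.
move=> a0 a1 c0 HF; set b := 2^-1 `^ alpha.
have half (u : R) : 0 < u -> 2^-1 `^ u < 1 :> R.
  move=> u0; rewrite [ltRHS](_ : 1 = 1 `^ u); last by rewrite powR1.
  by rewrite gt0_ltr_powR// ?nnegrE//; lra.
have b0 : 0 < b by rewrite powR_gt0.
have b1 : 2^-1 < b < 1.
  have E : (2^-1 : R) = b * 2^-1 `^ (1 - alpha).
    rewrite /b -powRD ?subrKC ?powRr1 ?invr_ge0//.
    by apply/implyP => _; rewrite invr_eq0 pnatr_eq0.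
  by rewrite half// andbT E gtr_pMr// half// subr_gt0.
have main r : exists A : R, 0 <= A /\
  [/\ forall vs, (size vs < n)%N -> forall x, `|x| < r -> differentiable (iter_diff F vs) x &
      forall vs x y, size vs = n -> `|x| < r -> `|y| < r -> `|x - y| < 1 ->
        `|iter_diff F vs x - iter_diff F vs y| <= A * `|x - y| `^ alpha * \prod_(v <- vs) `|v| ].
  have [C [P [Pp FP]]] := HF (r + n.+1%:R).
  have FP' k x : `|x| < r + n.+1%:R -> `|F x - P k x| <= `|C| * (b / 2 ^+ n) ^+ k.
    move=> xr; apply: le_trans (FP k x xr) _.
    by rewrite ler_wpM2r ?exprn_ge0 ?divr_ge0 ?exprn_ge0 ?(ltW b0)// ler_norm.
  have [A A0 [dF AF]] := holder_limit (normr_ge0 C) c0 b1 Pp FP'.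
  have [B B0 BP] := holder_next (normr_ge0 C) c0 b1 Pp FP'.
  exists ((2 * A + B) / b); split; first by rewrite divr_ge0 ?(ltW b0)// addr_ge0// mulr_ge0.
  split=> // vs x y vsn xr yr xy1.
  have Pi0 : 0 <= \prod_(v <- vs) `|v| by rewrite prodr_ge0.
  have [->|xy] := eqVneq x y.
    by rewrite !subrr !normr0 !mulr_ge0 ?invr_ge0 ?(ltW b0) ?addr_ge0 ?mulr_ge0// powR_ge0.
  have xy0 : 0 < `|x - y| by rewrite normr_gt0 subr_eq0.
  have [|k /andP[k1 k2]] := @dyadic_scale `|x - y|; first by rewrite xy0 xy1.
  have vn : (size vs <= n)%N by rewrite vsn.
  have E1 := AF vs vn k x xr; have E2 := AF vs vn k y yr.
  have E3 : `|iter_diff (P k) vs x - iter_diff (P k) vs y| <= B * (2 * b) ^+ k * (\prod_(v <- vs) `|v|) * `|x - y|.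
    apply: (pol_mvt (pol_iter_diff vs (Pp k)) yr xr) => z zr.
    have := BP k (x - y :: vs) z; rewrite /= vsn big_cons => /(_ erefl zr)/le_trans; apply.
    by rewrite mulrCA [leLHS]mulrC.
  (* Since [2 ^ (- (k + 1)) <= |x - y|], it is the power [k + 1] of [b] that is dominated; the
     missing factor explains the division by [b] in the constant. *)
  have bk : b ^+ k.+1 <= `|x - y| `^ alpha.
    rewrite /b -powR_mulrn ?powR_ge0// -powRrM mulrC powRrM powR_mulrn ?invr_ge0//.
    by rewrite ge0_ler_powR ?nnegrE ?exprn_ge0 ?(ltW a0)//.
  have -> : iter_diff F vs x - iter_diff F vs y = (iter_diff F vs x - iter_diff (P k) vs x) +
    (iter_diff (P k) vs x - iter_diff (P k) vs y) - (iter_diff F vs y - iter_diff (P k) vs y) by ring.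
  rewrite (le_trans (ler_normB _ _))// (le_trans (lerD (ler_normD _ _) (lexx _)))//.
  apply: le_trans (lerD (lerD E1 E3) E2) _.
  (* The inequality [2 ^ k |x - y| < 1] cancels the growth of the derivative of order [n + 1]. *)
  have E4 : B * (2 * b) ^+ k * (\prod_(v <- vs) `|v|) * `|x - y| <= B * (\prod_(v <- vs) `|v|) * b ^+ k.
    rewrite exprMn (_ : _ * _ * _ * _ = B * (\prod_(v <- vs) `|v|) * b ^+ k * (2 ^+ k * `|x - y|)); last by ring.
    rewrite ler_piMr ?mulr_ge0 ?exprn_ge0 ?(ltW b0)//.
    by move: (ltW k2); rewrite exprVn -[leRHS]div1r ler_pdivlMr ?exprn_gt0// mulrC.
  apply: le_trans (lerD (lerD (lexx _) E4) (lexx _)) _.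
  rewrite (_ : _ + _ + _ = (2 * A + B) / b * b ^+ k.+1 * \prod_(v <- vs) `|v|); last first.
    by rewrite exprS; field; rewrite gt_eqF.
  by rewrite ler_wpM2r// ler_wpM2l// divr_ge0 ?(ltW b0)// addr_ge0// mulr_ge0.
have holder (a : V) : exists2 W, nbhs a W & exists C : R,
    forall x y, W x -> W y -> forall vs, size vs = n ->
      `|iter_diff F vs x - iter_diff F vs y| <= C * `|x - y| `^ alpha * \prod_(v <- vs) `|v|.
  have [A [A0 [_ HA]]] := main (`|a| + 1).
  (* Radius one half keeps any two points of the neighbourhood at distance below 1, as [main]
     requires. *)
  exists (ball a 2^-1); first by apply: nbhsx_ballx; rewrite invr_gt0.
  have aW x : ball a 2^-1 x -> `|a - x| < 2^-1 /\ `|x| < `|a| + 1.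
    rewrite -ball_normE/= => ax; split=> //.
    have -> : x = a - (a - x) by rewrite opprB addrC subrK.
    by rewrite (le_lt_trans (ler_normB _ _))// ltrD2l; lra.
  exists A => x y /aW[ax xr] /aW[ay yr] vs vsn; apply: HA => //.
  have -> : x - y = (a - y) - (a - x) by rewrite opprB [RHS]addrC addrA subrK.
  by rewrite (le_lt_trans (ler_normB _ _))//; lra.
have diffF vs : (size vs < n)%N -> forall x, differentiable (iter_diff F vs) x.
  by move=> vn x; have [A [_ [dF _]]] := main (`|x| + 1); apply: dF => //; rewrite ltrDl.
(* Below order [n] continuity follows from differentiability; at order [n] it is read off the Holder
   bound. *)
split=> //; split=> // vs; rewrite leq_eqVlt => /orP[/eqP vsn x|vn x]; last first.
  exact/differentiable_continuous/diffF.
have [W Wx [A HA]] := holder x.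
apply/cvgrPdist_le => e e0.
pose K := `|A| * \prod_(v <- vs) `|v| + 1.
have K0 : 0 < K by rewrite ltr_wpDl// mulr_ge0// prodr_ge0.
have eK : 0 < (e / K) `^ alpha^-1 by rewrite powR_gt0// divr_gt0.
near=> y.
have Wy : W y by near: y.
have xy : `|x - y| < (e / K) `^ alpha^-1 by near: y; apply: cvgr_dist_lt.
apply: le_trans (HA x y (nbhs_singleton Wx) Wy vs vsn) _.
have xya : `|x - y| `^ alpha <= e / K.
  rewrite -[e / K]powRr1 ?divr_ge0 ?(ltW e0) ?(ltW K0)// -(mulVf (lt0r_neq0 a0)) powRrM.
  by rewrite ge0_ler_powR ?nnegrE ?(ltW a0)// ?powR_ge0// ltW.
have Pi0 : 0 <= \prod_(v <- vs) `|v| by rewrite prodr_ge0.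
apply: (@le_trans _ _ (`|A| * (e / K) * \prod_(v <- vs) `|v|)).
  rewrite ler_wpM2r// (le_trans (ler_wpM2r (powR_ge0 _ _) (ler_norm A)))//.
  by rewrite ler_wpM2l.
rewrite (_ : `|A| * (e / K) * _ = e * (`|A| * \prod_(v <- vs) `|v| / K)); last by ring.
by rewrite ler_piMr ?(ltW e0)// ler_pdivrMr// mul1r /K lerDl.
Unshelve. all: by end_near. Qed.

(** From [k] to [k + 1] the quotient [k ^ k / k!] is multiplied by [(1 + 1 / k) ^ k <= e]. It
    measures the loss in polarization. *)
Lemma expn_le_exp_fact k : k%:R ^+ k <= expR 1 ^+ k * k`!%:R :> R.
Proof.
elim: k => [|[|k] IH]; first by rewrite !expr0 mul1r.
  by rewrite !expr1 mulr1 (le_trans _ (expR_ge1Dx 1))// lerDl.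
have k0 : (0 : R) < k.+1%:R by rewrite ltr0n.
have E1 : (k.+2%:R / k.+1%:R) ^+ k.+1 <= expR 1 :> R.
  rewrite (_ : k.+2%:R / k.+1%:R = 1 + k.+1%:R^-1); last first.
    by rewrite -[k.+2%:R]natr1 mulrDl mulfV ?gt_eqF// mul1r.
  apply: (@le_trans _ _ (expR (k.+1%:R^-1) ^+ k.+1)).
    by rewrite lerXn2r ?nnegrE ?expR_ge0 ?addr_ge0 ?invr_ge0 ?(ltW k0)// expR_ge1Dx.
  by rewrite -expRM_natl mulfV// gt_eqF.
rewrite [k.+2%:R ^+ _]exprS [_ ^+ k.+1](_ : _ = (k.+2%:R / k.+1%:R) ^+ k.+1 * k.+1%:R ^+ k.+1); last first.
  by rewrite -exprMn divfK// gt_eqF.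
apply: (@le_trans _ _ (k.+2%:R * (expR 1 * (expR 1 ^+ k.+1 * (k.+1)`!%:R)))).
  by rewrite ler_wpM2l// ler_pM ?exprn_ge0 ?divr_ge0.
by rewrite (factS k.+1) natrM [expR 1 ^+ k.+2]exprS le_eqVlt; apply/orP; left; apply/eqP; ring.
Qed.

Lemma multilinear_homog k (A : ('I_k -> V) -> R) (c : 'I_k -> R) (w : 'I_k -> V) :
  multilinear A -> A (fun i => c i *: w i) = (\prod_i c i) * A w.
Proof.
move=> mA; have := @multilinear_expand _ _ k A unit (fun i _ => c i) (fun i _ => w i) mA.
rewrite (big_pred1 [ffun=> tt]) => [|f]; last first.
  by apply/esym/eqP/ffunP => i; rewrite ffunE; case: (f i).
by move=> <-; congr A; apply/funext => i; rewrite (big_pred1 tt)// => -[].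
Qed.

(** The symmetric form is expressed through values of [Q] alone, so that it survives pointwise
    limits of the forms [Q]. *)
Lemma polar_form k (Q : V -> R) : hpol k Q ->
  let S := fun v : 'I_k -> V => k`!%:R^-1 * \sum_(T : {set 'I_k}) (-1) ^+ #|~: T| * Q (\sum_(j in T) v j) in
  multilinear S /\ forall h, S (fun=> h) = Q h.
Proof.
move=> Qh S; have [B mB QB] := hpol_multilinear Qh.
have SB (v : 'I_k -> V) : S v = k`!%:R^-1 * \sum_(s : 'S_k) B (fun i => v (s i)).
  rewrite -(polarization v mB) /S; congr (_ * _); apply: eq_bigr => T _.
  by rewrite QB.
split=> [v i a x y|h]; last first.
  rewrite SB sumr_const; transitivity (k`!%:R^-1 * (B (fun=> h) *+ k`!)).
    congr (_ * (_ *+ _)); exact: card_Sn.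
  by rewrite -QB mulrnAr -mulrnAl -[_^-1 *+ _]mulr_natl mulfV ?mul1r// pnatr_eq0 -lt0n fact_gt0.
rewrite !SB [X in _ = X + _]mulrCA -mulrDr; congr (_ * _).
rewrite mulr_sumr -big_split/=; apply: eq_bigr => s _.
have E u : (fun j => @dfwith _ (fun=> V) v i u (s j)) = @dfwith _ (fun=> V) (fun j => v (s j)) (s^-1 i)%g u.
  by apply/funext => j; rewrite !dfwithE (canF_eq (permK s)).
by rewrite !E (mB _ _ a x y).
Qed.

(* The degree-[k] homogeneous parts of the [P N] at [a] converge as [N] grows,
   and polarizing the limits gives the multilinear forms of the expansion. *)
Lemma analytic_of_pol (F : V -> R) :
  (forall r : R, exists (c : nat) (C : R) (P : nat -> V -> R), (0 < c)%N /\
    (forall k, pol (c * k) (P k)) /\ forall k x, `|x| < r -> `|F x - P k x| <= C * 2 ^- k) ->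
  is_analytic F.
Proof.
move=> HF a; have [c [C0 [P [c0 [Pp FP]]]]] := HF (`|a| + 2).
have [B0 PB] := pol_bounded (`|a| + 2) (Pp 0%N).
pose C : R := `|B0| + `|C0|.
have Cge0 : 0 <= C by rewrite addr_ge0.
have /choice[H HH] : forall N, exists H : V -> {poly R},
  [/\ forall h, (size (H h) <= (c * N).+1)%N, forall k, hpol k (fun h => (H h)`_k) &
      forall h t, P N (a + t *: h) = (H h).[t]].
  by move=> N; exact: pol_homogeneous_parts.
pose s : R := (18 * c%:R)^-1.
have c0' : (0 : R) < c%:R by rewrite ltr0n.
have s0 : 0 < s by rewrite invr_gt0 mulr_gt0.
(* On lines through [a] the one-variable [series_of_papprox] applies, with a constant uniform over
   the directions [|h| <= 1]. *)
have [K [K0 line]] : exists K : R, 0 <= K /\ forall h, `|h| <= 1 -> exists q : nat -> R,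
  [/\ forall k, (H N h)`_k @[N --> \oo] --> q k, forall k, `|q k| <= K * s ^- k &
      forall t, `|t| < s -> series (fun k => q k * t ^+ k) @ \oo --> F (a + t *: h)].
  exists (300 * c%:R * C); split.
    by apply: mulr_ge0 Cge0; apply: mulr_ge0 (ltW c0'); exact: ler0n.
  move=> h h1; have ah t : -1 <= t <= 1 -> `|a + t *: h| < `|a| + 2.
    rewrite -ler_norml => t1; rewrite (le_lt_trans (ler_normD _ _))// ltrD2l normrZ.
    by rewrite (@le_lt_trans _ _ 1) ?ltr1n// mulr_ile1.
  apply: (@series_of_papprox R c C (fun t => F (a + t *: h)) (fun N => H N h)) => //.
  - move=> t /ah t1; have := FP 0%N _ t1; rewrite expr0 invr1 mulr1 => FP0.
    rewrite -[F _](subrK (P 0%N (a + t *: h))) addrC (le_trans (ler_normD _ _))// lerD//.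
      by rewrite (le_trans (PB _ t1))// ler_norm.
    by rewrite (le_trans FP0)// ler_norm.
  - by move=> N; case: (HH N) => + _ _; exact.
  - move=> N t /ah t1; have [_ _ <-] := HH N.
    rewrite (le_trans (FP N _ t1))// ler_wpM2r ?invr_ge0 ?exprn_ge0//.
    by rewrite (le_trans (ler_norm _))// lerDr.
have Hk N k : hpol k (fun h => (H N h)`_k) by case: (HH N).
have unit_dir h : exists t w, [/\ h = t *: w, `|w| <= 1 & t = `|h| ].
  have [->|h0] := eqVneq h 0; first by exists 0, 0; rewrite scaler0 normr0 ler01.
  exists `|h|, (`|h|^-1 *: h); rewrite scalerA mulfV ?normr_eq0// scale1r; split=> //.
  by rewrite normrZ normfV normr_id mulVf ?normr_eq0.
have /choice[Q HQ] : forall h, exists q : nat -> R,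
  [/\ forall k, (H N h)`_k @[N --> \oo] --> q k, forall k, `|q k| <= K * s ^- k * `|h| ^+ k &
      `|h| < s -> series q @ \oo --> F (a + h)].
  move=> h; have [t [w [hE w1 tE]]] := unit_dir h; have [q [q1 q2 q3]] := line w w1.
  exists (fun k => q k * t ^+ k); split=> [k|k|hs].
  - rewrite hE; under eq_cvg => N do rewrite (hpol_homog t w (Hk N k)) mulrC.
    by apply: cvgM => //; exact: cvg_cst.
  - by rewrite normrM tE (ger0_norm (exprn_ge0 _ (normr_ge0 h))) ler_wpM2r ?exprn_ge0.
  - by rewrite hE; apply: q3; rewrite tE normr_id.
pose S N k (v : 'I_k -> V) := k`!%:R^-1 * \sum_(T : {set 'I_k}) (-1) ^+ #|~: T| * (H N (\sum_(j in T) v j))`_k.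
pose A k (v : 'I_k -> V) := k`!%:R^-1 * \sum_(T : {set 'I_k}) (-1) ^+ #|~: T| * Q (\sum_(j in T) v j) k.
have SA k (v : 'I_k -> V) : S N k v @[N --> \oo] --> A k v.
  apply: cvgM; first exact: cvg_cst.
  apply: cvg_big => [|T _]; first exact: add_continuous.
  apply: cvgM; first exact: cvg_cst.
  by case: (HQ (\sum_(j in T) v j)).
have mS N k : multilinear (S N k) /\ forall h, S N k (fun=> h) = (H N h)`_k.
  exact: (polar_form (Hk N k)).
have mA k : multilinear (A k).
  move=> v i b x y; rewrite -(cvg_lim _ (SA k _))//; apply/cvg_lim => //.
  under eq_cvg => N do rewrite ((mS N k).1 v i b x y).
  by apply: cvgD; [apply: cvgM; [exact: cvg_cst|exact: SA]|exact: SA].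
have Adiag k h : A k (fun=> h) = Q h k.
  rewrite -(cvg_lim _ (SA k _))//; apply/cvg_lim => //.
  under eq_cvg => N do rewrite (mS N k).2.
  by case: (HQ h) => + _ _; apply.
(* Polarization sums over [2 ^ k] subsets and costs [k ^ k / k! <= e ^ k], which shrinks the radius
   by the factor [2 e]. *)
pose r := s / (2 * expR 1).
have e1 : 0 < expR 1 :> R by exact: expR_gt0.
have r0 : 0 < r by rewrite divr_gt0// mulr_gt0.
have rs : r <= s.
  rewrite ler_pdivrMr ?mulr_gt0// ler_peMr ?(ltW s0)//.
  have : 1 <= expR 1 :> R by rewrite (le_trans _ (expR_ge1Dx 1))// lerDl.
  by lra.
exists A, K, r; split=> // [k v|h hr]; last first.
  under [X in series X]eq_fun => k do rewrite Adiag.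
  by case: (HQ h) => _ _; apply; apply: lt_le_trans rs.
have bound1 (w : 'I_k -> V) : (forall i, `|w i| <= 1) -> `|A k w| <= K * r ^- k.
  move=> w1; rewrite /A normrM ger0_norm ?invr_ge0// ler_pdivrMl ?ltr0n ?fact_gt0//.
  apply: (@le_trans _ _ (\sum_(T : {set 'I_k}) K * s ^- k * k%:R ^+ k)).
    apply: (le_trans (ler_norm_sum _ _ _)); apply: ler_sum => T _.
    rewrite normrM normrX normrN1 expr1n mul1r.
    case: (HQ (\sum_(j in T) w j)) => _ /(_ k)/le_trans + _; apply.
    rewrite ler_wpM2l ?mulr_ge0 ?invr_ge0 ?exprn_ge0 ?(ltW s0)//.
    rewrite lerXn2r ?nnegrE// (le_trans (ler_norm_sum _ _ _))//.
    apply: (@le_trans _ _ (\sum_(j in T) 1)); first by apply: ler_sum.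
    by rewrite sumr_const ler_nat -[leqRHS]card_ord max_card.
  have -> : \sum_(T : {set 'I_k}) K * s ^- k * k%:R ^+ k = 2 ^+ k * (K * s ^- k * k%:R ^+ k).
    rewrite sumr_const -(natrX R 2 k) mulr_natl; congr (_ *+ _).
    by rewrite -cardsT -powersetT card_powerset cardsT card_ord.
  apply: (@le_trans _ _ (2 ^+ k * (K * s ^- k * (expR 1 ^+ k * k`!%:R)))).
    by rewrite ler_wpM2l ?exprn_ge0// ler_wpM2l ?mulr_ge0 ?invr_ge0 ?exprn_ge0 ?(ltW s0)// expn_le_exp_fact.
  rewrite /r expr_div_n exprMn le_eqVlt; apply/orP; left; apply/eqP.
  by field; rewrite !expf_neq0// gt_eqF.
(* A zero argument cannot be normalised; multilinearity makes the value 0 in that case. *)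
have [i0 v0|v0] := pickP (fun i => v i == 0).
  rewrite (bigD1 i0)//= (eqP v0) normr0 mul0r mulr0.
  have -> : v = fun i => (i != i0)%:R *: v i.
    by apply/funext => i; case: eqVneq => [->|_]; rewrite ?(eqP v0) ?scaler0// scale1r.
  by rewrite (multilinear_homog _ _ (mA k)) (bigD1 i0)//= eqxx mul0r mul0r normr0.
pose w i := `|v i|^-1 *: v i.
have -> : v = fun i => `|v i| *: w i.
  by apply/funext => i; rewrite /w scalerA mulfV ?scale1r// normr_eq0 v0.
rewrite (multilinear_homog _ _ (mA k)) normrM.
have -> : `|\prod_i `|v i| | = \prod_i `|v i| by rewrite ger0_norm// prodr_ge0.
have -> : \prod_i `| (`|v i| *: w i) | = \prod_i `|v i|.
  apply: eq_bigr => i _.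
  by rewrite normrZ normr_id /w normrZ normfV normr_id mulVf ?mulr1// normr_eq0 v0.
rewrite mulrC; apply: ler_wpM2r; first by rewrite prodr_ge0.
apply: bound1 => i.
by rewrite /w normrZ normfV normr_id mulVf// normr_eq0 v0.
Qed.

End inverse_theorems.

(** * Diagonalization by rotations *)

Section polynomial_matrices.
Context {R : realType} {V : normedModType R}.

Definition mpol m p q (A : V -> 'M[R]_(p, q)) := forall i j, pol m (fun x => A x i j).

Lemma mpol_cst m p q (A : 'M[R]_(p, q)) : mpol m (fun=> A).
Proof. by move=> i j; exact: pol_cst. Qed.

Lemma mpol_mul m n p q r (A : V -> 'M[R]_(p, q)) (B : V -> 'M[R]_(q, r)) :
  mpol m A -> mpol n B -> mpol (m + n) (fun x => A x *m B x).
Proof.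
move=> mA nB i j; under eq_fun => x do rewrite mxE.
by apply: pol_sum => k _; apply: pol_mul.
Qed.

Lemma mpol_sum m p q (I : finType) (D : {pred I}) (A : I -> V -> 'M[R]_(p, q)) :
  (forall i, mpol m (A i)) -> mpol m (fun x => \sum_(i in D) A i x).
Proof.
move=> mA i j; under eq_fun => x do rewrite summxE.
by apply: pol_sum => k _; exact: mA.
Qed.

Lemma mpol_tr m p q (A : V -> 'M[R]_(p, q)) : mpol m A -> mpol m (fun x => (A x)^T).
Proof. by move=> mA i j; under eq_fun => x do rewrite mxE; exact: mA. Qed.

Lemma pol_mxtrace m p (A : V -> 'M[R]_p) : mpol m A -> pol m (fun x => \tr (A x)).
Proof. by move=> mA; apply: pol_sum => k _; exact: mA. Qed.

Lemma pol_det m p (A : V -> 'M[R]_p) : mpol m A -> pol (p * m) (fun x => \det (A x)).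
Proof.
move=> mA; apply: pol_sum => s _; apply: pol_scale.
have := @pol_prod R V 'I_p (index_enum 'I_p) m (fun i x => A x i (s i)) (fun i => mA i (s i)).
by rewrite (_ : size (index_enum 'I_p) = p)//; rewrite -[RHS]card_ord cardT enumT.
Qed.

Lemma mpol_horner m n (A : V -> 'M[R]_n.+1) (u : {poly R}) : mpol 1 A -> (size u <= m.+1)%N ->
  mpol m (fun x => horner_mx (A x) u).
Proof.
move=> mA; elim/poly_ind: u m => [|u c IH] m.
  by move=> _; under eq_fun => x do rewrite rmorph0; exact: mpol_cst.
rewrite size_MXaddC; case: (eqVneq u 0) => [->|u0] /=.
  move=> _; rewrite mul0r add0r; under eq_fun => x do rewrite horner_mx_C; exact: mpol_cst.
case: m => [|m]; first by rewrite ltnS leqn0 size_poly_eq0 (negbTE u0).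
rewrite ltnS => um; under eq_fun => x do rewrite rmorphD rmorphM/= horner_mx_X horner_mx_C.
move=> i j; under eq_fun => x do rewrite mxE.
apply: pol_add; last exact: pol_cst.
by rewrite -addn1; apply: (mpol_mul (IH m um) mA).
Qed.

End polynomial_matrices.

(** * Spectral decomposition by orthogonal matrices, then by rotations *)

Section spectral.
Context {R : realType} (d : nat).
Implicit Types (g x y : 'M[R]_d).

Lemma orthogonal_entry g i j : g *m g^T = 1%:M -> `|g i j| <= 1.
Proof.
move=> /(congr1 (fun A : 'M[R]_d => A i i)); rewrite !mxE eqxx => gi.
have : g i j ^+ 2 <= 1.
  rewrite -[leRHS]gi (bigD1 j)//= mxE -expr2 lerDl sumr_ge0// => k _.
  by rewrite mxE -expr2 sqr_ge0.
by rewrite -[leLHS]real_normK ?num_real// => H; rewrite -(@expr_le1 R 2 _ isT (normr_ge0 _)).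
Qed.

Lemma vec_mx_pol : mpol 1 (fun v : 'rV[R]_(d * d) => vec_mx v : 'M[R]_d).
Proof.
move=> i j; apply: pol_lin; first by move=> a u v; rewrite linearP !mxE.
by under eq_fun => v do rewrite mxE; exact: coord_continuous.
Qed.

Lemma orthogonal_compact : compact [set v : 'rV[R]_(d * d) | vec_mx v *m (vec_mx v)^T = 1%:M :> 'M[R]_d].
Proof.
(* The orthogonal group is the zero set of a single polynomial, a sum of squares, hence closed. *)
pose h (v : 'rV[R]_(d * d)) : R := \sum_i \sum_j ((vec_mx v *m (vec_mx v)^T - 1%:M : 'M[R]_d) i j) ^+ 2.
have hpol : pol 4 h.
  rewrite /h; apply: pol_sum => i _; apply: pol_sum => j _.
  have P : pol 2 (fun v : 'rV[R]_(d * d) => (vec_mx v *m (vec_mx v)^T - 1%:M : 'M[R]_d) i j).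
    under eq_fun => v do rewrite mxE; apply: pol_add; last exact: pol_cst.
    exact: (mpol_mul vec_mx_pol (mpol_tr vec_mx_pol)).
  exact: (pol_mul P P).
have AE : [set v : 'rV[R]_(d * d) | vec_mx v *m (vec_mx v)^T = 1%:M :> 'M[R]_d] = h @^-1` [set 0].
  apply/seteqP; split=> v /=.
    by move=> v1; rewrite /h v1 subrr big1// => i _; rewrite big1// => j _; rewrite mxE expr0n.
  move=> h0; apply/eqP; rewrite -subr_eq0; apply/eqP/matrixP => i j; rewrite [RHS]mxE.
  have h1 := @psumr_eq0P R _ xpredT _ (fun i0 _ => sumr_ge0 _ (fun j0 _ => sqr_ge0 _)) h0 i isT.
  have /eqP := @psumr_eq0P R _ xpredT _ (fun j0 _ => sqr_ge0 _) h1 j isT.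
  by rewrite sqrf_eq0 => /eqP.
apply: bounded_closed_compact.
  exists 1; split=> // M M1 v /= v1; apply: (le_trans _ (ltW M1)).
  rewrite /Num.norm/= mx_normrE.
  apply: bigmax_le => // -[i k] _ /=.
  rewrite (ord1 i); case/mxvec_indexP: k => a b.
  by have := orthogonal_entry a b v1; rewrite mxE.
rewrite AE; apply: closed_comp => [v _|]; last exact: closed_eq.
exact/differentiable_continuous/(pol_diff hpol).1.
Qed.

Lemma reflection_quad (i j : 'I_d) (t : R) (A : 'M[R]_d) :
  let u : 'rV[R]_d := delta_mx 0 i + t *: delta_mx 0 j in
  (u *m A *m u^T) 0 0 = A i i + t * (A i j + A j i) + t ^+ 2 * A j j.
Proof.
move=> u; rewrite /u linearD linearZ/= !mulmxDl !mulmxDr -!scalemxAl -!scalemxAr !trmx_delta.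
have E a b : (delta_mx 0 a *m A *m delta_mx b 0 : 'M[R]_1) 0 0 = A a b.
  by rewrite -rowE -colE !mxE.
have D (B C : 'M[R]_1) : (B + C) 0 0 = B 0 0 + C 0 0 by rewrite mxE.
have Z c (B : 'M[R]_1) : (c *: B) 0 0 = c * B 0 0 by rewrite mxE.
by rewrite !(D, Z) !E; ring.
Qed.

(** The left side is [Y t + O(t ^ 2)], so both signs of [t] near 0 force [Y = 0]. At [t = Y / K] it
    equals [Y ^ 2 / K] times a factor at least [1 - 1 / 4 - 1 / 2]. *)
Lemma critical_offdiag (Y b : R) : (forall t : R, t * (Y * (1 - t ^+ 2) + t * b) <= 0) -> Y = 0.
Proof.
move=> H; apply/eqP; apply/negPn/negP => Y0.
pose K := 2 * (`|Y| + `|b| + 1).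
have K0 : 0 < K by rewrite mulr_gt0// ltr_wpDl// addr_ge0.
have := H (Y / K); apply/negP; rewrite -ltNge.
have -> : Y / K * (Y * (1 - (Y / K) ^+ 2) + Y / K * b) = Y ^+ 2 / K * (1 - (Y / K) ^+ 2 + b / K).
  by field; rewrite gt_eqF.
rewrite mulr_gt0 ?divr_gt0 ?exprn_even_gt0//.
have bK : `|b / K| <= 2^-1.
  rewrite normrM normfV (gtr0_norm K0) ler_pdivrMr// /K.
  by have := normr_ge0 Y; have := normr_ge0 b; lra.
have YK : `|Y / K| <= 2^-1.
  rewrite normrM normfV (gtr0_norm K0) ler_pdivrMr// /K.
  by have := normr_ge0 Y; have := normr_ge0 b; lra.
have : (Y / K) ^+ 2 <= 4^-1.
  rewrite -[leLHS]real_normK ?num_real//; have := normr_ge0 (Y / K).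
  by move: YK; move: (`|Y / K|) => z; nra.
by move: bK; rewrite ler_norml => /andP[]; lra.
Qed.

(* A maximizer [g] of [tr (N g x g^T)] over the orthogonal group, for [N]
   diagonal with distinct entries, diagonalizes [x]: comparing with [h g], [h]
   the reflection along [e_i + t e_j], kills the [(i, j)] entry. *)
Lemma symmetric_diagonalizable (x : 'M[R]_d) : x^T = x ->
  exists g, g *m g^T = 1%:M /\ is_diag_mx (g *m x *m g^T).
Proof.
move=> xs; pose N : 'M[R]_d := diag_mx (\row_i (i : nat)%:R).
pose f (v : 'rV[R]_(d * d)) : R := \tr (N *m (vec_mx v *m x *m (vec_mx v)^T)).
have fpol : pol 2 f.
  apply: pol_mxtrace; rewrite -[2%N]add0n; apply: mpol_mul; first exact: mpol_cst.
  rewrite -[2%N]/((1 + 0) + 1)%N; apply: mpol_mul; last exact: (mpol_tr vec_mx_pol).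
  by apply: mpol_mul; [exact: vec_mx_pol|exact: mpol_cst].
have [||v vA vmax] := @compact_EVT_max _ R f _ _ orthogonal_compact.
- by exists (mxvec 1%:M) => /=; rewrite mxvecK trmx1 mulmx1.
- apply: continuous_subspaceT => w.
  exact/differentiable_continuous/(pol_diff fpol).1.
move: vA; rewrite inE/=; set g := vec_mx v => gg.
exists g; split=> //; set y := g *m x *m g^T.
have ys : y^T = y by rewrite /y !trmx_mul trmxK xs mulmxA.
apply/is_diag_mxP => i j ij.
have ij' : i != j by apply: contra_neq ij => ->.
have nij : (i : nat)%:R - (j : nat)%:R != 0 :> R.
  by rewrite subr_eq0 eqr_nat; apply: contra_neq ij.
suff H (t : R) : t * ((((i : nat)%:R - (j : nat)%:R) * y i j) * (1 - t ^+ 2) +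
    t * (((i : nat)%:R - (j : nat)%:R) * (y j j - y i i))) <= 0.
  by have /eqP := critical_offdiag H; rewrite mulf_eq0 (negbTE nij) => /eqP.
pose u : 'rV[R]_d := delta_mx 0 i + t *: delta_mx 0 j.
have quad A : (u *m A *m u^T) 0 0 = A i i + t * (A i j + A j i) + t ^+ 2 * A j j.
  exact: reflection_quad.
have uu : u *m u^T = (1 + t ^+ 2)%:M.
  rewrite [LHS]mx11_scalar -[u in u *m _]mulmx1 quad !mxE !eqxx (negbTE ij') eq_sym (negbTE ij').
  by congr (_%:M); rewrite !(mulr1n, mulr0n); ring.
have s0 : 0 < 1 + t ^+ 2 by rewrite ltr_pwDl// sqr_ge0.
pose a := 2 / (1 + t ^+ 2); pose P := u^T *m u; pose h := 1%:M - a *: P.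
have Ps : P^T = P by rewrite /P trmx_mul trmxK.
have PP : P *m P = (1 + t ^+ 2) *: P.
  by rewrite /P mulmxA -(mulmxA u^T) uu mul_mx_scalar -scalemxAl.
have hs : h^T = h by rewrite /h linearB linearZ/= trmx1 Ps.
have hh : h *m h = 1%:M.
  rewrite /h mulmxBl !mulmxBr !mul1mx !mulmx1 -!scalemxAl -!scalemxAr PP !scalerA.
  have -> : a * a * (1 + t ^+ 2) = a + a by rewrite /a; field; rewrite gt_eqF.
  by rewrite scalerDl opprB addrK subrK.
have := vmax (mxvec (h *m g)).
rewrite inE/= mxvecK trmx_mul mulmxA -(mulmxA h) gg mulmx1 hs hh => /(_ erefl).
rewrite /f mxvecK -/g -/y trmx_mul hs.
have -> : h *m g *m x *m (g^T *m h) = h *m y *m h by rewrite /y !mulmxA.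
(* Every trace in the expansion except that of [N *m y] contains the rank-one matrix [P], hence
   reduces to quadratic forms in [u]. *)
have n_tr A : \tr (N *m (u^T *m (u *m A))) = (u *m A *m N *m u^T) 0 0.
  by rewrite mulmxA mxtrace_mulC [X in \tr X]mx11_scalar mxtrace_scalar mulr1n !mulmxA.
have NE A : A *m N = \matrix_(k, l) (A k l * (l : nat)%:R).
  by rewrite /N mul_mx_diag; apply/matrixP => k l; rewrite !mxE.
have yji : y j i = y i j by have := congr1 (fun A : 'M[R]_d => A i j) ys; rewrite mxE.
have T1 : \tr (N *m (P *m y)) = (u *m (y *m N) *m u^T) 0 0.
  by rewrite /P -mulmxA n_tr !mulmxA.
have T2 : \tr (N *m (y *m P)) = (u *m (y *m N) *m u^T) 0 0.
  rewrite -T1; have -> : N *m (y *m P) = (P *m y *m N)^T.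
    by rewrite (trmx_mul (P *m y)) (trmx_mul P) Ps ys tr_diag_mx.
  by rewrite mxtrace_tr mxtrace_mulC.
have T3 : \tr (N *m (P *m y *m P)) = (u *m y *m u^T) 0 0 * (u *m N *m u^T) 0 0.
  rewrite /P; have -> : u^T *m u *m y *m (u^T *m u) = (u *m y *m u^T) 0 0 *: (u^T *m (u *m 1%:M)).
    have c := mx11_scalar (u *m y *m u^T).
    have -> : u^T *m u *m y *m (u^T *m u) = u^T *m ((u *m y *m u^T) *m u) by rewrite !mulmxA.
    by rewrite {1}c mul_scalar_mx -scalemxAr mulmx1.
  by rewrite -scalemxAr linearZ/= n_tr mulmx1.
have -> : h *m y *m h = y - a *: (P *m y) - a *: (y *m P) + a ^+ 2 *: (P *m y *m P).
  rewrite /h !mulmxBl !mul1mx !mulmxBr !mulmx1 -!scalemxAl -!scalemxAr.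
  move: (P *m y) (y *m P) (P *m y *m P) => A B C.
  by apply/matrixP => k l; rewrite !mxE; ring.
rewrite mulmxDr !mulmxBr -!scalemxAr mxtraceD !linearB/= !mxtraceZ T1 T2 T3.
have yN k l : (y *m N) k l = y k l * (l : nat)%:R by rewrite NE [LHS]mxE.
have Nkk k : N k k = (k : nat)%:R by rewrite !mxE eqxx mulr1n.
have Nij : N i j = 0 by rewrite !mxE (negbTE ij') mulr0n.
have Nji : N j i = 0 by rewrite !mxE eq_sym (negbTE ij') mulr0n.
rewrite !quad !yN !Nkk Nij Nji yji.
move: (\tr (N *m y)) (y i i) (y j j) (y i j) (i : nat)%:R (j : nat)%:R => T p q Y n m.
(* Multiplying by the positive [(1 + t ^ 2) ^ 2 / 4] clears the denominators of [a] and leaves the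
   expression of [critical_offdiag]. *)
rewrite -subr_le0 -(pmulr_rle0 _ (_ : 0 < (1 + t ^+ 2) ^+ 2 / 4)); last first.
  by rewrite divr_gt0// exprn_gt0.
by congr (_ <= 0); rewrite /a; field; rewrite gt_eqF.
Qed.

(** The determinant is 1 or -1, and a sign matrix with that determinant commutes with every diagonal
    matrix: it makes a rotation of an orthogonal matrix without disturbing the diagonal form. *)
Lemma sign_correction g : (0 < d)%N -> g *m g^T = 1%:M ->
  exists2 e : 'rV[R]_d, diag_mx e *m diag_mx e = 1%:M & \det (diag_mx e) = \det g.
Proof.
move=> d0 gg; exists (\row_k (if k == Ordinal d0 then \det g else 1)).
  have dg : \det g ^+ 2 = 1 by have := congr1 determinant gg; rewrite det_mulmx det_tr det1 expr2.
  rewrite mulmx_diag -diag_const_mx; congr diag_mx; apply/rowP => k; rewrite !mxE.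
  by case: eqP => _; rewrite ?mulr1// -expr2.
rewrite det_diag (bigD1 (Ordinal d0))//= mxE eqxx big1 ?mulr1// => k k0.
by rewrite mxE (negbTE k0).
Qed.

Lemma rotation_diagonalizable (x : 'M[R]_d) : (0 < d)%N -> x^T = x ->
  exists2 g, g \in @rotation R d & exists l : 'rV_d, x = g *m diag_mx l *m g^T.
Proof.
move=> d0 /symmetric_diagonalizable[h [hh /diag_mxP[l yl]]].
have [e ee de] := sign_correction d0 hh.
have dh : \det h ^+ 2 = 1 by have := congr1 determinant hh; rewrite det_mulmx det_tr det1 expr2.
pose g := h^T *m diag_mx e; exists g.
  rewrite /rotation unfold_in; apply/andP; split.
    rewrite /g trmx_mul trmxK tr_diag_mx mulmxA -(mulmxA h^T) ee mulmx1.
    by apply/eqP/mulmx1C.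
  by rewrite det_mulmx det_tr de -expr2 dh.
exists l; rewrite /g trmx_mul trmxK tr_diag_mx -!mulmxA (mulmxA (diag_mx l)) diag_mxC.
rewrite (mulmxA (diag_mx e)) (mulmxA (diag_mx e)) ee mul1mx -yl !mulmxA.
have hTh := mulmx1C hh.
by rewrite hTh mul1mx -mulmxA hTh mulmx1.
Qed.

(** The matrix of an odd permutation has determinant -1, which the sign matrix repairs; so [F] on
    diagonal matrices is invariant under all permutations of the entries, not only the even ones. *)
Lemma rotation_permutation (s : 'S_d) : (0 < d)%N ->
  exists2 g, g \in @rotation R d &
    forall l : 'rV[R]_d, g *m diag_mx l *m g^T = diag_mx (col_perm s l).
Proof.
move=> d0; pose h : 'M[R]_d := perm_mx s.
have hh : h *m h^T = 1%:M by rewrite tr_perm_mx -perm_mxM mulgV perm_mx1.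
have [e ee de] := sign_correction d0 hh.
have dh : \det h ^+ 2 = 1 by have := congr1 determinant hh; rewrite det_mulmx det_tr det1 expr2.
exists (diag_mx e *m h) => [|l].
  rewrite /rotation unfold_in trmx_mul tr_diag_mx mulmxA -(mulmxA _ h) hh mulmx1 ee eqxx/=.
  by rewrite det_mulmx de -expr2 dh.
have E : h *m diag_mx l *m h^T = diag_mx (col_perm s l).
  rewrite tr_perm_mx -row_permE -col_permE; apply/matrixP => i j; rewrite !mxE.
  by rewrite (inj_eq perm_inj).
rewrite trmx_mul tr_diag_mx !mulmxA -(mulmxA _ h) -(mulmxA _ _ h^T) E.
by rewrite -mulmxA diag_mxC mulmxA ee mul1mx.
Qed.

End spectral.

(** * Approximation by sums of products *)

Section tensor_approximation.
Context {R : realType} (d : nat).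
Implicit Types (l : 'rV[R]_d) (phi : 'rV[R]_d -> R) (M e : R).

Definition upd l (i : 'I_d) (t : R) : 'rV[R]_d := \row_k (if k == i then t else l 0 k).

Definition cube M : set 'rV[R]_d := [set l | forall k, `|l 0 k| <= M].

Lemma upd_cube M l i t : cube M l -> `|t| <= M -> cube M (upd l i t).
Proof. by move=> lM tM k; rewrite mxE; case: eqP. Qed.

Lemma upd_id l i : upd l i (l 0 i) = l.
Proof. by apply/rowP => k; rewrite mxE; case: eqP => [->|]. Qed.

Lemma updC l i j s t : i != j -> upd (upd l i s) j t = upd (upd l j t) i s.
Proof.
move=> ij; apply/rowP => k; rewrite !mxE; case: eqP => [->|//].
by rewrite eq_sym (negbTE ij).
Qed.

(** Partially separated functions: the coordinates in [s] enter through polynomials, the others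
    through the coefficient [q.1]. This lets an induction separate one coordinate at a time. *)
Definition tensor (n : nat) (s : seq 'I_d) phi :=
  exists L : seq (('rV[R]_d -> R) * ('I_d -> {poly R})),
  [/\ forall q, q \in L -> forall i, (size (q.2 i) <= n)%N,
      forall q, q \in L -> forall i l t, i \in s -> q.1 (upd l i t) = q.1 l &
      forall l, phi l = \sum_(q <- L) q.1 l * \prod_(i <- s) (q.2 i).[l 0 i]].

(* If [V] is a one-variable operator of norm at most [3] that fixes [p], then
   [phi - V psi = (phi - p) - V (phi - p) + V (phi - psi)], whence the recurrence. *)
Fixpoint tensor_const (k : nat) : R := if k is m.+1 then 4 + 3 * tensor_const m else 0.

Lemma vallee_poussin_scaled (N : nat) M : (0 < N)%N -> 0 < M ->
  exists (m : nat) (y : 'I_m -> R) (w : 'I_m -> {poly R}),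
  [/\ forall k, `|y k| <= M, forall k, (size (w k) <= N.*2)%N,
      forall x : R, `|x| <= M -> \sum_k `|(w k).[x]| <= 3 &
      forall (p : {poly R}) (x : R), (size p <= N.+1)%N -> \sum_k p.[y k] * (w k).[x] = p.[x]].
Proof.
move=> N0 M0; have [m [y [w [y1 sw w3 pw]]]] := @vallee_poussin R N N0.
exists m, (fun k => M * y k), (fun k => w k \Po (M^-1 *: 'X)); split.
- by move=> k; rewrite normrM (gtr0_norm M0) ler_piMr ?(ltW M0)// ler_norml.
- move=> k; rewrite (leq_trans _ (sw k))// size_comp_poly2//.
  by rewrite size_scale ?size_polyX// invr_eq0 gt_eqF.
- move=> x xM; under eq_bigr => k _ do rewrite horner_comp hornerZ hornerX.
  apply: w3; rewrite -ler_norml normrM normfV (gtr0_norm M0).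
  by rewrite mulrC ler_pdivrMr// mul1r.
- move=> p x sp; have sp' : (size (p \Po (M *: 'X)) <= N.+1)%N.
    by rewrite size_comp_poly2// size_scale ?size_polyX// gt_eqF.
  have /(congr1 (fun q => q.[M^-1 * x])) := pw _ sp'.
  rewrite horner_sum horner_comp hornerZ hornerX mulVKf ?gt_eqF// => <-.
  by apply: eq_bigr => k _; rewrite hornerZ !horner_comp !hornerZ !hornerX.
Qed.

Lemma tensor_approx_seq (N : nat) M e phi (s : seq 'I_d) : (0 < N)%N -> 0 < M -> uniq s ->
  (forall l i, cube M l -> exists2 p : {poly R}, (size p <= N.+1)%N &
     forall t, `|t| <= M -> `|phi (upd l i t) - p.[t]| <= e) ->
  exists2 psi, tensor N.*2 s psi & forall l, cube M l -> `|phi l - psi l| <= tensor_const (size s) * e.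
Proof.
move=> N0 M0 us H; have [m [y [w [yM sw w3 pw]]]] := vallee_poussin_scaled N0 M0.
elim: s us => [_|i s IH] /=.
  exists phi => [|l _]; last by rewrite subrr normr0 mul0r.
  exists [:: (phi, fun=> 0)]; split=> [q|q|l]; rewrite ?inE.
  - by move=> /eqP -> i; rewrite size_poly0.
  - by [].
  - by rewrite big_seq1 big_nil mulr1.
move=> /andP[iNs us]; have [psi [L [sL iL psiL]] psie] := IH us.
have upds l t j : j \in s -> (upd l i t) 0 j = l 0 j.
  by move=> js; rewrite mxE; case: eqP => // ji; rewrite -ji js in iNs.
(* Sampling [psi] at the nodes removes coordinate [i] from the coefficient; it returns only through
   [w k]. The nodes stay in the cube, where [psi] is close to [phi]. *)
exists (fun l => \sum_k psi (upd l i (y k)) * (w k).[l 0 i]).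
  exists [seq ((fun l => q.1 (upd l i (y k))), (fun j => if j == i then w k else q.2 j)) | k <- enum 'I_m, q <- L].
  split=> [_ /allpairsP[[k q] /= [_ qL ->]] j|_ /allpairsP[[k q] /= [_ qL ->]] j l t|l] /=.
  - by case: eqP => _; [exact: sw|exact: sL].
  - rewrite inE => /orP[/eqP ->|js].
      by congr (q.1 _); apply/rowP => j'; rewrite !mxE; case: eqP.
    have ji : j != i by apply: contraNneq iNs => <-.
    by rewrite updC// iL.
  - rewrite big_allpairs_dep/= [RHS]big_enum/=; apply: eq_bigr => k _.
    rewrite psiL mulr_suml; apply: eq_bigr => q _; rewrite big_cons eqxx -mulrA; congr (_ * _).
    rewrite mulrC; congr (_ * _); rewrite big_seq [RHS]big_seq; apply: eq_bigr => j js.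
    by rewrite upds//; case: eqP => // ji; rewrite -ji js in iNs.
move=> l lM; have li : `|l 0 i| <= M by exact: lM.
have [p sp pe] := H l i lM.
have e0 : 0 <= e by apply: le_trans (pe (l 0 i) li).
have -> : phi l - \sum_k psi (upd l i (y k)) * (w k).[l 0 i] =
   (phi (upd l i (l 0 i)) - p.[l 0 i]) -
   \sum_k ((phi (upd l i (y k)) - p.[y k]) + (psi (upd l i (y k)) - phi (upd l i (y k)))) * (w k).[l 0 i].
  rewrite upd_id -(pw p (l 0 i) sp) -addrA -opprD -big_split/=; congr (_ - _).
  by apply: eq_bigr => k _; ring.
apply: (le_trans (ler_normB _ _)).
have S0 : \sum_k `|((phi (upd l i (y k)) - p.[y k]) + (psi (upd l i (y k)) - phi (upd l i (y k)))) * (w k).[l 0 i]| <=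
    (e + tensor_const (size s) * e) * 3.
  apply: (@le_trans _ _ (\sum_k (e + tensor_const (size s) * e) * `|(w k).[l 0 i]|)).
    apply: ler_sum => k _; rewrite normrM ler_wpM2r//.
    apply: (le_trans (ler_normD _ _)); apply: lerD; first exact: pe.
    by rewrite distrC; apply: psie; exact: upd_cube.
  rewrite -mulr_sumr ler_wpM2l ?w3//.
  have := psie l lM => /(le_trans (normr_ge0 _)).
  by lra.
apply: le_trans (lerD (pe (l 0 i) li) (le_trans (ler_norm_sum _ _ _) S0)) _.
rewrite le_eqVlt; apply/orP; left; apply/eqP; ring.
Qed.

Lemma tensor_approx (N : nat) M e phi : (0 < N)%N -> 0 < M ->
  (forall l i, cube M l -> exists2 p : {poly R}, (size p <= N.+1)%N &
     forall t, `|t| <= M -> `|phi (upd l i t) - p.[t]| <= e) ->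
  exists L : seq (R * ('I_d -> {poly R})),
    (forall q, q \in L -> forall i, (size (q.2 i) <= N.*2)%N) /\
    forall l, cube M l -> `|phi l - \sum_(q <- L) q.1 * \prod_i (q.2 i).[l 0 i]| <= tensor_const d * e.
Proof.
move=> N0 M0 H; have [psi [L [sL iL psiL]] psie] := tensor_approx_seq N0 M0 (enum_uniq 'I_d) H.
(* The coefficients depend on no coordinate any more, so each is the constant [q.1 0]. *)
exists [seq (q.1 0, q.2) | q <- L]; split=> [_ /mapP[q qL ->]|l lM]; first exact: sL.
rewrite -[X in tensor_const X](card_ord d) cardE; apply: le_trans (psie l lM).
rewrite big_map psiL le_eqVlt; apply/orP; left; apply/eqP; congr (`|_ - _|).
rewrite big_seq [RHS]big_seq; apply: eq_bigr => q qL; rewrite big_enum/=; congr (_ * _).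
suff E (s : seq 'I_d) : q.1 (\row_k (if k \in s then 0 else l 0 k)) = q.1 l.
  by rewrite -(E (enum 'I_d)); congr (q.1 _); apply/rowP => k; rewrite !mxE mem_enum.
elim: s => [|i s IH]; first by congr (q.1 _); apply/rowP => k; rewrite mxE.
rewrite -IH -(iL q qL i (\row_k (if k \in s then 0 else l 0 k)) 0) ?mem_enum//.
by congr (q.1 _); apply/rowP => k; rewrite !mxE inE; case: eqP.
Qed.

End tensor_approximation.

(** * Rotation-invariant extension of polynomials *)

Section symmetric_extension.
Context {R : realType} (d' : nat).
Local Notation d := d'.+1.
Implicit Types (l : 'rV[R]_d) (L : seq (R * ('I_d -> {poly R}))).

Lemma symmx_sym (x : symmx R d) : (\val x)^T = \val x.
Proof. exact/sym_predP/(valP x). Qed.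

Lemma sdiag_subproof l : diag_mx l \in @sym_pred R d.
Proof. by apply/sym_predP; rewrite tr_diag_mx. Qed.

Definition sdiag l : symmx R d := NormedSubmod (sdiag_subproof l).

Lemma symmx_entry (x : symmx R d) i j : `|\val x i j| <= `|x|.
Proof.
rewrite normed_submod_normE [leRHS]/Num.norm/= mx_normrE.
exact: (le_bigmax_cond _ (fun k : 'I_d * 'I_d => `|\val x k.1 k.2|) (isT : xpredT (i, j))).
Qed.

Lemma symmx_mpol : mpol 1 (fun x : symmx R d => \val x).
Proof.
move=> i j; have S : scalar (fun x : symmx R d => \val x i j).
  by move=> a u v; rewrite linearP !mxE.
apply: pol_lin => //.
pose L : {linear symmx R d -> R} := HB.pack (fun x : symmx R d => \val x i j)
  (GRing.isLinear.Build R (symmx R d) R *%R (fun x : symmx R d => \val x i j) S).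
apply: (@linear_bounded_continuous _ _ _ L).1; apply/bounded_funP => r.
by exists r => v vr; apply: le_trans (symmx_entry v i j) vr.
Qed.

(* By polarization of the determinant of diagonal matrices, this is the average
   of [\sum_(q <- L) q.1 * \prod_k (q.2 k).[l 0 (s k)]] over the permutations
   [s] of the eigenvalues [l] of [x]. *)
Definition sym_ext L (x : 'M[R]_d) : R := d`!%:R^-1 * \sum_(q <- L) q.1 *
  \sum_(T : {set 'I_d}) (-1) ^+ #|~: T| * \det (\sum_(i in T) horner_mx x (q.2 i)).

Lemma sym_ext_pol L m : (forall q, q \in L -> forall i, (size (q.2 i) <= m.+1)%N) ->
  pol (d * m) (fun x : symmx R d => sym_ext L (\val x)).
Proof.
move=> Lm; apply: pol_scale; under eq_fun => x do rewrite big_seq.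
apply: pol_sum => q qL; apply: pol_scale; apply: pol_sum => T _; apply: pol_scale.
by apply: pol_det; apply: mpol_sum => i; apply: mpol_horner; [exact: symmx_mpol|exact: Lm].
Qed.

(** Conjugation passes through [horner_mx] and drops out of the determinant. On diagonal matrices
    the determinant is the multilinear form [B] with equal arguments, so [polarization] turns the
    signed sum into one over permutations. *)
Lemma sym_ext_conj L g l : g \in @rotation R d ->
  sym_ext L (g *m diag_mx l *m g^T) =
  d`!%:R^-1 * \sum_(s : 'S_d) \sum_(q <- L) q.1 * \prod_k (q.2 k).[(col_perm s l) 0 k].
Proof.
move=> gG; rewrite /sym_ext exchange_big/=; congr (_ * _); apply: eq_bigr => q _.
rewrite -mulr_sumr; congr (_ * _).
have gu : g \in unitmx by case/andP: gG => /eqP /mulmx1_unit[].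
pose B (v : 'I_d -> 'rV[R]_d) : R := \prod_k v k 0 k.
have mB : multilinear B.
  move=> v i a x y; rewrite /B (bigD1 i)//= [X in _ = a * X + _](bigD1 i)//=.
  rewrite [X in _ = _ + X](bigD1 i)//= !dfwithE !eqxx !mxE mulrDl mulrA.
  by congr (_ * _ + _ * _); apply: eq_bigr => j /negbTE ji; rewrite !dfwithE ji.
transitivity (\sum_(T : {set 'I_d}) (-1) ^+ #|~: T| *
    B (fun=> \sum_(i in T) \row_k (q.2 i).[l 0 k])).
  apply: eq_bigr => T _; congr (_ * _).
  rewrite (_ : \sum_(i in T) _ = g *m diag_mx (\sum_(i in T) \row_k (q.2 i).[l 0 k]) *m invmx g).
    by rewrite !det_mulmx mulrC mulrA -det_mulmx mulVmx// det1 mul1r det_diag.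
  rewrite raddf_sum mulmx_sumr mulmx_suml; apply: eq_bigr => i _.
  rewrite -(rotation_inv gG) horner_mx_uconj// horner_mx_diag; congr (_ *m diag_mx _ *m _).
  by apply/rowP => k; rewrite !mxE.
(* Polarization permutes the polynomials; passing to the inverse permutation and reindexing the
   product moves it onto the eigenvalues. *)
rewrite (polarization _ mB) (reindex_inj invg_inj)/=; apply: eq_bigr => s _.
rewrite /B (reindex_inj (@perm_inj _ s))/=; apply: eq_bigr => k _.
by rewrite !mxE permK.
Qed.

Variable F : symmx R d -> R.
Hypothesis Finv : rotation_invariant F.

Lemma rotation_invariantE g l (x : symmx R d) : g \in @rotation R d ->
  \val x = g *m diag_mx l *m g^T -> F x = F (sdiag l).
Proof.
move=> gG xl; rewrite -(Finv gG (sdiag l)); congr F; apply: val_inj => /=.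
by rewrite rotation_inv.
Qed.

Lemma sdiag_perm (s : 'S_d) l : F (sdiag (col_perm s l)) = F (sdiag l).
Proof.
have [g gG gE] := @rotation_permutation R d s isT.
by apply: (rotation_invariantE gG); rewrite gE.
Qed.

Lemma transfer (N : nat) (M e : R) : (0 < N)%N -> 0 < M ->
  (forall l i, cube M l -> exists2 p : {poly R}, (size p <= N.+1)%N &
     forall t, `|t| <= M -> `|F (sdiag (upd l i t)) - p.[t]| <= e) ->
  exists2 P, pol (d * N.*2) P &
    forall x, d%:R ^+ 2 * `|x| <= M -> `|F x - P x| <= tensor_const d * e.
Proof.
move=> N0 M0 H; have [L [sL LF]] := @tensor_approx R d N M e (fun l => F (sdiag l)) N0 M0 H.
exists (fun x => sym_ext L (\val x)) => [|x xM].
  by apply: sym_ext_pol => q qL i; apply: leqW; exact: sL.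
have [g gG [l xl]] := @rotation_diagonalizable R d (\val x) isT (symmx_sym x).
have gg : g *m g^T = 1%:M by case/andP: gG => /eqP.
(* Each eigenvalue is a diagonal entry of [g^T x g], a sum of [d ^ 2] terms bounded by the maximum
   norm of [x], because the entries of [g] are at most 1 in absolute value. *)
have lM : cube M l.
  move=> k; apply: le_trans xM.
  have -> : l 0 k = (g^T *m \val x *m g) k k.
    rewrite xl !mulmxA (mulmx1C gg) mul1mx -mulmxA (mulmx1C gg) mulmx1 mxE eqxx.
    by rewrite mulr1n.
  rewrite mxE; apply: le_trans (ler_norm_sum _ _ _) _.
  rewrite expr2 -mulrA -[X in X%:R * _]card_ord mulr_natl -sumr_const; apply: ler_sum => j _.
  rewrite normrM -[leRHS]mulr1; apply: ler_pM => //; last exact: orthogonal_entry.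
  rewrite mxE; apply: le_trans (ler_norm_sum _ _ _) _.
  rewrite -[X in X%:R * _]card_ord mulr_natl -sumr_const; apply: ler_sum => i _.
  rewrite normrM -[leRHS]mul1r; apply: ler_pM => //; last exact: symmx_entry.
  by rewrite mxE; exact: orthogonal_entry.
rewrite (rotation_invariantE gG xl) xl sym_ext_conj//.
have f0 : (0 : R) < d`!%:R by rewrite ltr0n fact_gt0.
have -> : F (sdiag l) = d`!%:R^-1 * \sum_(s : 'S_d) F (sdiag (col_perm s l)).
  under eq_bigr => s _ do rewrite sdiag_perm.
  by rewrite sumr_const card_Sn -[F _ *+ _]mulr_natl mulKf// gt_eqF.
rewrite -mulrBr -sumrB normrM (ger0_norm (ltW _)) ?invr_gt0// mulrC ler_pdivrMr//.
apply: le_trans (ler_norm_sum _ _ _) _; rewrite mulr_natr -card_Sn -sumr_const.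
by apply: ler_sum => s _; apply: LF => k; rewrite mxE.
Qed.

End symmetric_extension.

(** * Direct theorems on diagonal matrices *)

Section lines.
Context {R : realType} {V : normedModType R}.
Implicit Types (f h : V -> R) (K : set V) (w x : V).

Lemma papprox_weak (m n : nat) (e e' : R) (g : R -> R) : (m <= n)%N -> e <= e' ->
  papprox m e g -> papprox n e' g.
Proof.
move=> mn ee' [p sp pe]; exists p; first exact: leq_trans sp _.
by move=> x x1; apply: le_trans (pe x x1) ee'.
Qed.

(** Local constants are merged through the filter at [+oo], which is why the local hypothesis asks
    for every [C >= C0]. *)
Lemma compact_uniform K (P : R -> V -> Prop) : compact K ->
  (forall a, K a -> exists2 W, nbhs a W & exists C0, forall C x, C0 <= C -> W x -> P C x) ->
  exists2 C : R, 0 < C & forall x, K x -> P C x.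
Proof.
move=> /compact_near_coveringP cK H.
have KP : \forall C \near +oo, K `<=` P C.
  apply: cK => a Ka; have [W aW [C0 PC]] := H a Ka.
  exists (W, [set C | C0 <= C]); first by split=> //=; apply: nbhs_pinfty_ge; exact: num_real.
  by move=> [x C] [/= Wx CC0]; exact: PC.
have [C [C0 KC]] := filter_ex (filterI (nbhs_pinfty_gt (num_real 0)) KP).
by exists C.
Qed.

Lemma compact_sup K h : compact K -> continuous h ->
  exists2 B : R, 0 < B & forall x, K x -> `|h x| <= B.
Proof.
move=> cK ch; apply: compact_uniform cK _ => a Ka.
exists [set x | `|h a - h x| < 1].
  by have /cvgr_dist_lt/(_ _ ltr01) := ch a.
exists (`|h a| + 1) => C x CC /= hx; apply: le_trans CC.
rewrite -[h x](subrK (h a)); apply: le_trans (ler_normD _ _) _.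
by rewrite addrC lerD2l distrC ltW.
Qed.

(** Close pairs fall under a local Holder bound; pairs at distance at least [r / 2] under the
    supremum [B], at the price [2 B] over the [alpha]-th power of [r / 2]. *)
Lemma compact_holder K h (alpha : R) : 0 < alpha -> compact K -> continuous h ->
  (forall a : V, exists2 W, nbhs a W & exists C : R, forall x y, W x -> W y ->
     `|h x - h y| <= C * `|x - y| `^ alpha) ->
  exists2 D : R, 0 < D & forall x y, K x -> K y -> `|h x - h y| <= D * `|x - y| `^ alpha.
Proof.
move=> a0 cK ch hH; have [B B0 hB] := compact_sup cK ch.
suff [D D0 KD] : exists2 D : R, 0 < D & forall x, K x ->
    K x -> forall y, K y -> `|h x - h y| <= D * `|x - y| `^ alpha.
  by exists D => // x y Kx; exact: KD.
apply: compact_uniform cK _ => a _; have [W /nbhs_ballP[r /= r0 rW] [C WC]] := hH a.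
have r20 : 0 < r / 2 by rewrite divr_gt0.
exists (ball a (r / 2)); first exact: nbhsx_ballx.
exists (Num.max C (2 * B / (r / 2) `^ alpha)) => D x; rewrite ge_max => /andP[CD BD] ax Kx y Ky.
have Wx : W x by apply: rW; apply: le_ball ax; lra.
have [xy|xy] := ltP `|x - y| (r / 2).
  apply: (le_trans (WC x y Wx _)); last by rewrite ler_wpM2r ?powR_ge0.
  apply: rW; rewrite (splitr r); apply: ball_triangle ax _.
  by rewrite -ball_normE.
apply: le_trans (ler_normB _ _) _; apply: le_trans (lerD (hB x Kx) (hB y Ky)) _.
have p0 : 0 < (r / 2) `^ alpha by rewrite powR_gt0.
apply: (@le_trans _ _ (2 * B / (r / 2) `^ alpha * (r / 2) `^ alpha)).
  by rewrite divfK ?gt_eqF//; lra.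
apply: ler_pM; rewrite ?divr_ge0 ?powR_ge0//; first by lra.
by rewrite ge0_ler_powR ?nnegrE//; exact: ltW.
Qed.

Lemma iter_diff_line n f k x w (u : R) : is_Cn n f -> (k < n)%N ->
  is_derive u 1 (fun u => iter_diff f (nseq k w) (x + u *: w))
    (iter_diff f (nseq k.+1 w) (x + u *: w)).
Proof.
move=> [fd _] kn; have := fd (nseq k w) _ (x + u *: w); rewrite size_nseq => /(_ kn) hd.
have E : (fun h : R => h^-1 *: (((fun u => iter_diff f (nseq k w) (x + u *: w)) \o shift u) (h *: 1) -
    iter_diff f (nseq k w) (x + u *: w))) =
  (fun h : R => h^-1 *: ((iter_diff f (nseq k w) \o shift (x + u *: w)) (h *: w) -
    iter_diff f (nseq k w) (x + u *: w))).
  apply/funext => h /=; congr (_ *: (iter_diff _ _ _ - _)).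
  by rewrite scaler1 scalerDl addrCA.
apply: DeriveDef.
  by rewrite /derivable E; exact: diff_derivable.
by rewrite /derive E -[LHS]/('D_w (iter_diff f (nseq k w)) (x + u *: w)) deriveE.
Qed.

Lemma line_papprox n f x w (N : nat) (e : R) : is_Cn n f ->
  papprox N e (fun u => iter_diff f (nseq n w) (x + u *: w)) ->
  papprox (N + n) ((181 / N.+1%:R) ^+ n * e) (fun u => f (x + u *: w)).
Proof.
move=> fC; apply: (@jackson R N n e (fun k u => iter_diff f (nseq k w) (x + u *: w))).
by move=> k u kn _; exact: iter_diff_line fC kn.
Qed.

Lemma powR_le1D_sqr (z alpha : R) : 0 <= z -> 0 < alpha -> alpha < 1 -> z `^ alpha <= 1 + z ^+ 2.
Proof.
move=> z0 a0 a1; have [z1|z1] := leP z 1.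
  apply: (@le_trans _ _ (1 `^ alpha)); first by rewrite ge0_ler_powR ?nnegrE// ltW.
  by rewrite powR1 lerDl sqr_ge0.
apply: le_trans (ler1_powR (ltW z1) (ltW a1)) _.
by apply: (@le_trans _ _ (z ^+ 2)); [rewrite expr2 ler_peMr// ltW|rewrite lerDr].
Qed.

(** With [z = N |x - y|], the factor [|x - y|] to the power [alpha] is [N^-alpha z^alpha], and
    [z^alpha <= 1 + z^2] gives the hypothesis of [jackson0]. *)
Lemma holder_papprox (N : nat) (D alpha : R) (g : R -> R) : (0 < N)%N -> 0 < alpha -> alpha < 1 -> 0 <= D ->
  (forall x y : R, -1 <= x <= 1 -> -1 <= y <= 1 -> `|g x - g y| <= D * `|x - y| `^ alpha) ->
  papprox N (181 * (D * N%:R^-1 `^ alpha)) g.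
Proof.
move=> N0 a0 a1 D0 gD; apply: jackson0 => // x y x1 y1.
have N0' : (0 : R) < N%:R by rewrite ltr0n.
apply: le_trans (gD x y x1 y1) _; rewrite -mulrA ler_wpM2l//.
have -> : `|x - y| = N%:R^-1 * (N%:R * `|x - y|) by rewrite mulKf// gt_eqF.
rewrite powRM ?invr_ge0 ?(ltW N0') ?mulr_ge0 ?(ltW N0')// ler_wpM2l ?powR_ge0//.
apply: le_trans (powR_le1D_sqr _ a0 a1) _; first by rewrite mulr_ge0// ltW.
by rewrite exprMn real_normK ?num_real.
Qed.

Definition line_in K x w := forall u : R, -1 <= u <= 1 -> K (x + u *: w).

Lemma pow2_rate (n k : nat) (alpha : R) :
  (2 ^ k)%:R^-1 `^ alpha * (2 ^ k)%:R ^- n = (2^-1 `^ alpha / 2 ^+ n) ^+ k :> R.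
Proof.
have -> : (2 ^ k)%:R^-1 = 2^-1 `^ k%:R :> R by rewrite natrX -exprVn powR_mulrn ?invr_ge0.
rewrite -powRrM (mulrC k%:R) powRrM powR_mulrn ?powR_ge0// exprMn; congr (_ * _).
by rewrite natrX exprVn -!exprM mulnC.
Qed.

Lemma jackson_rate (n k : nat) (e : R) : 0 <= e ->
  (181 / (2 ^ k).+1%:R) ^+ n * e <= 181 ^+ n * ((2 ^ k)%:R ^- n * e).
Proof.
move=> e0; rewrite expr_div_n -mulrA; apply: (ler_wpM2l (exprn_ge0 _ (ler0n _ _))); rewrite ler_wpM2r//.
rewrite lef_pV2 ?posrE ?exprn_gt0 ?ltr0n ?expn_gt0//.
by rewrite lerXn2r ?nnegrE ?ler_nat.
Qed.

Lemma holder_lines n (alpha : R) f K w : 0 < alpha -> alpha < 1 -> compact K ->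
  is_holder n alpha f -> exists2 D : R, 0 <= D & forall x, line_in K x w ->
    forall k, papprox (n.+2 * 2 ^ k) (D * (2^-1 `^ alpha / 2 ^+ n) ^+ k) (fun u => f (x + u *: w)).
Proof.
move=> a0 a1 cK [fC fH]; pose h := iter_diff f (nseq n w).
have [||D D0 KD] := compact_holder (h := h) a0 cK.
- by apply: fC.2; rewrite size_nseq.
- move=> a; have [W aW [C WC]] := fH a; exists W => //.
  exists (C * \prod_(v <- nseq n w) `|v|) => x y Wx Wy.
  by rewrite mulrAC; apply: WC => //; rewrite size_nseq.
pose D1 := D * `|w| `^ alpha; have D10 : 0 <= D1 by rewrite mulr_ge0 ?powR_ge0// ltW.
have c0 : (0 : R) <= 181 by exact: ler0n.
exists (181 ^+ n * (181 * D1)); first exact: (mulr_ge0 (exprn_ge0 _ c0) (mulr_ge0 c0 D10)).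
move=> x xK k.
have := @holder_papprox (2 ^ k) D1 alpha (fun u => h (x + u *: w)) _ a0 a1 D10.
rewrite expn_gt0 => /(_ isT) H; apply: papprox_weak (line_papprox fC (H _)).
- by rewrite !mulSn; have := expn_gt0 2 k; nia.
- apply: le_trans (jackson_rate _ _ _) _.
    exact: (mulr_ge0 c0 (mulr_ge0 D10 (powR_ge0 _ _))).
  by rewrite -pow2_rate le_eqVlt; apply/orP; left; apply/eqP; ring.
- move=> u v u1 v1; apply: le_trans (KD _ _ (xK u u1) (xK v v1)) _.
  rewrite /D1 -mulrA ler_wpM2l ?(ltW D0)//.
  by rewrite opprD addrACA subrr add0r -scalerBl normrZ mulrC powRM.
Qed.

(** The derivative of order [n + 1] is bounded on [K], which is [jackson0] with [D = 2 B]. The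
    additional Jackson step yields [2 ^ (- k)], better than [2 ^ (- k alpha)], and the factor
    [n + 2] makes room for the degree [2 ^ k + n + 1]. *)
Lemma smooth_lines n (alpha : R) f K w : 0 < alpha -> alpha < 1 -> compact K ->
  is_Cn n.+1 f -> exists2 D : R, 0 <= D & forall x, line_in K x w ->
    forall k, papprox (n.+2 * 2 ^ k) (D * (2^-1 `^ alpha / 2 ^+ n) ^+ k) (fun u => f (x + u *: w)).
Proof.
move=> a0 a1 cK fC; pose h := iter_diff f (nseq n.+1 w).
have [|B B0 KB] := @compact_sup K h cK.
  by apply: fC.2; rewrite size_nseq.
have c0 : (0 : R) <= 181 by exact: ler0n.
have B20 : 0 <= 181 * (2 * B) by apply: (mulr_ge0 c0); rewrite mulr_ge0// ltW.
exists (181 ^+ n.+1 * (181 * (2 * B))); first exact: (mulr_ge0 (exprn_ge0 _ c0) B20).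
move=> x xK k.
have H : papprox (2 ^ k) (181 * (2 * B)) (fun u => h (x + u *: w)).
  apply: jackson0 => [|u v u1 v1]; first by rewrite expn_gt0.
  apply: le_trans (ler_normB _ _) _; apply: le_trans (lerD (KB _ (xK u u1)) (KB _ (xK v v1))) _.
  rewrite (_ : B + B = 2 * B * 1); last by ring.
  by rewrite ler_wpM2l ?mulr_ge0 ?(ltW B0)// lerDl mulr_ge0 ?sqr_ge0.
apply: papprox_weak (line_papprox fC H).
  by rewrite !mulSn; have := expn_gt0 2 k; nia.
apply: le_trans (jackson_rate _ _ B20) _.
rewrite -[leRHS]mulrA; apply: (ler_wpM2l (exprn_ge0 _ c0)); rewrite mulrC ler_wpM2l//.
rewrite -pow2_rate exprS invfM ler_wpM2r ?invr_ge0 ?exprn_ge0//.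
set x2 : R := (2 ^ k)%:R; have k1 : 1 <= x2 by rewrite ler1n expn_gt0.
have k0 : 0 < x2 by exact: lt_le_trans k1.
have -> : x2^-1 `^ alpha = (x2 `^ alpha)^-1.
  apply/(mulIf (lt0r_neq0 (powR_gt0 alpha k0))).
  by rewrite -powRM ?invr_ge0 ?(ltW k0)// !mulVf ?powR1 ?gt_eqF ?powR_gt0.
by rewrite lef_pV2 ?posrE ?powR_gt0// ler1_powR// ltW.
Qed.

End lines.

(** * Analytic functions along lines *)

Section analytic_lines.
Context {R : realType} {V : normedModType R}.
Implicit Types (f : V -> R) (K : set V) (a b w x : V).

(** Re-expansion at a nearby point [b], with constants uniform in [b]. Instead of rearranging a
    double series, the partial sums at [a] are read as polynomials along the line and given to
    [series_of_papprox]. The choice of [t] keeps the segment within [r / 2] of [a], so they converge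
    with ratio one half. *)
Lemma analytic_line_series f (A : forall k, ('I_k -> V) -> R) (C r : R) a b w : 0 < r ->
  (forall k, multilinear (A k)) ->
  (forall k (v : 'I_k -> V), `|A k v| <= C * r ^- k * \prod_i `|v i|) ->
  (forall h, `|h| < r -> series (fun k => A k (fun=> h)) @ \oo --> f (a + h)) ->
  `|b - a| < r / 4 -> let t := r / (4 * (`|w| + 1)) in
  exists2 c : nat -> R, (forall k, `|c k| <= 600 * `|C| * (18 / t) ^+ k) &
    forall h : R, `|h| < t / 18 -> pseries c h @ \oo --> f (b + h *: w).
Proof.
move=> r0 Am AC Af ba t.
have w0 := normr_ge0 w.
have t0 : 0 < t by rewrite divr_gt0// mulr_gt0// ltr_wpDl.
have tw : t * `|w| <= r / 4.
  rewrite /t [leRHS](_ : _ = r / (4 * (`|w| + 1)) * (`|w| + 1)).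
    by apply: ler_wpM2l; [exact: ltW|rewrite lerDl].
  by field; rewrite gt_eqF// ltr_wpDl.
clearbody t; have hr (u : R) : -1 <= u <= 1 -> `|b - a + (t * u) *: w| <= r / 2.
  move=> u1; apply: le_trans (ler_normD _ _) _; rewrite normrZ normrM (gtr0_norm t0) mulrAC.
  have : `|u| <= 1 by rewrite ler_norml.
  have tw0 : 0 <= t * `|w| by rewrite mulr_ge0// ltW.
  move: (normr_ge0 u) tw tw0 ba.
  by move: (t * `|w|) (`|u|) (`|b - a|) => T U B; nra.
have /choice[q qP] : forall k, exists p : {poly R}, (size p <= k.+1)%N /\
    forall s, A k (fun=> b - a + s *: w) = p.[s].
  by move=> k; have [p sp pE] := multilinear_line (b - a) w (Am k); exists p.
pose P n : {poly R} := \sum_(0 <= k < n.+1) (q k \Po (t *: 'X)).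
pose g (u : R) := f (b + (t * u) *: w).
have PE n u : (P n).[u] = series (fun k => A k (fun=> b - a + (t * u) *: w)) n.+1.
  rewrite /P horner_sum /series/=; apply: eq_bigr => k _.
  by rewrite horner_comp hornerZ hornerX (qP k).2.
have gP (u : R) n : -1 <= u <= 1 ->
    `|g u - series (fun k => A k (fun=> b - a + (t * u) *: w)) n| <= 2 * `|C| * 2 ^- n.
  move=> u1; have hu := hr u u1; set h := b - a + _ in hu *.
  have half : 0 <= (2^-1 : R) < 1 by apply/andP; split; lra.
  have [n0|l ul lB] := @cvg_geo_bound R (series (fun k => A k (fun=> h))) `|C| 2^-1 half.
  - rewrite /series/= big_nat_recr//= addrAC subrr add0r.
    apply: le_trans (AC _ _) _; rewrite prodr_const card_ord -mulrA.
    apply: (@le_trans _ _ (`|C| * (r ^- n0 * `|h| ^+ n0))).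
      by rewrite ler_wpM2r ?ler_norm// mulr_ge0 ?exprn_ge0// invr_ge0 exprn_ge0// ltW.
    rewrite ler_wpM2l// -exprVn -exprMn lerXn2r ?nnegrE ?mulr_ge0 ?invr_ge0 ?(ltW r0)//.
    by rewrite mulrC ler_pdivrMr// mulrC.
  have hlt : `|h| < r by apply: le_lt_trans hu _; lra.
  have -> : g u = l.
    have := Af h hlt; rewrite [a + h](_ : _ = b + (t * u) *: w) => [fh|]; last first.
      by rewrite /h addrA (addrC a) subrK.
    by rewrite /g (cvg_unique _ fh ul).
  apply: le_trans (lB n) _; rewrite -exprVn le_eqVlt; apply/orP; left; apply/eqP; by field.
(* Degree factor 1 and constant [2 |C|] give the [600 |C|] and the base 18; undoing the scaling by
   [t] makes it [18 / t]. *)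
have [||||c [_ cB cg]] := @series_of_papprox R 1 (2 * `|C|) g P.
- by [].
- by move=> u u1; have := gP u 0%N u1; rewrite /series/= big_geq// subr0 expr0 invr1 mulr1.
- move=> n; rewrite mul1n; apply: leq_trans (size_sum _ _ _) _; apply/bigmax_leqP_seq => k.
  rewrite mem_index_iota => /andP[_ kn] _; rewrite size_comp_poly2.
    by apply: leq_trans (qP k).1 _.
  by rewrite size_scale ?size_polyX// gt_eqF.
- move=> n u u1; rewrite PE; apply: le_trans (gP u n.+1 u1) _.
  by rewrite ler_wpM2l ?mulr_ge0// -!exprVn exprS ler_piMl ?exprn_ge0//; lra.
exists (fun k => c k * t ^- k) => [k|h ht].
  rewrite normrM [X in _ * X]gtr0_norm ?invr_gt0 ?exprn_gt0//.
  apply: le_trans (ler_wpM2r _ (cB k)) _; first by rewrite invr_ge0 exprn_ge0// ltW.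
  rewrite !mulr1 exprMn !exprVn invrK; move: (18 ^+ k) (t ^- k) => p q'.
  by rewrite le_eqVlt; apply/orP; left; apply/eqP; ring.
have := cg (h / t); rewrite /g (mulrC t) divfK ?gt_eqF// mulr1 => H.
have /H : `|h / t| < 18^-1.
  by rewrite normrM normfV (gtr0_norm t0) ltr_pdivrMr// mulrC.
rewrite (_ : series _ = pseries (fun k => c k * t ^- k) h)//.
by apply/funext => n; apply: eq_bigr => k _ /=; rewrite exprMn exprVn -mulrA [X in _ * X]mulrC.
Qed.

Lemma analytic_lines f K w : compact K -> is_analytic f ->
  exists (L : nat) (C : R), [/\ (0 < L)%N, 0 < C & forall x, line_in K x w ->
    forall n, papprox (L * n) (C * 2 ^- n) (fun u => f (x + u *: w))].
Proof.
move=> cK fa.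
(* One constant serves as coefficient bound, growth rate and inverse radius, so that the property
   persists when [C] grows. *)
pose Q (C : R) b := 0 < C -> exists2 c : nat -> R, (forall k, `|c k| <= C * C ^+ k) &
  forall h : R, `|h| < C^-1 -> pseries c h @ \oo --> f (b + h *: w).
have [|C C0 KQ] := @compact_uniform R V K Q cK.
  move=> a _; have [A [C [r [r0 Am AC Af]]]] := fa a.
  exists (ball a (r / 4)); first by apply: nbhsx_ballx; rewrite divr_gt0.
  exists (Num.max (600 * `|C|) (18 / (r / (4 * (`|w| + 1))))) => D b.
  rewrite ge_max => /andP[CD tD] ab D0.
  have ba : `|b - a| < r / 4 by rewrite distrC; move: ab; rewrite -ball_normE.
  have [c cB cf] := analytic_line_series w r0 Am AC Af ba.
  set t := r / _ in tD cB cf; have t0 : 0 < t by rewrite divr_gt0// mulr_gt0// ltr_wpDl.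
  exists c => [k|h hD].
    have q0 : 0 <= 18 / t by exact: (divr_ge0 (ler0n _ _) (ltW t0)).
    apply: le_trans (cB k) _.
    apply: (ler_pM (mulr_ge0 (ler0n _ _) (normr_ge0 _)) (exprn_ge0 _ q0) CD).
    by rewrite lerXn2r ?nnegrE ?(ltW D0).
  apply: cf; apply: lt_le_trans hD _.
  by rewrite -[leRHS]invrK lef_pV2 ?posrE ?invr_gt0 ?divr_gt0// invf_div.
have [|L L0 HL] := @analytic_papprox R C C^-1; first by rewrite invr_gt0.
exists L, C; split=> // x xK n; apply: HL => u u1.
have [c cB cf] := KQ _ (xK u u1) C0; exists c => [k|h hC]; first by rewrite exprVn invrK.
by rewrite scalerDl addrA; exact: cf.
Qed.

End analytic_lines.

(** * Transfer of regularity to symmetric matrices *)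

Section main.
Context {R : realType} (d' : nat).
Local Notation d := d'.+1.
Implicit Types (l : 'rV[R]_d) (M e : R).

Lemma ddiag_subproof l : sdiag l \in @diag_pred R d.
Proof. exact: diag_mx_is_diag. Qed.

Definition ddiag l : diagmx R d := NormedSubmod (ddiag_subproof l).

Lemma ddiag_linear : linear ddiag.
Proof. by move=> a u v; apply/val_inj/val_inj; rewrite /= linearP. Qed.

Lemma ddiag_continuous : continuous ddiag.
Proof.
pose L : {linear 'rV[R]_d -> diagmx R d} := HB.pack ddiag
  (GRing.isLinear.Build R 'rV[R]_d (diagmx R d) *:%R ddiag ddiag_linear).
apply: (@linear_bounded_continuous _ _ _ L).1; apply/bounded_funP => r.
exists r => v vr; apply: le_trans vr.
rewrite !normed_submod_normE /= !/Num.norm/= mx_normrE.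
apply: bigmax_le => [|[i j] _ /=]; first exact: (normr_ge0 v).
rewrite mxE; case: eqP => [->|_]; last by rewrite mulr0n normr0 (normr_ge0 v).
rewrite mulr1n mx_normrE.
exact: (le_bigmax_cond _ (fun k : 'I_1 * 'I_d => `|v k.1 k.2|) (isT : xpredT (0, j))).
Qed.

Lemma cube_compact M : compact (cube M : set 'rV[R]_d).
Proof.
rewrite (_ : cube M = [set v : 'rV[R]_d | forall i, `[(- M), M]%classic (v ord0 i)]); last first.
  apply/seteqP; split=> l lM k; have := lM k; rewrite /= in_itv/= ler_norml//.
by apply: (@rV_compact R d (fun=> `[(- M), M]%classic)) => _; exact: segment_compact.
Qed.

Lemma dcube_compact M : compact (ddiag @` cube M).
Proof.
apply: continuous_compact (@cube_compact M).
exact/continuous_subspaceT/ddiag_continuous.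
Qed.

Variable F : symmx R d -> R.
Hypothesis Finv : rotation_invariant F.
Local Notation f := (restrict_diag F).
Local Notation axis M i := (M *: ddiag (delta_mx 0 i)).

Lemma diag_transfer (N : nat) M e : (0 < N)%N -> 0 < M ->
  (forall i x, line_in (ddiag @` cube M) x (axis M i) ->
    papprox N e (fun u => f (x + u *: axis M i))) ->
  exists2 P, pol (d * N.*2) P &
    forall x, d%:R ^+ 2 * `|x| <= M -> `|F x - P x| <= tensor_const d * e.
Proof.
move=> N0 M0 H; apply: (transfer Finv N0 M0) => l i lM.
(* The line is based at the point with coordinate [i] equal to 0, so that [u] in [[-1, 1]] sweeps
   exactly the values in [[-M, M]]. *)
have E (u : R) : ddiag (upd l i (M * u)) = ddiag (upd l i 0) + u *: axis M i.
  rewrite scalerA addrC -ddiag_linear; congr ddiag; apply/rowP => k; rewrite !mxE eqxx/=.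
  by case: eqP => _; rewrite ?mulr1 ?mulr0 ?addr0 ?add0r// mulrC.
have [|p sp pe] := H i (ddiag (upd l i 0)).
  move=> u u1; exists (upd l i (M * u)); last by rewrite E.
  by apply: upd_cube => //; rewrite normrM (gtr0_norm M0) ler_piMr ?(ltW M0)// ler_norml.
exists (p \Po (M^-1 *: 'X)).
  by rewrite size_comp_poly2// size_scale ?size_polyX// invr_eq0 gt_eqF.
move=> t tM; have := pe (M^-1 * t); rewrite -E mulVKf ?gt_eqF//.
rewrite horner_comp hornerZ hornerX; apply.
by rewrite -ler_norml normrM normfV (gtr0_norm M0) mulrC ler_pdivrMr// mul1r.
Qed.

(** Half-side of a cube containing the eigenvalues of every [x] with [|x| < r]; the added 1 keeps it
    positive. *)
Let side (r : R) : R := d%:R ^+ 2 * `|r| + 1.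

Let side_gt0 r : 0 < side r.
Proof. by rewrite ltr_wpDl// mulr_ge0// exprn_ge0. Qed.

Let side_norm r (x : symmx R d) : `|x| < r -> d%:R ^+ 2 * `|x| <= side r.
Proof.
move=> xr; apply: (@le_trans _ _ (d%:R ^+ 2 * `|r|)); last by rewrite lerDl.
by apply: ler_wpM2l; [rewrite exprn_ge0|exact: le_trans (ltW xr) (ler_norm r)].
Qed.

(** The smooth and Holder cases differ only in how the rate along lines is obtained, and meet
    here. *)
Lemma holder_of_lines n (alpha : R) : 0 < alpha -> alpha < 1 ->
  (forall K w, compact K -> exists2 D : R, 0 <= D & forall x, line_in K x w ->
    forall k, papprox (n.+2 * 2 ^ k) (D * (2^-1 `^ alpha / 2 ^+ n) ^+ k) (fun u => f (x + u *: w))) ->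
  is_holder n alpha F.
Proof.
move=> a0 a1 H; apply: (@holder_of_pol _ _ F n (d * n.+2.*2) alpha) => // r.
have /choice[D HD] : forall i, exists D : R, 0 <= D /\
    forall x, line_in (ddiag @` cube (side r)) x (axis (side r) i) ->
    forall k, papprox (n.+2 * 2 ^ k) (D * (2^-1 `^ alpha / 2 ^+ n) ^+ k) (fun u => f (x + u *: axis (side r) i)).
  by move=> i; have [D D0 HD] := H _ (axis (side r) i) (@dcube_compact (side r)); exists D.
pose b : R := 2^-1 `^ alpha / 2 ^+ n.
have b0 : 0 <= b by rewrite divr_ge0 ?powR_ge0// exprn_ge0.
pose C := \sum_i D i.
have /choice[P HP] : forall k, exists P, pol (d * n.+2.*2 * 2 ^ k) P /\
    forall x, d%:R ^+ 2 * `|x| <= side r -> `|F x - P x| <= tensor_const d * (C * b ^+ k).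
  move=> k; have [|i x xK|P Pp PF] := @diag_transfer (n.+2 * 2 ^ k) (side r) (C * b ^+ k) _ (side_gt0 r).
  - by rewrite muln_gt0 expn_gt0.
  - apply: papprox_weak ((HD i).2 x xK k); first by [].
    rewrite ler_wpM2r ?exprn_ge0// /C (bigD1 i)//= lerDl sumr_ge0// => j _.
    exact: (HD j).1.
  by exists P; split=> //; rewrite -mulnA -doubleMl.
exists (tensor_const d * C), P; split=> [k|k x xr]; first exact: (HP k).1.
by rewrite -mulrA; apply: (HP k).2; exact: side_norm.
Qed.

Lemma invariant_holder n (alpha : R) : 0 < alpha -> alpha < 1 ->
  is_holder n alpha f -> is_holder n alpha F.
Proof.
move=> a0 a1 fH; apply: (holder_of_lines a0 a1) => K w cK.
exact: holder_lines.
Qed.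

Lemma invariant_smooth : is_Cinfty f -> is_Cinfty F.
Proof.
move=> fC n; have a0 : (0 : R) < 2^-1 by [].
have a1 : (2^-1 : R) < 1 by rewrite invf_lt1// ltr1n.
by apply: (proj1 (holder_of_lines a0 a1 _)) => K w cK; exact: smooth_lines.
Qed.

Lemma invariant_analytic : is_analytic f -> is_analytic F.
Proof.
move=> fa.
apply: analytic_of_pol => r.
have /choice[LC HLC] : forall i, exists LC : nat * R, [/\ (0 < LC.1)%N, 0 < LC.2 &
    forall x, line_in (ddiag @` cube (side r)) x (axis (side r) i) ->
    forall k, papprox (LC.1 * k) (LC.2 * 2 ^- k) (fun u => f (x + u *: axis (side r) i))].
  move=> i; have [L [C H]] := analytic_lines (axis (side r) i) (@dcube_compact (side r)) fa.
  by exists (L, C).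
pose L := (\sum_i (LC i).1)%N; pose C := \sum_i (LC i).2.
have L0 : (0 < L)%N.
  by rewrite /L (bigD1 ord0)//= addn_gt0; case: (HLC ord0) => ->.
(* The shift by one keeps the degree positive. The zero polynomial will stand at index 0, and [B]
   enters the final constant to cover its error. *)
have /choice[P HP] : forall k, exists P, pol (d * L.*2 * k.+1) P /\
    forall x, `|x| < r -> `|F x - P x| <= tensor_const d * (C * 2 ^- k.+1).
  move=> k; have [|i x xK|P Pp PF] := @diag_transfer (L * k.+1) (side r) (C * 2 ^- k.+1) _ (side_gt0 r).
  - by rewrite muln_gt0 L0.
  - have [_ C0 H] := HLC i; apply: papprox_weak (H x xK k.+1).
      by rewrite leq_mul2r /L [X in (_ <= X)%N](bigD1 i)//= leq_addr.
    rewrite ler_wpM2r ?invr_ge0 ?exprn_ge0// /C (bigD1 i)//= lerDl sumr_ge0// => j _.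
    by case: (HLC j) => _ /ltW.
  by exists P; split=> [|x /side_norm]; [rewrite -mulnA -doubleMl|exact: PF].
have [B PB] := pol_bounded r (HP 0%N).1.
exists (d * L.*2)%N, (tensor_const d * C + `|B|), (fun k => if k is k'.+1 then P k' else fun=> 0).
split; first by rewrite muln_gt0 double_gt0.
split=> [[|k]|[|k] x xr]; [exact: pol_cst|exact: (HP k).1| |].
- rewrite expr0 invr1 mulr1 subr0 -[F x](subrK (P 0%N x)).
  apply: le_trans (ler_normD _ _) _.
  have := le_trans (PB x xr) (ler_norm B); have := (HP 0%N).2 x xr.
  rewrite expr1 mulrA; have := normr_ge0 (F x - P 0%N x).
  by move: (`|F x - _|) (`|P 0%N x|) (`|B|) (tensor_const d * C) => y z t u; lra.
- apply: le_trans ((HP k).2 x xr) _; rewrite mulrA ler_wpM2r ?lerDl//.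
Qed.

End main.

Theorem corollary1 (R : realType) (d : nat) (d_ge1 : (1 <= d)%N)
    (F : symmx R d -> R) (Finv : rotation_invariant F) :
  [/\ is_Cinfty (restrict_diag F) -> is_Cinfty F,
      forall (n : nat) (alpha : R), 0 < alpha -> alpha < 1 ->
        is_holder n alpha (restrict_diag F) -> is_holder n alpha F &
      is_analytic (restrict_diag F) -> is_analytic F].
Proof.
case: d d_ge1 F Finv => // d' _ F Finv; split.
- exact: invariant_smooth.
- by move=> n alpha; exact: invariant_holder.
- exact: invariant_analytic.
Qed.
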